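(* The sequence $(A_k(q))_{k\geq0}$ defined below is the unique sequence of power series in $q$ satisfying: (a) each $A_k$ is a quasi-modular form of weight $2k$ and $\frac{d}{dG_2}A_k=2A_{k-1}$ (where $A_{-1}:=0$); (b) for every $n\geq0$ there exists a polynomial $p_n(k)$ of degree $2n$ such that for every $k\geq n$, \[ \big[A_k(q)\big]_{q^n}=\frac{1}{(-4)^k(2k+1)!!}\,p_n(k); \] (c) $A_0=1+O(q)$.
   Context: For even $k\geq 2$, $G_k(q)=-\frac{B_k}{2k}+\sum_{n\geq1}\sum_{d|n}d^{k-1}q^n$ ($B_k$ Bernoulli numbers); $G_k:=0$ for odd $k$. The algebra of quasi-modular forms is $\mathsf{QMod}=\mathbb{C}[G_2,G_4,G_6]$ (a free polynomial algebra), graded by weight with $G_k$ of weight $k$; $\frac{d}{dG_2}$ is the partial derivative with respect to the generator $G_2$. $[f]_{q^n}$ denotes the $q^n$-coefficient, $(2k+1)!!=(2k+1)(2k-1)\cdots3\cdot1$. Let $\wp(z)=z^{-2}+2\sum_{k\geq4}G_k\frac{z^{k-2}}{(k-2)!}$ as a formal Laurent series in $z$ with quasi-modular coefficients; let $(\wp-4G_2)^{1/2}$ be the unique formal square root of $\wp(z)-4G_2$ of the form $z^{-1}+O(z)$, and $(\wp-4G_2)^{k+\frac12}:=(\wp-4G_2)^k(\wp-4G_2)^{1/2}$. Define $A_k(q)=\frac{(-1)^k}{(2k+1)!!}\mathrm{Res}_{z=0}\left[(\wp(z)-4G_2)^{k+\frac12}\right]$, where $\mathrm{Res}_{z=0}$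 takes the coefficient of $z^{-1}$. *)

(* Defs.v *)
From HB Require Import structures.
From mathcomp Require Import all_boot all_order all_algebra.
From mathcomp Require Import mpoly.
Set Implicit Arguments. Unset Strict Implicit. Unset Printing Implicit Defensive.
Import Order.TTheory GRing.Theory Num.Theory.
Local Open Scope ring_scope.

(* Throughout, C is an arbitrary numClosedFieldType (algebraically closed
   characteristic-0 field with a norm); the complex numbers are an instance.
   A power series in q with coefficients in C is represented by its
   coefficient sequence  f : nat -> C  (f n = [f]_{q^n}). *)

(* ---------- Bernoulli numbers (B_0 = 1, B_1 = -1/2, B_2 = 1/6, ...) ----------
   via  sum_{j=0}^{m} C(m+1,j) B_j = 0  for m >= 1. *)
Fixpoint bern_seq (C : fieldType) (m : nat) : seq C :=
  match m with
  | 0 => [:: 1]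
  | m'.+1 =>
      let s := bern_seq C m' in
      rcons s (- (m'.+2%:R)^-1 *
               \sum_(j < m'.+1) ('C(m'.+2, j))%:R * s`_j)
  end.

Definition bernoulli (C : fieldType) (m : nat) : C := (bern_seq C m)`_m.

Definition Gcoef (C : fieldType) (k n : nat) : C :=
  if odd k then 0
  else if n == 0%N then - bernoulli C k / (k.*2)%:R
  else \sum_(d < n.+1 | (d %| n)%N) ((d : nat)%:R) ^+ k.-1.

Definition Gtrunc (C : fieldType) (k N : nat) : {poly C} :=
  \poly_(i < N.+1) Gcoef C k i.

(* ---------- quasi-modular forms: QMod = C[G2,G4,G6] ----------
   An element of QMod is a polynomial P in three variables 'X_0,'X_1,'X_2
   standing for G2, G4, G6.  Its q-expansion coefficient of q^n: *)
Definition qexp (C : fieldType) (P : {mpoly C[3]}) (n : nat) : C :=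
  (mmap (@polyC C) (fun i : 'I_3 => Gtrunc C (2 * i.+1) n) P)`_n.

Definition qmod_homog (C : fieldType) (w : nat) (P : {mpoly C[3]}) : Prop :=
  forall m, m \in msupp P -> (\sum_(i < 3) 2 * i.+1 * m i)%N = w.

Definition smul (R : ringType) (a b : nat -> R) : nat -> R :=
  fun j => \sum_(i < j.+1) a i * b (j - i)%N.

Definition spow (R : ringType) (a : nat -> R) (k : nat) : nat -> R :=
  iter k (smul a) (fun j => if j == 0%N then 1 else 0).

(* z^2 * wp(z), wp(z) = z^-2 + 2 sum_{k>=4} G_k z^(k-2)/(k-2)!,
   with q-coefficients truncated at order N *)
Definition wpz (C : fieldType) (N : nat) (j : nat) : {poly C} :=
  if j == 0%N then 1
  else if (4 <= j)%N then (2 / ((j - 2)`!)%:R) *: Gtrunc C j N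
  else 0.

(* z^2 * (wp(z) - 4 G_2) *)
Definition Fz (C : fieldType) (N : nat) (j : nat) : {poly C} :=
  wpz C N j - (if j == 2%N then 4 *: Gtrunc C 2 N else 0).

(* The unique power series S(z) = 1 + O(z) with S^2 = F (for F = 1 + O(z)):
   S_0 = 1,  S_m = (F_m - sum_{0<i<m} S_i S_{m-i}) / 2.
   Then (wp - 4G_2)^{1/2} = z^{-1} S(z) with F = Fz. *)
Fixpoint sqrt_seq (C : fieldType) (F : nat -> {poly C}) (m : nat) : seq {poly C} :=
  match m with
  | 0 => [:: 1]
  | m'.+1 =>
      let s := sqrt_seq F m' in
      rcons s ((2 : C)^-1 *: (F m - \sum_(1 <= i < m) s`_i * s`_(m - i)%N))
  end.

Definition sqrt_ser (C : fieldType) (F : nat -> {poly C}) (m : nat) : {poly C} :=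
  (sqrt_seq F m)`_m.

Fixpoint odd_dfact (k : nat) : nat :=
  match k with
  | 0 => 1%N
  | k'.+1 => (k.*2.+1 * odd_dfact k')%N
  end.

(* Res_{z=0} (wp - 4G_2)^{k+1/2} = Res z^{-2k-1} F^k S = [F^k S]_{z^{2k}},
   computed with q-expansions truncated at order N. *)
Definition res_trunc (C : fieldType) (k N : nat) : {poly C} :=
  smul (spow (Fz C N) k) (sqrt_ser (Fz C N)) (k.*2).

Definition A (C : fieldType) (k n : nat) : C :=
  (-1) ^+ k / (odd_dfact k)%:R * (res_trunc C k n)`_n.

Definition cond_a (C : fieldType) (B : nat -> nat -> C) : Prop :=
  forall k : nat, exists P : {mpoly C[3]},
    [/\ qmod_homog (k.*2) P,
        forall n, qexp P n = B k n &
        forall n, qexp (P^`M(ord0)) n = 2 * (if k is k'.+1 then B k' n else 0)].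

Definition cond_b (C : fieldType) (B : nat -> nat -> C) : Prop :=
  forall n : nat, exists p : {poly C},
    size p = (n.*2).+1 /\
    forall k : nat, (n <= k)%N ->
      B k n = p.[k%:R] / ((-4) ^+ k * (odd_dfact k)%:R).

Definition cond_c (C : fieldType) (B : nat -> nat -> C) : Prop := B 0%N 0%N = 1.

(* Main.v *)
(* Everything happens in formal power series. The bijection
   [a x + b y = a (x - y) + (a + b) y] on solutions of [a x + b y = n] gives two families of
   convolution identities for divisor sums: one yields Ramanujan's equations for the
   derivatives of E2, E4, E6, the other the second order equation of the Weierstrass
   function, which expresses every G_k by G_4 and G_6. Hence A_k is quasi-modular, and
   d/dG_2 of (wp - 4 G_2)^(k+1/2) gives (a).

   For (b), put t = tanh(z/2). Then wp - 4 G_2 = (1 + N) / (4 t^2), where the q^n-coefficient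
   of N is a polynomial in t^2 divided by (1 - t^2)^n. Since dz = 2 dt / (1 - t^2), the residue
   becomes a Taylor coefficient of a rational function of t^2 with denominator
   (1 - t^2)^(n+1), multiplied by binomial coefficients in k.

   Uniqueness is by induction on k. By (a) and the algebraic independence of E2, E4, E6 two
   solutions differ in index k by a modular form of weight 2k; p_n is determined by the
   indices n, ..., 3n, so the q^n-coefficients with 3n < k agree; and a modular form of weight
   2k vanishing to that order is 0.

   With e = E4^(1/2), X = E2/e, Y = E6/e^3 and Y = 1 - 864 q + ..., a modular form is
   essentially a polynomial p(Y), of order at q = 0 equal to the multiplicity of its root 1,
   and p is even or odd; this bounds the order. For independence, a relation F(X, Y) = 0 of
   minimal degree r in X is mapped to c(Y) F by the derivation 12 e^-1 q d/dq plus r X.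
   Comparing both sides at Y = 1, at Y = -1 and on the part of F of top weight (X of weight 1,
   Y of weight 3) forces r = 0. *)
Require Import Defs.
From HB Require Import structures.
From mathcomp Require Import all_boot all_order all_algebra.
From mathcomp Require Import mpoly.
From mathcomp Require Import boolp.
From mathcomp Require Import ring zify.
Set Implicit Arguments. Unset Strict Implicit. Unset Printing Implicit Defensive.
Import Order.TTheory GRing.Theory Num.Theory.
Local Open Scope ring_scope.

(** * Formal power series *)

(** Independence and the valence bound are usually proved with the action of the modular group. Only
    q-expansions are available here, so both are drawn from Ramanujan's equations. With D = q d/dq
    these become, in weight 0, 12 e^-1 D X = -(X^2 - 2XY + 1) and 12 e^-1 D Y = 6(Y^2 - 1). At Y = 1
    and Y = -1 the quadratic is a square, and comparing orders at its double root gives c(1) = r and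
    c(-1) = -r. The top weight w of F makes c linear with slope 2w. Hence 2w = r, while w >= r
    because F has degree r in X; so r = 0. For the valence bound, p has degree at most k/3 and the
    root 1 of multiplicity at least k/3, so p is a multiple of a power of Y - 1; a positive power is
    neither even nor odd. The range 3n < k needed there is the one that (b) supplies, since p_n has
    2n + 1 coefficients and is known on n, ..., 3n. *)

Record fps (R : Type) := Fps { fcoef :> nat -> R }.

HB.instance Definition _ (R : Type) := gen_eqMixin (fps R).
HB.instance Definition _ (R : Type) := gen_choiceMixin (fps R).

Lemma fpsP (R : Type) (f g : fps R) : f =1 g -> f = g.
Proof. by case: f g => [f] [g] /= /funext ->. Qed.

Section FpsRing.
Variable R : comNzRingType.
Implicit Types f g h : fps R.

Definition fps0 := Fps (fun _ : nat => 0 : R).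
Definition fpsD f g := Fps (fun n => f n + g n).
Definition fpsN f := Fps (fun n => - f n).
Definition fpsC (c : R) := Fps (fun n => if n == 0%N then c else 0).
Definition fpsM f g := Fps (fun n => \sum_(i < n.+1) f i * g (n - i)%N).

Lemma fpsDA : associative fpsD.
Proof. by move=> f g h; apply: fpsP => n /=; rewrite addrA. Qed.

Lemma fpsDC : commutative fpsD.
Proof. by move=> f g; apply: fpsP => n /=; rewrite addrC. Qed.

Lemma fps0D : left_id fps0 fpsD.
Proof. by move=> f; apply: fpsP => n /=; rewrite add0r. Qed.

Lemma fpsND : left_inverse fps0 fpsN fpsD.
Proof. by move=> f; apply: fpsP => n /=; rewrite addNr. Qed.

HB.instance Definition _ := GRing.isZmodule.Build (fps R) fpsDA fpsDC fps0D fpsND.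

Lemma fpsMC : commutative fpsM.
Proof.
move=> f g; apply: fpsP => n /=; rewrite (reindex_inj rev_ord_inj) /=.
apply: eq_bigr => i _; rewrite mulrC subSS subKn //.
by rewrite -ltnS.
Qed.

Lemma fps1M : left_id (fpsC 1) fpsM.
Proof.
move=> f; apply: fpsP => n /=; rewrite big_ord_recl /= mul1r subn0.
by rewrite big1 ?addr0 // => i _; rewrite mul0r.
Qed.

Lemma fpsMDl : left_distributive fpsM fpsD.
Proof.
move=> f g h; apply: fpsP => n /=; rewrite -big_split /=.
by apply: eq_bigr => i _; rewrite mulrDl.
Qed.

(** Coefficients up to [N] only see polynomials, so associativity can be inherited from
    [{poly R}]. *)
Lemma coef_mul_poly_trunc f g n N : (n <= N)%N ->
  fpsM f g n = (\poly_(i < N.+1) f i * \poly_(i < N.+1) g i)`_n.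
Proof.
move=> nN; rewrite coefM /=; apply: eq_bigr => i _; rewrite !coef_poly.
have lei : (i <= n)%N by rewrite -ltnS.
by rewrite !ltnS (leq_trans lei nN) (leq_trans (leq_subr _ _) nN).
Qed.

Lemma fpsMA : associative fpsM.
Proof.
move=> f g h; apply: fpsP => n.
have tr (a b : {poly R}) : (forall i, (i <= n)%N -> a`_i = b`_i) ->
    forall c : {poly R}, (a * c)`_n = (b * c)`_n.
  move=> ab c; rewrite !coefM; apply: eq_bigr => i _.
  by rewrite ab // -ltnS.
have mulE (a b : fps R) : (forall i, (i <= n)%N -> (\poly_(i < n.+1) fpsM a b i)`_i =
    (\poly_(i < n.+1) a i * \poly_(i < n.+1) b i)`_i).
  by move=> i lein; rewrite coef_poly ltnS lein (@coef_mul_poly_trunc _ _ _ n).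
rewrite !(@coef_mul_poly_trunc _ _ n n) // mulrC.
by rewrite (tr _ _ (mulE g h)) (tr _ _ (mulE f g)) mulrC mulrA.
Qed.

Lemma fps1_neq0 : fpsC 1 != 0.
Proof.
apply/eqP => /(congr1 (fun f : fps R => f 0%N)) /= /eqP.
by rewrite oner_eq0.
Qed.

HB.instance Definition _ := GRing.Zmodule_isComNzRing.Build (fps R)
  fpsMA fpsMC fps1M fpsMDl fps1_neq0.

Lemma fps_addE f g n : (f + g) n = f n + g n. Proof. by []. Qed.
Lemma fps_oppE f n : (- f) n = - f n. Proof. by []. Qed.
Lemma fps_subE f g n : (f - g) n = f n - g n. Proof. by []. Qed.
Lemma fps_mulE f g n : (f * g) n = \sum_(i < n.+1) f i * g (n - i)%N.
Proof. by []. Qed.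
Lemma fps_0E n : (0 : fps R) n = 0. Proof. by []. Qed.
Lemma fps_1E n : (1 : fps R) n = (n == 0%N)%:R.
Proof. by rewrite /=; case: eqP. Qed.
Lemma fpsCE c n : fpsC c n = if n == 0%N then c else 0. Proof. by []. Qed.

Lemma fps_sumE (I : Type) (r : seq I) (P : pred I) (F : I -> fps R) n :
  (\sum_(i <- r | P i) F i) n = \sum_(i <- r | P i) F i n.
Proof.
by elim/big_rec2: _ => [|i y x _ <-]; rewrite ?fps_0E ?fps_addE.
Qed.

Fact fpsC_additive : zmod_morphism fpsC.
Proof.
by move=> a b; apply: fpsP => n; rewrite fps_subE !fpsCE; case: eqP; rewrite ?subr0.
Qed.

Fact fpsC_multiplicative : monoid_morphism fpsC.
Proof.
split=> // a b; apply: fpsP => n; rewrite fps_mulE big_ord_recl subn0 /=.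
rewrite big1 ?addr0 => [|i _]; last by rewrite mul0r.
by case: eqP; rewrite ?mulr0.
Qed.

HB.instance Definition _ := GRing.isZmodMorphism.Build R (fps R) fpsC fpsC_additive.
HB.instance Definition _ :=
  GRing.isMonoidMorphism.Build R (fps R) fpsC fpsC_multiplicative.

Lemma fpsC_mulE c f n : (fpsC c * f) n = c * f n.
Proof.
rewrite fps_mulE big_ord_recl subn0 /= big1 ?addr0 // => i _.
by rewrite mul0r.
Qed.

Lemma fps_natr_mulE k f n : (k%:R * f) n = k%:R * f n.
Proof. by rewrite -(rmorph_nat fpsC) fpsC_mulE. Qed.

Lemma fps_natrE k n : (k%:R : fps R) n = if n == 0%N then k%:R else 0.
Proof. by rewrite -(rmorph_nat fpsC). Qed.

Lemma fpsC_exp c k : fpsC (c ^+ k) = fpsC c ^+ k.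
Proof. exact: rmorphXn. Qed.

Definition fpsXn (k : nat) : fps R := Fps (fun n => (n == k)%:R).

Lemma fpsXn_mulE k f n : (fpsXn k * f) n = if (k <= n)%N then f (n - k)%N else 0.
Proof.
rewrite fps_mulE; case: leqP => [lekn|ltnk].
  rewrite (bigD1 (inord k)) //= inordK // eqxx mul1r big1 ?addr0 // => i.
  rewrite -val_eqE /= inordK // => /negbTE ->.
  by rewrite mul0r.
rewrite big1 // => i _ /=; case: eqP => [eik|]; rewrite ?mul0r //.
by have := ltn_ord i; rewrite eik ltnS leqNgt ltnk.
Qed.

Lemma fpsXnD j k : fpsXn (j + k) = fpsXn j * fpsXn k.
Proof.
apply: fpsP => n; rewrite fpsXn_mulE /=; case: leqP => [le|lt].
  by congr (_ %:R); rewrite -{1}(subnKC le) eqn_add2l.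
by case: eqP => // en; move: lt; rewrite en ltnNge leq_addr.
Qed.

Lemma fpsXnM j k : fpsXn (j * k) = fpsXn j ^+ k.
Proof.
elim: k => [|k IH]; last by rewrite mulnS fpsXnD IH exprS.
by rewrite muln0 expr0; apply: fpsP => n; rewrite fps_1E.
Qed.

Lemma coef0_mul f g : (f * g) 0%N = f 0%N * g 0%N.
Proof. by rewrite fps_mulE big_ord1. Qed.

Lemma coef0_exp f k : (f ^+ k) 0%N = f 0%N ^+ k.
Proof. by elim: k => [|k IH]; rewrite ?fps_1E // !exprS coef0_mul IH. Qed.

(** [f] is divisible by the variable, so [f ^+ m] starts in degree [m]: the two cases are its
    leading coefficient and its vanishing below. *)
Lemma fps_ord_pow f g m n : f 0%N = 0 -> (n <= m)%N ->
  (f ^+ m * g) n = if n == m then f 1%N ^+ m * g 0%N else 0.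
Proof.
move=> f0 lenm; pose f' := Fps (fun n => f n.+1).
have ff' : f = fpsXn 1 * f' by apply: fpsP => -[|i]; rewrite fpsXn_mulE // subn1.
rewrite ff' exprMn -mulrA -fpsXnM mul1n fpsXn_mulE eqn_leq lenm.
case: (leqP m n) => // lemn; rewrite (_ : n - m = 0)%N ?coef0_mul ?coef0_exp; last by lia.
by rewrite fpsXn_mulE.
Qed.

Lemma fps_mul_coef f g n : (0 < n)%N ->
  (f * g) n = f 0%N * g n + f n * g 0%N + \sum_(1 <= i < n) f i * g (n - i)%N.
Proof.
case: n => // n _; rewrite fps_mulE big_ord_recr big_ord_recl /= subn0 subnn.
rewrite big_add1 /= big_mkord /bump /=.
by under eq_bigr do rewrite add1n; ring.
Qed.

(* Euler's operator [X d/dX]; using it instead of [d/dX] avoids all index shifts. *)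
Definition euler f : fps R := Fps (fun n => n%:R * f n).

Lemma eulerE f n : euler f n = n%:R * f n. Proof. by []. Qed.

Fact euler_additive : zmod_morphism euler.
Proof. by move=> f g; apply: fpsP => n; rewrite fps_subE !eulerE fps_subE mulrBr. Qed.

HB.instance Definition _ :=
  GRing.isZmodMorphism.Build (fps R) (fps R) euler euler_additive.

Lemma eulerM f g : euler (f * g) = euler f * g + f * euler g.
Proof.
apply: fpsP => n; rewrite fps_addE eulerE !fps_mulE mulr_sumr -big_split /=.
apply: eq_bigr => i _.
have lei : (i <= n)%N by rewrite -ltnS.
by rewrite -{1}(subnKC lei) natrD mulrDl mulrA mulrCA.
Qed.

Lemma eulerC c : euler (fpsC c) = 0.
Proof.
by apply: fpsP => n; rewrite eulerE fpsCE; case: eqP => [->|_]; rewrite ?mul0r ?mulr0.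
Qed.

Lemma euler_natr k : euler k%:R = 0.
Proof. by rewrite -(rmorph_nat fpsC) eulerC. Qed.

Lemma euler1 : euler 1 = 0.
Proof. exact: (euler_natr 1). Qed.

Lemma euler_fpsCM c f : euler (fpsC c * f) = fpsC c * euler f.
Proof. by rewrite eulerM eulerC mul0r add0r. Qed.

Lemma euler_natrM k f : euler (k%:R * f) = k%:R * euler f.
Proof. by rewrite -(rmorph_nat fpsC) euler_fpsCM. Qed.

Lemma eulerXn k : euler (fpsXn k) = k%:R * fpsXn k.
Proof.
apply: fpsP => n; rewrite eulerE fps_natr_mulE /=.
by case: eqP => [->|]; rewrite ?mulr0.
Qed.

Lemma eulerX f k : euler (f ^+ k.+1) = k.+1%:R * f ^+ k * euler f.
Proof.
elim: k => [|k IH]; first by rewrite expr1 expr0; ring.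
by rewrite exprS eulerM IH -(natr1 k.+1) !exprS; ring.
Qed.

(** The hypothesis says that [Phi] computes coefficient [n] from the earlier ones. Hence coefficient
    [n] is the same in all iterates from the one of index [n.+1] on, and these stable values form a
    fixed point. *)
Lemma fps_rec (Phi : (nat -> R) -> nat -> R) :
  (forall (u v : nat -> R) n, (forall i, (i < n)%N -> u i = v i) -> Phi u n = Phi v n) ->
  exists f : fps R, forall n, f n = Phi f n.
Proof.
move=> causal; pose it k := iter k Phi (fun _ => 0).
have stable n : forall k, (n < k)%N -> it k n = it n.+1 n.
  elim/ltn_ind: n => n IH [//|k] ltnk.
  apply: (causal (it k) (it n)) => i ltin.
  by rewrite !IH // (leq_trans ltin).
exists (Fps (fun n => it n.+1 n)) => n /=.
apply: (causal (it n)) => i ltin.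
by rewrite stable.
Qed.

Lemma fps_inv_exists f (c : R) : f 0%N * c = 1 -> exists g : fps R, f * g = 1.
Proof.
move=> f0c.
pose Phi (g : nat -> R) n := c * ((n == 0%N)%:R - \sum_(i < n) f i.+1 * g (n - i.+1)%N).
have [|g gE] := fps_rec (Phi := Phi).
  move=> u v n equv; rewrite /Phi; congr (_ * (_ - _)).
  apply: eq_bigr => i _; rewrite equv //.
  by have := ltn_ord i; lia.
exists g; apply: fpsP => n; rewrite fps_mulE fps_1E big_ord_recl subn0 /=.
by rewrite [X in _ * X]gE /Phi mulrA f0c mul1r subrK.
Qed.

(** Isolates the two terms containing [g n]. This is the recursion of [sqrt_seq], so
    [fps_sqrt_intro] can recognise that sequence as a square root. *)
Lemma fps_sqrt_coef f g n : (0 < n)%N -> g 0%N = 1 -> g * g = f ->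
  2 * g n = f n - \sum_(1 <= i < n) g i * g (n - i)%N.
Proof.
case: n => // n _ g0 <-; rewrite fps_mulE big_ord_recr big_ord_recl /=.
rewrite g0 subn0 subnn g0 big_add1 /= big_mkord /bump /=.
by under eq_bigr do rewrite add1n; ring.
Qed.

Lemma fps_sqrt_intro f g : f 0%N = 1 -> g 0%N = 1 ->
  (forall n, (0 < n)%N -> 2 * g n = f n - \sum_(1 <= i < n) g i * g (n - i)%N) ->
  g * g = f.
Proof.
move=> f0 g0 grec; apply: fpsP => -[|n]; first by rewrite coef0_mul g0 f0 mulr1.
by have := grec n.+1 isT; rewrite (fps_sqrt_coef _ g0 (erefl _)) // => /addIr.
Qed.

Lemma fps_sqrt_exists f (c : R) : 2 * c = 1 -> f 0%N = 1 ->
  exists g : fps R, g 0%N = 1 /\ g * g = f.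
Proof.
move=> c2 f0.
pose Phi (g : nat -> R) n := if n == 0%N then 1 else
  c * (f n - \sum_(1 <= i < n) g i * g (n - i)%N).
have [|g gE] := fps_rec (Phi := Phi).
  move=> u v n equv; rewrite /Phi; case: eqP => // _; congr (_ * (_ - _)).
  by rewrite !big_nat; apply: eq_bigr => i /andP[i0 ltin]; rewrite !equv //; lia.
have g0 : g 0%N = 1 by rewrite gE.
exists g; split=> //; apply: fps_sqrt_intro => // -[|n] // _.
by rewrite [X in 2 * X]gE /Phi /= mulrA c2 mul1r.
Qed.

(** [I] is an ideal of the coefficient ring. For the multiples of q^(N+1) this says that truncating
    before multiplying is harmless. *)
Lemma fps_mul_congr (I : R -> Prop) f f' g g' :
  I 0 -> (forall a b, I a -> I b -> I (a + b)) -> (forall a b, I b -> I (a * b)) ->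
  (forall n, I (f n - f' n)) -> (forall n, I (g n - g' n)) ->
  forall n, I ((f * g) n - (f' * g') n).
Proof.
move=> I0 ID IM If Ig n; rewrite !fps_mulE -sumrB; apply: big_ind => // i _.
have -> : f i * g (n - i)%N - f' i * g' (n - i)%N =
  f i * (g (n - i)%N - g' (n - i)%N) + g' (n - i)%N * (f i - f' i) by ring.
by apply: ID; apply: IM.
Qed.

(* Uniqueness of square roots modulo an ideal [I] of the coefficient ring; [I = 0]
   and [I = (q^(N+1))] are the cases of interest. *)
Lemma fps_sqrt_unique (I : R -> Prop) (c : R) (f g : fps R) :
  I 0 -> (forall a b, I a -> I b -> I (a - b)) -> (forall a b, I b -> I (a * b)) ->
  2 * c = 1 -> f 0%N = 1 -> g 0%N = 1 ->
  (forall n, I ((f * f) n - (g * g) n)) -> forall n, I (f n - g n).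
Proof.
move=> I0 IB IM c2 f0 g0 Ifg n.
have IN a : I a -> I (- a) by move=> ?; rewrite -sub0r; apply: IB.
have ID a b : I a -> I b -> I (a + b).
  by move=> ? ?; rewrite -[b]opprK; apply: IB => //; apply: IN.
elim/ltn_ind: n => -[|n] IH; first by rewrite f0 g0 subrr.
have -> : f n.+1 - g n.+1 = c * (2 * f n.+1 - 2 * g n.+1).
  by rewrite -mulrBr mulrA [c * _]mulrC c2 mul1r.
apply: (IM); rewrite !(@fps_sqrt_coef _ _ n.+1 _ _ (erefl _)) //.
set a := \sum_(1 <= i < _) _; set b := \sum_(1 <= i < _) _.
have -> : (f * f) n.+1 - a - ((g * g) n.+1 - b) =
  ((f * f) n.+1 - (g * g) n.+1) - (a - b) by ring.
apply: (IB) => //; rewrite /a /b -sumrB big_nat.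
apply: big_ind => // i /andP[i0 ltin].
have -> : f i * f (n.+1 - i)%N - g i * g (n.+1 - i)%N =
  f i * (f (n.+1 - i)%N - g (n.+1 - i)%N) + g (n.+1 - i)%N * (f i - g i) by ring.
by apply: ID; apply: IM; apply: IH; lia.
Qed.

End FpsRing.

Lemma fps_mul_eq0 (R : idomainType) (f g : fps R) : f * g = 0 -> f <> 0 -> g = 0.
Proof.
move=> fg0 fN0.
have exf : exists n, f n != 0.
  apply: contrapT => nex; apply: fN0; apply: fpsP => n.
  by rewrite fps_0E; apply/eqP/negP => /negP fn; apply: nex; exists n.
case: (ex_minnP exf) => m fm minm.
(* If [m] is the order of [f] and [g] vanishes below [n], the coefficient of [f * g] in degree
   [m + n] reduces to [f m * g n]. *)
apply: fpsP; elim/ltn_ind => n IH; rewrite fps_0E.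
have /eqP : (f * g) (m + n)%N = 0 by rewrite fg0.
have lem : (m < (m + n).+1)%N by rewrite ltnS leq_addr.
rewrite fps_mulE (bigD1 (Ordinal lem)) //= big1 ?addr0 => [|i].
  by rewrite addKn mulf_eq0 (negbTE fm) => /eqP.
rewrite -val_eqE /= => im; have ltimn := ltn_ord i.
case: (ltnP i m) => [ltim|leim].
  case: (eqVneq (f i) 0) => [->|/minm]; first by rewrite mul0r.
  by rewrite leqNgt ltim.
by rewrite IH ?fps_0E ?mulr0 //; lia.
Qed.

(** * Coefficientwise gradings *)

Section Graded.
Variables (R : comNzRingType) (G : nat -> R -> Prop).
Hypotheses (G0 : forall n, G n 0) (G1 : G 0 1).
Hypothesis GB : forall n a b, G n a -> G n b -> G n (a - b).
Hypothesis GM : forall i j a b, G i a -> G j b -> G (i + j) (a * b).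

(** Used for series in z, with [G n] the quasi-modular polynomials of weight n, and for series in q,
    with [G n] the rational functions of t^2 = tanh(z/2)^2 with denominator (1 - t^2)^n. *)
Definition graded (f : fps R) := forall n, G n (f n).

Lemma graded_sum n (I : Type) (r : seq I) (p : pred I) (F : I -> R) :
  (forall i, p i -> G n (F i)) -> G n (\sum_(i <- r | p i) F i).
Proof.
move=> hF; apply: big_ind => // a b ha hb.
by rewrite -[b]opprK -[- b]sub0r; do ?apply: GB.
Qed.

Lemma graded_mul (f g : fps R) : graded f -> graded g -> graded (f * g).
Proof.
move=> hf hg n; rewrite fps_mulE; apply: graded_sum => i _.
have lein : (i <= n)%N by rewrite -ltnS.
by rewrite -[X in G X _](subnKC lein); apply: GM.
Qed.

Lemma graded_exp (f : fps R) k : graded f -> graded (f ^+ k).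
Proof.
move=> hf; elim: k => [|k IH]; last by rewrite exprS; apply: graded_mul.
by rewrite expr0 => -[|n]; rewrite fps_1E.
Qed.

(** Every product in the recursion for coefficient [n] of a square root has weight [n]; closure
    under multiplication by [c] covers the division by 2. *)
Lemma graded_sqrt (c : R) (f : fps R) : 2 * c = 1 -> (forall n a, G n a -> G n (c * a)) ->
  f 0%N = 1 -> graded (f * f) -> graded f.
Proof.
move=> c2 Gc f0 hf; elim/ltn_ind => -[|n] IH; first by rewrite f0.
have -> : f n.+1 = c * (2 * f n.+1) by rewrite mulrA [c * 2]mulrC c2 mul1r.
rewrite (fps_sqrt_coef _ f0 (erefl _)) //; apply/Gc/GB; first exact: hf.
rewrite big_nat; apply: graded_sum => i /andP[i0 ltin].
rewrite -[X in G X](subnKC (ltnW ltin)).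
by apply: GM; apply: IH; lia.
Qed.

End Graded.

(** * Change of coefficients, exchange of the two variables *)

Section FpsMap.
Variables (R S : comNzRingType) (phi : {rmorphism R -> S}).

Definition map_fps (f : fps R) : fps S := Fps (fun n => phi (f n)).

Lemma map_fpsE f n : map_fps f n = phi (f n). Proof. by []. Qed.

Fact map_fps_additive : zmod_morphism map_fps.
Proof. by move=> f g; apply: fpsP => n; rewrite /= rmorphB. Qed.

Fact map_fps_multiplicative : monoid_morphism map_fps.
Proof.
split=> [|f g]; apply: fpsP => n; first by rewrite map_fpsE !fps_1E rmorph_nat.
rewrite map_fpsE !fps_mulE rmorph_sum; apply: eq_bigr => i _.
by rewrite rmorphM.
Qed.

HB.instance Definition _ :=
  GRing.isZmodMorphism.Build (fps R) (fps S) map_fps map_fps_additive.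
HB.instance Definition _ :=
  GRing.isMonoidMorphism.Build (fps R) (fps S) map_fps map_fps_multiplicative.

End FpsMap.

Section FpsSwap.
Variable R : comNzRingType.

(** The outer variable is z where weights are counted, and q where equations in z are solved
    coefficient by coefficient; this passes from one view to the other. *)
Definition swap_fps (f : fps (fps R)) : fps (fps R) := Fps (fun n => Fps (fun j => f j n)).

Lemma swap_fpsE f n j : swap_fps f n j = f j n. Proof. by []. Qed.

Fact swap_fps_additive : zmod_morphism swap_fps.
Proof. by move=> f g; apply: fpsP => n; apply: fpsP => j. Qed.

Fact swap_fps_multiplicative : monoid_morphism swap_fps.
Proof.
split=> [|f g]; apply: fpsP => n; apply: fpsP => j.
  by case: n j => [|n] [|j].
rewrite swap_fpsE !fps_mulE !fps_sumE.
under eq_bigr do rewrite fps_mulE.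
under [RHS]eq_bigr do rewrite fps_mulE.
by rewrite exchange_big.
Qed.

HB.instance Definition _ :=
  GRing.isZmodMorphism.Build _ _ swap_fps swap_fps_additive.
HB.instance Definition _ :=
  GRing.isMonoidMorphism.Build _ _ swap_fps swap_fps_multiplicative.

End FpsSwap.

(** * Convolution sums *)

(** Positivity of the four unknowns in a x + b y = n bounds them all by n, so the finite search
    misses no solution. *)
Definition quads (n : nat) : seq ((nat * nat) * (nat * nat)) :=
  let pairs := [seq (a, b) | a <- iota 1 n, b <- iota 1 n] in
  [seq q <- [seq (u, v) | u <- pairs, v <- pairs] |
     q.1.1 * q.2.1 + q.1.2 * q.2.2 == n]%N.

Lemma quads_uniq n : uniq (quads n).
Proof.
apply: filter_uniq; apply: allpairs_uniq; last by move=> [? ?] [? ?].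
  by apply: allpairs_uniq; rewrite ?iota_uniq // => -[? ?] [? ?].
by apply: allpairs_uniq; rewrite ?iota_uniq // => -[? ?] [? ?].
Qed.

Lemma mem_quads n a b x y :
  (((a, b), (x, y)) \in quads n) =
  [&& 0 < a, 0 < b, 0 < x, 0 < y & a * x + b * y == n]%N.
Proof.
rewrite mem_filter /=; case: eqP => /= [eqn|]; last by rewrite !andbF.
have mem_pairs c d : ((c, d) \in [seq (c, d) | c <- iota 1 n, d <- iota 1 n]) =
    [&& 0 < c, c <= n, 0 < d & d <= n]%N.
  apply/allpairsP/idP => [[[c' d'] /= [+ + [-> ->]]]|].
    by rewrite !mem_iota !add1n !ltnS => /andP[-> ->] /andP[-> ->].
  by move=> h; exists (c, d); rewrite /= !mem_iota !add1n !ltnS; move: h; case/and4P=> -> -> -> ->.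
have -> : (((a, b), (x, y)) \in [seq (u, v) |
    u <- [seq (a, b) | a <- iota 1 n, b <- iota 1 n],
    v <- [seq (a, b) | a <- iota 1 n, b <- iota 1 n]]) =
    ((a, b) \in [seq (a, b) | a <- iota 1 n, b <- iota 1 n]) &&
    ((x, y) \in [seq (a, b) | a <- iota 1 n, b <- iota 1 n]).
  apply/allpairsP/andP => [[[u v] /= [? ? [-> ->]]]|[? ?]]; first by split.
  by exists ((a, b), (x, y)).
rewrite !mem_pairs andbT; apply/idP/idP => [/and5P[]|].
  by lia.
by case/and4P=> a0 b0 x0 y0; nia.
Qed.

Section QuadSums.
Variable V : zmodType.
Implicit Types p w : nat -> nat -> V.

Definition qswap (q : (nat * nat) * (nat * nat)) := ((q.1.2, q.1.1), (q.2.2, q.2.1)).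

Lemma sum_quads_swap n (P : pred ((nat * nat) * (nat * nat))) F :
  \sum_(q <- quads n | P (qswap q)) F (qswap q) = \sum_(q <- quads n | P q) F q :> V.
Proof.
transitivity (\sum_(q <- map qswap (quads n) | P q) F q); first by rewrite big_map.
apply: perm_big; apply: uniq_perm; rewrite ?map_inj_uniq ?quads_uniq //.
  by move=> [[? ?] [? ?]] [[? ?] [? ?]] [-> -> -> ->].
move=> [[a b] [x y]]; rewrite mem_quads; apply/mapP/idP.
  move=> [[[a' b'] [x' y']] + [-> -> -> ->]]; rewrite mem_quads.
  by case/and5P=> -> -> -> -> /=; rewrite addnC.
case/and5P=> a0 b0 x0 y0 eqn; exists ((b, a), (y, x)) => //.
by rewrite mem_quads a0 b0 x0 y0 addnC.
Qed.

(* The bijection behind Skoruppa's combinatorial proof of Eisenstein series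
   identities: [a x + b y = a (x - y) + (a + b) y]. *)
Lemma sum_quads_shear n w :
  \sum_(q <- quads n | (q.2.2 < q.2.1)%N) w q.1.1 (q.1.1 + q.1.2)%N =
  \sum_(q <- quads n | (q.1.1 < q.1.2)%N) w q.1.1 q.1.2.
Proof.
pose s (q : (nat * nat) * (nat * nat)) :=
  ((q.1.1, q.1.1 + q.1.2), (q.2.1 - q.2.2, q.2.2))%N.
rewrite -big_filter -[RHS]big_filter.
pose r := [seq q <- quads n | (q.2.2 < q.2.1)%N].
transitivity (\sum_(q <- map s r) w q.1.1 q.1.2); rewrite /r.
  by rewrite big_map.
apply: perm_big; apply: uniq_perm; rewrite ?(filter_uniq _ (quads_uniq n)) //.
  rewrite map_inj_in_uniq ?(filter_uniq _ (quads_uniq n)) //.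
  move=> [[a b] [x y]] [[a' b'] [x' y']]; rewrite !mem_filter /= => /andP[lt1 _] /andP[lt2 _].
  by case=> ea eb ex ey; have -> : a = a' by []; congr ((_, _), (_, _)); lia.
move=> [[a b] [x y]]; rewrite mem_filter mem_quads /=; apply/mapP/idP.
  move=> [[[a' b'] [x' y']]]; rewrite mem_filter mem_quads /=.
  move=> /andP[lt /and5P[a0 b0 x0 y0 /eqP eqn]] [-> -> -> ->].
  by apply/and5P; split; rewrite ?subn_gt0 ?y0 ?x0 ?a0 ?addn_gt0 ?a0 -?eqn //; lia || nia.
case/andP=> ltab /and5P[a0 b0 x0 y0 /eqP eqn].
exists ((a, b - a), (x + y, y))%N; last by rewrite /s /= subnKC ?addnK // ltnW.
rewrite mem_filter mem_quads /= a0 y0 subn_gt0 ltab addn_gt0 x0 /=.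
apply/andP; split; first by lia.
by apply/eqP; nia.
Qed.

(** Split the left sum by x > y, x = y, x < y and the first sum on the right by a < b, a = b, a > b.
    The shear matches x > y with a < b, its mirror image matches x < y with a > b, and the two
    diagonals remain. *)
Lemma sum_quads_unfold n p w :
  (forall a b, p a b = p b a) -> (forall a b, w a b = w b a) ->
  (forall a b, p a b = w a (a + b)%N) ->
  \sum_(q <- quads n) p q.1.1 q.1.2 =
  \sum_(q <- quads n) w q.1.1 q.1.2
  - \sum_(q <- quads n | q.1.1 == q.1.2) w q.1.1 q.1.1
  + \sum_(q <- quads n | q.2.1 == q.2.2) p q.1.1 q.1.2.
Proof.
move=> pC wC pw.
have split3 (F : (nat * nat) * (nat * nat) -> V) (k l : (nat * nat) * (nat * nat) -> nat) :
    \sum_(q <- quads n) F q = \sum_(q <- quads n | k q == l q) F q +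
      (\sum_(q <- quads n | (k q < l q)%N) F q + \sum_(q <- quads n | (l q < k q)%N) F q).
  rewrite (bigID (fun q => k q == l q)) /=; congr (_ + _).
  rewrite (bigID (fun q => k q < l q)%N) /=.
  by congr (_ + _); apply: eq_bigl => q; case: ltngtP.
rewrite (split3 _ (fun q => q.2.1) (fun q => q.2.2)).
rewrite [in RHS](split3 _ (fun q => q.1.1) (fun q => q.1.2)).
have -> : \sum_(q <- quads n | q.1.1 == q.1.2) w q.1.1 q.1.1 =
          \sum_(q <- quads n | q.1.1 == q.1.2) w q.1.1 q.1.2.
  by apply: eq_bigr => q /eqP <-.
have hgt : \sum_(q <- quads n | (q.2.2 < q.2.1)%N) p q.1.1 q.1.2 =
           \sum_(q <- quads n | (q.1.1 < q.1.2)%N) w q.1.1 q.1.2.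
  by rewrite -sum_quads_shear; apply: eq_bigr.
have hlt : \sum_(q <- quads n | (q.2.1 < q.2.2)%N) p q.1.1 q.1.2 =
           \sum_(q <- quads n | (q.1.2 < q.1.1)%N) w q.1.1 q.1.2.
  rewrite -sum_quads_swap -[RHS]sum_quads_swap /=.
  under eq_bigr do rewrite pC.
  by rewrite hgt; under eq_bigr do rewrite wC.
by rewrite hgt hlt [RHS]addrC [in RHS]addrAC subrr add0r [X in _ = _ + X]addrC.
Qed.

(** On x = y the equation reads (a + b) x = n, so d = a + b runs over the divisors. *)
Lemma sum_quads_diagr n p : (0 < n)%N ->
  \sum_(q <- quads n | q.2.1 == q.2.2) p q.1.1 q.1.2 =
  \sum_(d <- divisors n) \sum_(1 <= a < d) p a (d - a)%N.
Proof.
move=> n0; rewrite -big_filter.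
pose s (r : nat * nat) := ((r.2, r.1 - r.2), (n %/ r.1, n %/ r.1))%N.
pose l := [seq (d, a) | d <- divisors n, a <- index_iota 1 d].
transitivity (\sum_(q <- map s l) p q.1.1 q.1.2); last first.
  by rewrite big_map big_allpairs_dep.
have memP d a : ((d, a) \in l) = [&& d %| n, 0 < a & a < d]%N.
  apply/allpairsPdep/idP => [[d' [a' [+ + [-> ->]]]]|].
    by rewrite -dvdn_divisors // mem_index_iota => -> /andP[-> ->].
  case/and3P=> dn a0 ltad; exists d, a.
  by rewrite -dvdn_divisors // mem_index_iota a0.
apply: perm_big; apply: uniq_perm.
- exact/filter_uniq/quads_uniq.
- rewrite map_inj_in_uniq.
    apply: allpairs_uniq_dep; rewrite ?divisors_uniq //.
      by move=> *; apply: iota_uniq.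
    by move=> [? ?] [? ?] _ _ [-> ->].
  move=> [d a] [d' a']; rewrite !memP => /and3P[_ _ ?] /and3P[_ _ ?] [-> *].
  by congr (_, _); lia.
move=> [[a b] [x y]]; rewrite mem_filter mem_quads /=; apply/idP/mapP.
  case/andP=> /eqP <- /and5P[a0 b0 x0 _ /eqP eqn].
  exists ((a + b)%N, a); first by rewrite memP -eqn -mulnDl dvdn_mulr // a0 -[X in (X < _)%N]addn0 ltn_add2l.
  by rewrite /s /= addKn -eqn -mulnDl mulKn // addn_gt0 a0.
move=> [[d c]]; rewrite memP => /and3P[dn c0 ltcd] [-> -> -> ->].
rewrite eqxx c0 subn_gt0 ltcd divn_gt0 ?(ltn_trans c0) // dvdn_leq //=.
by rewrite -mulnDl subnKC ?(ltnW ltcd) // mulnC divnK.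
Qed.

(** On a = b the equation reads a (x + y) = n; a divisor d = a leaves n/d - 1 choices of x. *)
Lemma sum_quads_diagl n (w : nat -> V) : (0 < n)%N ->
  \sum_(q <- quads n | q.1.1 == q.1.2) w q.1.1 =
  \sum_(d <- divisors n) w d *+ (n %/ d).-1.
Proof.
move=> n0; rewrite -big_filter.
pose s (r : nat * nat) := ((r.1, r.1), (r.2, n %/ r.1 - r.2))%N.
pose l := [seq (d, x) | d <- divisors n, x <- index_iota 1 (n %/ d)].
transitivity (\sum_(q <- map s l) w q.1.1); last first.
  rewrite big_map big_allpairs_dep; apply: eq_bigr => d _ /=.
  by rewrite sumr_const_nat subn1.
have memP d x : ((d, x) \in l) = [&& d %| n, 0 < x & x < n %/ d]%N.
  apply/allpairsPdep/idP => [[d' [x' [+ + [-> ->]]]]|].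
    by rewrite -dvdn_divisors // mem_index_iota => -> /andP[-> ->].
  case/and3P=> dn x0 ltx; exists d, x.
  by rewrite -dvdn_divisors // mem_index_iota x0.
apply: perm_big; apply: uniq_perm.
- exact/filter_uniq/quads_uniq.
- rewrite map_inj_in_uniq.
    apply: allpairs_uniq_dep; rewrite ?divisors_uniq //.
      by move=> *; apply: iota_uniq.
    by move=> [? ?] [? ?] _ _ [-> ->].
  by move=> [d x] [d' x']; rewrite !memP => /and3P[_ _ ?] /and3P[_ _ ?] [-> _ ->].
move=> [[a b] [x y]]; rewrite mem_filter mem_quads /=; apply/idP/mapP.
  case/andP=> /eqP <- /and5P[a0 _ x0 y0 /eqP eqn].
  exists (a, x); last by rewrite /s /= -eqn -mulnDr mulKn // addKn.
  by rewrite memP -eqn -mulnDr dvdn_mulr // mulKn // x0 -[X in (X < _)%N]addn0 ltn_add2l.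
move=> [[d c]]; rewrite memP => /and3P[dn c0 ltcd] [-> -> -> ->].
rewrite eqxx c0 subn_gt0 ltcd (dvdn_gt0 n0 dn) /=.
by rewrite -mulnDr subnKC ?(ltnW ltcd) // mulnC divnK.
Qed.

End QuadSums.

(** Group the solutions by i = a x; then a runs over the divisors of i and b over those of n - i. *)
Lemma sum_quads_mul (R : comNzRingType) (u v : nat -> R) n :
  \sum_(q <- quads n) u q.1.1 * v q.1.2 =
  \sum_(1 <= i < n) (\sum_(a <- divisors i) u a) * (\sum_(b <- divisors (n - i)) v b).
Proof.
transitivity (\sum_(1 <= i < n) \sum_(q <- quads n | (q.1.1 * q.2.1)%N == i) u q.1.1 * v q.1.2).
  rewrite (exchange_big_dep xpredT) //= big_seq [RHS]big_seq; apply: eq_bigr => -[[a b] [x y]].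
  rewrite mem_quads /= => /and5P[a0 b0 x0 y0 /eqP eqn].
  have axn : ((a * x)%N \in index_iota 1 n).
    by rewrite mem_index_iota muln_gt0 a0 x0 -eqn -[X in (X < _)%N]addn0 ltn_add2l muln_gt0 b0.
  under eq_bigl do rewrite eq_sym.
  by rewrite -big_filter filter_pred1_uniq ?iota_uniq // big_seq1.
rewrite !big_nat; apply: eq_bigr => i /andP[i0 ltin]; rewrite -big_filter.
pose s (r : nat * nat) := ((r.1, r.2), (i %/ r.1, (n - i) %/ r.2))%N.
pose l := [seq (a, b) | a <- divisors i, b <- divisors (n - i)].
transitivity (\sum_(q <- map s l) u q.1.1 * v q.1.2); last first.
  rewrite big_map big_allpairs /= mulr_suml; apply: eq_bigr => a _.
  by rewrite mulr_sumr.
have ni0 : (0 < n - i)%N by rewrite subn_gt0.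
have memP a b : ((a, b) \in l) = (a %| i)%N && (b %| n - i)%N.
  apply/allpairsP/idP => [[[a' b'] [/= + + [-> ->]]]|].
    by rewrite -!dvdn_divisors // => -> ->.
  by case/andP=> ai bni; exists (a, b); rewrite -!dvdn_divisors.
apply: perm_big; apply: uniq_perm.
- exact/filter_uniq/quads_uniq.
- rewrite map_inj_uniq; last by move=> [? ?] [? ?] [-> ->].
  by apply: allpairs_uniq; rewrite ?divisors_uniq // => -[? ?] [? ?].
move=> [[a b] [x y]]; rewrite mem_filter mem_quads /=; apply/idP/mapP.
  case/andP=> /eqP axi /and5P[a0 b0 x0 y0 /eqP eqn].
  have byi : (n - i = b * y)%N by rewrite -eqn axi addKn.
  exists (a, b); first by rewrite memP byi -axi !dvdn_mulr.
  by rewrite /s /= byi -axi !mulKn.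
move=> [[a' b']]; rewrite memP => /andP[ai bni] [-> -> -> ->].
rewrite (dvdn_gt0 i0 ai) (dvdn_gt0 ni0 bni) !divn_gt0 ?(dvdn_gt0 i0 ai) ?(dvdn_gt0 ni0 bni) //.
have mulK d m : (d %| m)%N -> (d * (m %/ d))%N = m by move=> dm; rewrite mulnC divnK.
rewrite (dvdn_leq i0 ai) (dvdn_leq ni0 bni) (mulK _ _ ai) (mulK _ _ bni).
by rewrite subnKC ?eqxx // ltnW.
Qed.

Definition adist (a b : nat) : nat := ((a - b) + (b - a))%N.

Lemma adistC a b : adist a b = adist b a.
Proof. by rewrite /adist addnC. Qed.

Lemma adistDl a b : adist a (a + b) = b.
Proof. by rewrite /adist; lia. Qed.

Lemma adist_even_exp (R : comNzRingType) a b k :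
  ((adist a b)%:R : R) ^+ k.*2 = (a%:R - b%:R) ^+ k.*2.
Proof.
rewrite -mul2n ![_ ^+ (2 * _)]exprM; congr (_ ^+ _).
wlog leab : a b / (a <= b)%N => [hw|].
  case/orP: (leq_total a b) => [/hw //|/hw].
  by rewrite adistC => ->; ring.
have -> : adist a b = (b - a)%N by rewrite /adist; lia.
by rewrite natrB //; ring.
Qed.

Lemma big_divisors_pos (V : nmodType) n (F G : nat -> V) :
  (forall d, (0 < d)%N -> (d %| n)%N -> F d = G d) -> (0 < n)%N ->
  \sum_(d <- divisors n) F d = \sum_(d <- divisors n) G d.
Proof.
move=> FG n0; rewrite big_seq [RHS]big_seq; apply: eq_bigr => d.
by rewrite -dvdn_divisors // => dn; apply: FG => //; apply: dvdn_gt0 dn.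
Qed.

Lemma big_index1 (V : nmodType) (F : nat -> V) d : F 0%N = 0 ->
  \sum_(1 <= a < d) F a = \sum_(0 <= a < d) F a.
Proof.
by case: d => [|d] F0; [rewrite !big_geq | rewrite [RHS]big_ltn // F0 add0r].
Qed.

Lemma big_index1_rev (V : nmodType) (F : nat -> V) d :
  \sum_(1 <= a < d) F (d - a)%N = \sum_(1 <= a < d) F a.
Proof.
by rewrite [RHS]big_nat_rev /=; apply: eq_big_nat => a _; rewrite add1n subSS.
Qed.

(** * The two families of convolution identities *)

Section Convolutions.
Variable R : comNzRingType.
Implicit Types f : nat -> R.

Lemma liouville f n : (0 < n)%N -> f 0%N = 0 ->
  \sum_(q <- quads n) (f (q.1.1 + q.1.2)%N - f (adist q.1.1 q.1.2)) =
  \sum_(d <- divisors n)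
    (2 * (\sum_(0 <= a < d) f a) + (d%:R + 1) * f d - 2 * (n %/ d)%:R * f d).
Proof.
move=> n0 f0.
(* The terms [f a + f b] cancel in [p - w]; they are added to obtain [p a b = w a (a + b)]. *)
pose p a b := f a + f b + f (a + b)%N.
pose w a b := f a + f b + f (adist a b).
have : _ := @sum_quads_unfold R n p w _ _ _.
have -> : \sum_(q <- quads n) (f (q.1.1 + q.1.2)%N - f (adist q.1.1 q.1.2)) =
   \sum_(q <- quads n) p q.1.1 q.1.2 - \sum_(q <- quads n) w q.1.1 q.1.2.
  by rewrite -sumrB; apply: eq_bigr => q _; rewrite /p /w; ring.
move=> -> //; rewrite /p /w; first last.
- by move=> a b; rewrite adistDl; ring.
- by move=> a b; rewrite adistC; ring.
- by move=> a b; rewrite addnC; ring.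
rewrite (sum_quads_diagr (fun a b => p a b)) // (sum_quads_diagl (fun a => w a a)) //.
set W := \sum_(q <- quads n) _.
have -> (x y : R) : W - x + y - W = y - x by ring.
rewrite -sumrB; apply: big_divisors_pos => // d d0 dn.
have -> : \sum_(1 <= a < d) p a (d - a)%N = \sum_(1 <= a < d) f a + \sum_(1 <= a < d) f a + (d%:R - 1) * f d.
  rewrite -[X in _ + X + _]big_index1_rev -big_split /=.
  have -> : (d%:R - 1) * f d = \sum_(1 <= a < d) f d.
    by rewrite sumr_const_nat -[f d *+ _]mulr_natl natrB.
  rewrite -big_split /= /=; apply: eq_big_nat => a /andP[a0 ltad].
  by rewrite /p subnKC // ltnW.
have nd0 : (0 < n %/ d)%N by rewrite divn_gt0 // dvdn_leq.
rewrite big_index1 // /w /adist subnn f0 -[_ *+ _.-1]mulr_natl -subn1 natrB //; ring.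
Qed.

Lemma sum_mul_compl d : 6 * (\sum_(0 <= a < d) (a%:R * (d%:R - a%:R))) = d%:R ^+ 3 - d%:R :> R.
Proof.
have [-> ->] : (\sum_(0 <= a < d) (a%:R * (d%:R - a%:R)) : R) =
   d%:R * (\sum_(0 <= a < d) a%:R) - \sum_(0 <= a < d) a%:R ^+ 2 /\ 0 = 0 :> R.
  by split=> //; rewrite mulr_sumr -sumrB; apply: eq_bigr => a _; ring.
have h1 : 2 * (\sum_(0 <= a < d) a%:R) = d%:R * (d%:R - 1) :> R.
  elim: d => [|d IH]; first by rewrite big_geq //; ring.
  by rewrite big_nat_recr //= mulrDr IH -natr1; ring.
have h2 : 6 * (\sum_(0 <= a < d) a%:R ^+ 2) = d%:R * (d%:R - 1) * (2 * d%:R - 1) :> R.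
  elim: d {h1} => [|d IH]; first by rewrite big_geq //; ring.
  by rewrite big_nat_recr //= mulrDr IH -natr1; ring.
have -> (x y : R) : 6 * (d%:R * x - y) = 3 * d%:R * (2 * x) - 6 * y by ring.
by rewrite h1 h2; ring.
Qed.

(** The bracket has the shape of the product formula [coszM], so for [f = cosz] the sum becomes a
    convolution square; for f(x) = x^4 the bracket is 12 a^2 b^2. *)
Lemma second_convolution f n : (0 < n)%N -> f 0%N = 0 ->
  6 * (\sum_(q <- quads n) q.1.1%:R * q.1.2%:R *
     (f (q.1.1 + q.1.2)%N + f (adist q.1.1 q.1.2) - 2 * f q.1.1 - 2 * f q.1.2)) =
  \sum_(d <- divisors n)
    ((d%:R ^+ 3 - d%:R) * f d - 12 * d%:R * \sum_(0 <= a < d) (d%:R - a%:R) * f a).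
Proof.
move=> n0 f0.
(* Symmetric expressions, linear in [f] with quadratic coefficients, fitted so that
   [p a b = w a (a + b)] and [p - w] is the summand in question. *)
pose p a b : R := a%:R * b%:R * f (a + b)%N - b%:R * (a%:R + b%:R) * f a
  - a%:R * (a%:R + b%:R) * f b.
pose w a b : R := - a%:R * b%:R * f (adist a b) - b%:R * (b%:R - a%:R) * f a
  + a%:R * (b%:R - a%:R) * f b.
have : _ := @sum_quads_unfold R n p w _ _ _.
have -> : \sum_(q <- quads n) q.1.1%:R * q.1.2%:R *
     (f (q.1.1 + q.1.2)%N + f (adist q.1.1 q.1.2) - 2 * f q.1.1 - 2 * f q.1.2) =
   \sum_(q <- quads n) p q.1.1 q.1.2 - \sum_(q <- quads n) w q.1.1 q.1.2.
  by rewrite -sumrB; apply: eq_bigr => q _; rewrite /p /w; ring.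
move=> -> //; rewrite /p /w; first last.
- by move=> a b; rewrite adistDl natrD; ring.
- by move=> a b; rewrite adistC; ring.
- by move=> a b; rewrite addnC; ring.
rewrite (sum_quads_diagr (fun a b => p a b)) // (sum_quads_diagl (fun a => w a a)) //.
set W := \sum_(q <- quads n) _.
have -> (x y : R) : W - x + y - W = y - x by ring.
rewrite -sumrB mulr_sumr; apply: big_divisors_pos => // d d0 dn.
have -> : w d d = 0 by rewrite /w /adist subnn f0; ring.
rewrite mul0rn subr0.
pose K := \sum_(1 <= a < d) (d%:R - a%:R) * f a.
have -> : \sum_(1 <= a < d) p a (d - a)%N =
  (\sum_(1 <= a < d) (a%:R * (d%:R - a%:R))) * f d - d%:R * K - d%:R * K.
  rewrite -{2}[K]big_index1_rev mulr_suml /K !mulr_sumr -!sumrB.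
  apply: eq_big_nat => a /andP[a0 ltad].
  by rewrite /p subnKC ?(ltnW ltad) // natrB ?(ltnW ltad) //; ring.
rewrite -sum_mul_compl /K !big_index1 ?f0 ?mulr0 ?mul0r //.
ring.
Qed.

End Convolutions.

(** Proof by certificate: [c] is the cofactor with which the hypothesis [u = v] enters; what remains
    is an identity for [ring] or [field], or for the next hypothesis. *)
Lemma eq_lincomb (R : pzRingType) (c x y u v : R) : u = v -> x - y = c * (u - v) -> x = y.
Proof. by move=> -> /eqP; rewrite subrr mulr0 subr_eq0 => /eqP. Qed.

(** * Eisenstein series and Ramanujan's differential equations *)

Section Eisenstein.
Variable C : numFieldType.

Definition sigma (k n : nat) : C := \sum_(d <- divisors n) d%:R ^+ k.

Definition sconv (k l n : nat) : C := \sum_(1 <= i < n) sigma k i * sigma l (n - i).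

Lemma sconvE k l n :
  sconv k l n = \sum_(q <- quads n) q.1.1%:R ^+ k * q.1.2%:R ^+ l.
Proof.
by rewrite (sum_quads_mul (fun a => a%:R ^+ k) (fun b => b%:R ^+ l)).
Qed.

Lemma sconvC k l n : sconv k l n = sconv l k n.
Proof.
rewrite !sconvE -sum_quads_swap /=.
by apply: eq_bigr => q _; rewrite mulrC.
Qed.

Lemma natr_inj0 (k : nat) (x y : C) : k.+1%:R * x = k.+1%:R * y -> x = y.
Proof. by apply: mulfI; rewrite pnatr_eq0. Qed.

(** Even exponents make the sign of a - b irrelevant, and the expanded difference has only monomials
    odd in both variables, which sum to convolutions of odd divisor power sums. *)
Lemma liouville_pow k n : (0 < n)%N ->
  \sum_(q <- quads n) ((q.1.1%:R + q.1.2%:R) ^+ k.+1.*2 - (q.1.1%:R - q.1.2%:R) ^+ k.+1.*2) =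
  \sum_(d <- divisors n) (2 * (\sum_(0 <= a < d) a%:R ^+ k.+1.*2) +
     (d%:R + 1) * d%:R ^+ k.+1.*2) - 2 * n%:R * sigma k.*2.+1 n :> C.
Proof.
move=> n0.
transitivity (\sum_(q <- quads n) ((q.1.1 + q.1.2)%:R ^+ k.+1.*2 -
    (adist q.1.1 q.1.2)%:R ^+ k.+1.*2) : C).
  by apply: eq_bigr => q _; rewrite adist_even_exp natrD.
rewrite (liouville (f := fun m => m%:R ^+ k.+1.*2)) ?expr0n // /sigma.
rewrite mulr_sumr -sumrB; apply: big_divisors_pos => // d d0 dn.
rewrite -[in 2 * n%:R](divnK dn) natrM doubleS !exprS; ring.
Qed.

Lemma sconv11 n : (0 < n)%N ->
  12 * sconv 1 1 n = 5 * sigma 3 n + sigma 1 n - 6 * n%:R * sigma 1 n.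
Proof.
move=> n0; have := liouville_pow 0 n0.
have -> : \sum_(q <- quads n) ((q.1.1%:R + q.1.2%:R) ^+ 2 - (q.1.1%:R - q.1.2%:R) ^+ 2)
    = 4 * sconv 1 1 n.
  by rewrite sconvE mulr_sumr; apply: eq_bigr => q _; ring.
have s2 d : 3 * (\sum_(0 <= a < d) a%:R ^+ 2) = d%:R ^+ 3 - 3 / 2 * d%:R ^+ 2 + d%:R / 2 :> C.
  elim: d => [|d IH]; first by rewrite big_geq //; field.
  by rewrite big_nat_recr //= mulrDr IH -natr1; field.
have -> : \sum_(d <- divisors n) (2 * (\sum_(0 <= a < d) a%:R ^+ 2) +
     (d%:R + 1) * d%:R ^+ 2) = 5 / 3 * sigma 3 n + sigma 1 n / 3.
  rewrite /sigma mulr_sumr mulr_suml -big_split /=; apply: eq_bigr => d _.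
  by apply: (@natr_inj0 2); rewrite mulrDr mulrCA s2; field.
by move=> h; apply: (eq_lincomb (c := 3) h); field.
Qed.

Lemma sconv13 n : (0 < n)%N ->
  240 * sconv 1 3 n = 21 * sigma 5 n + 10 * sigma 3 n - 30 * n%:R * sigma 3 n - sigma 1 n.
Proof.
move=> n0; have := liouville_pow 1 n0.
have -> : \sum_(q <- quads n) ((q.1.1%:R + q.1.2%:R) ^+ 4 - (q.1.1%:R - q.1.2%:R) ^+ 4)
    = 16 * sconv 1 3 n.
  have -> : 16 * sconv 1 3 n = 8 * sconv 1 3 n + 8 * sconv 3 1 n.
    by rewrite (sconvC 3); ring.
  by rewrite !sconvE !mulr_sumr -big_split; apply: eq_bigr => q _ /=; ring.
have s4 d : 30 * (\sum_(0 <= a < d) a%:R ^+ 4) =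
    6 * d%:R ^+ 5 - 15 * d%:R ^+ 4 + 10 * d%:R ^+ 3 - d%:R :> C.
  elim: d => [|d IH]; first by rewrite big_geq //; ring.
  by rewrite big_nat_recr //= mulrDr IH -natr1; ring.
have -> : \sum_(d <- divisors n) (2 * (\sum_(0 <= a < d) a%:R ^+ 4) +
     (d%:R + 1) * d%:R ^+ 4) = 7 / 5 * sigma 5 n + 2 / 3 * sigma 3 n - sigma 1 n / 15.
  rewrite /sigma !mulr_sumr mulr_suml -big_split -sumrB /=; apply: eq_bigr => d _.
  by apply: (@natr_inj0 29); rewrite mulrDr mulrCA s4; field.
by move=> h; apply: (eq_lincomb (c := 15) h); field.
Qed.

(** Equivalent to E_4^2 = E_8. Exponent 6 in [liouville_pow] mixes this sum with [sconv 1 5]; the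
    second family separates the two. *)
Lemma sconv33 n : (0 < n)%N -> 120 * sconv 3 3 n = sigma 7 n - sigma 3 n.
Proof.
move=> n0; have := second_convolution (f := fun m => m%:R ^+ 4 : C) n0 (expr0n _ 4).
have -> : \sum_(q <- quads n) q.1.1%:R * q.1.2%:R *
    ((q.1.1 + q.1.2)%:R ^+ 4 + (adist q.1.1 q.1.2)%:R ^+ 4 - 2 * q.1.1%:R ^+ 4 -
     2 * q.1.2%:R ^+ 4) = 12 * sconv 3 3 n.
  rewrite sconvE mulr_sumr; apply: eq_bigr => q _.
  by rewrite (@adist_even_exp _ _ _ 2) natrD; ring.
have s5 d : 60 * (\sum_(0 <= a < d) (d%:R - a%:R) * a%:R ^+ 4) =
    2 * d%:R ^+ 6 - 5 * d%:R ^+ 4 + 3 * d%:R ^+ 2 :> C.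
  have h4 e : 30 * (\sum_(0 <= a < e) a%:R ^+ 4) =
    6 * e%:R ^+ 5 - 15 * e%:R ^+ 4 + 10 * e%:R ^+ 3 - e%:R :> C.
    elim: e => [|e IH]; first by rewrite big_geq //; ring.
    by rewrite big_nat_recr //= mulrDr IH -natr1; ring.
  have h5 e : 12 * (\sum_(0 <= a < e) a%:R ^+ 5) =
    2 * e%:R ^+ 6 - 6 * e%:R ^+ 5 + 5 * e%:R ^+ 4 - e%:R ^+ 2 :> C.
    elim: e => [|e IH]; first by rewrite big_geq //; ring.
    by rewrite big_nat_recr //= mulrDr IH -natr1; ring.
  have -> : \sum_(0 <= a < d) (d%:R - a%:R) * a%:R ^+ 4 =
     d%:R * (\sum_(0 <= a < d) a%:R ^+ 4) - \sum_(0 <= a < d) a%:R ^+ 5 :> C.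
    by rewrite mulr_sumr -sumrB; apply: eq_bigr => a _; ring.
  have -> (x y : C) : 60 * (d%:R * x - y) = 2 * d%:R * (30 * x) - 5 * (12 * y) by ring.
  by rewrite h4 h5; ring.
have -> : \sum_(d <- divisors n) ((d%:R ^+ 3 - d%:R) * d%:R ^+ 4 - 12 * d%:R *
     \sum_(0 <= a < d) (d%:R - a%:R) * a%:R ^+ 4) = 3 / 5 * sigma 7 n - 3 / 5 * sigma 3 n.
  rewrite /sigma !mulr_sumr -sumrB /=; apply: eq_bigr => d _.
  apply: (@natr_inj0 4).
  have -> (x : C) : 5 * ((d%:R ^+ 3 - d%:R) * d%:R ^+ 4 - 12 * d%:R * x) =
    5 * (d%:R ^+ 7 - d%:R ^+ 5) - d%:R * (60 * x) by ring.
  by rewrite s5; field.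
by move=> h; apply: (eq_lincomb (c := 5 / 3) h); field.
Qed.

Lemma sconv15 n : (0 < n)%N -> 504 * sconv 1 5 n =
  20 * sigma 7 n - 42 * n%:R * sigma 5 n + 21 * sigma 5 n + sigma 1 n.
Proof.
move=> n0; have := liouville_pow 2 n0.
have -> : \sum_(q <- quads n) ((q.1.1%:R + q.1.2%:R) ^+ 6 - (q.1.1%:R - q.1.2%:R) ^+ 6)
    = 24 * sconv 1 5 n + 40 * sconv 3 3 n.
  have -> : 24 * sconv 1 5 n = 12 * sconv 1 5 n + 12 * sconv 5 1 n.
    by rewrite (sconvC 5); ring.
  by rewrite !sconvE !mulr_sumr -!big_split; apply: eq_bigr => q _ /=; ring.
have s6 d : 42 * (\sum_(0 <= a < d) a%:R ^+ 6) =
    6 * d%:R ^+ 7 - 21 * d%:R ^+ 6 + 21 * d%:R ^+ 5 - 7 * d%:R ^+ 3 + d%:R :> C.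
  elim: d => [|d IH]; first by rewrite big_geq //; ring.
  by rewrite big_nat_recr //= mulrDr IH -natr1; ring.
have -> : \sum_(d <- divisors n) (2 * (\sum_(0 <= a < d) a%:R ^+ 6) +
     (d%:R + 1) * d%:R ^+ 6) =
     9 / 7 * sigma 7 n + sigma 5 n - sigma 3 n / 3 + sigma 1 n / 21.
  rewrite /sigma !mulr_sumr !mulr_suml -big_split -sumrB -big_split /=.
  apply: eq_bigr => d _.
  by apply: (@natr_inj0 41); rewrite mulrDr mulrCA s6; field.
by move=> h; apply: (eq_lincomb (c := 21) h); apply: (eq_lincomb (c := -7) (sconv33 n0)); field.
Qed.

Lemma size_bern_seq m : size (bern_seq C m) = m.+1.
Proof. by elim: m => //= m IH; rewrite size_rcons IH. Qed.

Lemma nth_bern_seq m j : (j <= m)%N -> (bern_seq C m)`_j = bernoulli C j.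
Proof.
elim: m => [|m IH]; first by rewrite leqn0 => /eqP ->.
rewrite leq_eqVlt => /predU1P[-> //|ltjm].
by rewrite /= nth_rcons size_bern_seq ltjm IH.
Qed.

Lemma bernoulli0 : bernoulli C 0 = 1. Proof. by []. Qed.

Lemma bernoulliS m : bernoulli C m.+1 =
  - (m.+2%:R)^-1 * \sum_(j < m.+1) 'C(m.+2, j)%:R * bernoulli C j.
Proof.
rewrite {1}/bernoulli /= nth_rcons size_bern_seq ltnn eqxx.
by congr (_ * _); apply: eq_bigr => j _; rewrite nth_bern_seq // -ltnS.
Qed.

Lemma bernoulli_sum m : \sum_(j < m.+2) 'C(m.+2, j)%:R * bernoulli C j = 0.
Proof.
rewrite big_ord_recr /= bernoulliS binSn mulrA mulrN mulfV ?pnatr_eq0 //.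
by rewrite mulN1r subrr.
Qed.

Ltac bern_step eqs :=
  rewrite bernoulliS !big_ord_recl big_ord0 /= /bump /= ?eqs;
  repeat match goal with |- context [binomial ?n ?k] =>
    let v := eval vm_compute in (binomial n k) in change (binomial n k) with v end;
  field.

Lemma bernoulli_small : [/\ bernoulli C 2 = 1 / 6, bernoulli C 4 = - (1 / 30) &
  bernoulli C 6 = 1 / 42].
Proof.
have b1 : bernoulli C 1 = - (1 / 2) by bern_step bernoulli0.
have b2 : bernoulli C 2 = 1 / 6 by bern_step (bernoulli0, b1).
have b3 : bernoulli C 3 = 0 by bern_step (bernoulli0, b1, b2).
have b4 : bernoulli C 4 = - (1 / 30) by bern_step (bernoulli0, b1, b2, b3).
have b5 : bernoulli C 5 = 0 by bern_step (bernoulli0, b1, b2, b3, b4).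
by split=> //; bern_step (bernoulli0, b1, b2, b3, b4, b5).
Qed.

Definition Gser (k : nat) : fps C := Fps (Gcoef C k).

Lemma Gser_sigma k n : ~~ odd k -> (0 < n)%N -> Gser k n = sigma k.-1 n.
Proof.
rewrite /= /Gcoef => /negbTE -> n0; rewrite -[n == 0%N]negbK -lt0n n0 /= /sigma.
rewrite -(big_mkord (fun d => d %| n)%N (fun d => d%:R ^+ k.-1)) -big_filter.
apply: perm_big; apply: uniq_perm; rewrite ?divisors_uniq ?filter_uniq ?iota_uniq //.
move=> d; rewrite mem_filter mem_index_iota -dvdn_divisors //= ltnS.
by case: (boolP (d %| n)%N) => //= /dvdn_leq ->.
Qed.

Lemma Gser_coef0 : [/\ Gser 2 0%N = - (1 / 24), Gser 4 0%N = 1 / 240 & Gser 6 0%N = - (1 / 504)].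
Proof.
have [b2 b4 b6] := bernoulli_small.
by rewrite /= /Gcoef /= b2 b4 b6 -!muln2 !natrM; split; field.
Qed.

Lemma Gser_mul k l n : ~~ odd k -> ~~ odd l -> (0 < n)%N ->
  (Gser k * Gser l) n = Gser k 0%N * sigma l.-1 n + sigma k.-1 n * Gser l 0%N
    + sconv k.-1 l.-1 n.
Proof.
move=> ek el n0; rewrite fps_mul_coef // (Gser_sigma ek n0) (Gser_sigma el n0); congr (_ + _).
by apply: eq_big_nat => i /andP[i0 ltin]; rewrite !Gser_sigma ?subn_gt0.
Qed.

Definition E2 : fps C := fpsC (-24) * Gser 2.
Definition E4 : fps C := fpsC 240 * Gser 4.
Definition E6 : fps C := fpsC (-504) * Gser 6.

Lemma Eseries_coef0 : [/\ E2 0%N = 1, E4 0%N = 1 & E6 0%N = 1].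
Proof.
have [g2 g4 g6] := Gser_coef0.
by rewrite /E2 /E4 /E6 !fpsC_mulE g2 g4 g6; split; field.
Qed.

Lemma Eseries_coef n : (0 < n)%N ->
  [/\ E2 n = -24 * sigma 1 n, E4 n = 240 * sigma 3 n & E6 n = -504 * sigma 5 n].
Proof. by move=> n0; rewrite /E2 /E4 /E6 !fpsC_mulE !Gser_sigma. Qed.

Lemma Eseries_mul (k l : nat) (a b : C) n : ~~ odd k -> ~~ odd l -> (0 < n)%N ->
  (fpsC a * Gser k * (fpsC b * Gser l)) n = a * b * (Gser k 0%N * sigma l.-1 n
    + sigma k.-1 n * Gser l 0%N + sconv k.-1 l.-1 n).
Proof.
by move=> ek el n0; rewrite mulrACA -rmorphM fpsC_mulE Gser_mul.
Qed.

Lemma ramanujan_E2 : 12 * euler E2 = E2 * E2 - E4.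
Proof.
have [e2 e4 _] := Eseries_coef0; have [g2 _ _] := Gser_coef0.
apply: fpsP => n; rewrite fps_natr_mulE eulerE fps_subE.
have [->|n0] := posnP n; first by rewrite (coef0_mul E2 E2) e2 e4; ring.
have [-> -> _] := Eseries_coef n0; rewrite Eseries_mul // g2 /=.
by apply: (eq_lincomb (c := -48) (sconv11 n0)); field.
Qed.

Lemma ramanujan_E4 : 3 * euler E4 = E2 * E4 - E6.
Proof.
have [e2 e4 e6] := Eseries_coef0; have [g2 g4 _] := Gser_coef0.
apply: fpsP => n; rewrite fps_natr_mulE eulerE fps_subE.
have [->|n0] := posnP n; first by rewrite (coef0_mul E2 E4) e2 e4 e6; ring.
have [_ -> ->] := Eseries_coef n0; rewrite Eseries_mul // g2 g4 /=.
by apply: (eq_lincomb (c := 24) (sconv13 n0)); field.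
Qed.

Lemma ramanujan_E6 : 2 * euler E6 = E2 * E6 - E4 * E4.
Proof.
have [e2 e4 e6] := Eseries_coef0; have [g2 g4 g6] := Gser_coef0.
apply: fpsP => n; rewrite fps_natr_mulE eulerE fps_subE.
have [->|n0] := posnP n; first by rewrite (coef0_mul E2 E6) (coef0_mul E4 E4) e2 e4 e6; ring.
have [_ _ ->] := Eseries_coef n0; rewrite !Eseries_mul // g2 g4 g6 /=.
apply: (eq_lincomb (c := -24) (sconv15 n0)).
by apply: (eq_lincomb (c := 480) (sconv33 n0)); field.
Qed.

End Eisenstein.

(** * The differential equation of the Weierstrass function *)

Section WeierstrassP.
Variable C : numFieldType.
Notation z := (fpsXn C 1).

Lemma fps_natI k (f g : fps C) : k.+1%:R * f = k.+1%:R * g -> f = g.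
Proof.
move=> fg; apply: fpsP => n; apply: (@natr_inj0 _ k).
by rewrite -!fps_natr_mulE fg.
Qed.

Definition expz (c : C) : fps C := Fps (fun n => c ^+ n / n`!%:R).

Lemma fact_neq0 n : n`!%:R != 0 :> C.
Proof. by rewrite pnatr_eq0 -lt0n fact_gt0. Qed.

Lemma expzD a b : expz a * expz b = expz (a + b).
Proof.
apply: fpsP => n; rewrite fps_mulE /= exprDn mulr_suml [RHS](reindex_inj rev_ord_inj) /=.
apply: eq_bigr => i _; have lein : (i <= n)%N by rewrite -ltnS.
rewrite subSS subKn // bin_sub // -mulr_natr.
have := bin_fact lein => /(congr1 (fun m => m%:R : C)); rewrite 2!natrM => e.
have b0 : 'C(n, i)%:R != 0 :> C by rewrite pnatr_eq0 -lt0n bin_gt0.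
rewrite -e; have := fact_neq0 i; have := fact_neq0 (n - i) => h1 h2.
by field; rewrite h1 h2 b0.
Qed.

Lemma expz0 : expz 0 = 1.
Proof.
apply: fpsP => n; rewrite fps_1E /= expr0n; case: eqP => [->|_]; last by rewrite mul0r.
by rewrite divr1.
Qed.

Lemma euler_expz c : euler (expz c) = fpsC c * (z * expz c).
Proof.
apply: fpsP => -[|n]; rewrite eulerE fpsC_mulE fpsXn_mulE /=; first by rewrite mul0r mulr0.
rewrite subn1 /= factS natrM exprS; have h := fact_neq0 n.
have : n.+1%:R != 0 :> C by rewrite pnatr_eq0.
by move: (n.+1%:R) => m m0; field; rewrite h m0.
Qed.

(** This is 2 cosh(d z) - 2 = 4 sinh(d z/2)^2; subtracting 2 gives [cosz 0 = 0], as
    [second_convolution] demands. *)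
Definition cosz (d : nat) : fps C := expz d%:R + expz (- d%:R) - 2.

Lemma cosz0 : cosz 0 = 0.
Proof. by rewrite /cosz oppr0 expz0; ring. Qed.

Lemma cosz_coef d i : cosz d i =
  if odd i || (i == 0)%N then 0 else 2 * d%:R ^+ i / i`!%:R.
Proof.
rewrite fps_subE fps_addE fps_natrE /= exprNn -signr_odd.
case: i => [|i] /=; first by rewrite expr0 fact0; field.
by case: (odd i) => /=; rewrite ?expr1 ?expr0; field; rewrite fact_neq0.
Qed.

Lemma coszM a b : cosz a * cosz b =
  cosz (a + b) + cosz (adist a b) - 2 * cosz a - 2 * cosz b.
Proof.
wlog leab : a b / (a <= b)%N => [hw|].
  case/orP: (leq_total a b) => [/hw //|/hw].
  by rewrite adistC addnC mulrC => ->; ring.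
have -> : adist a b = (b - a)%N by rewrite /adist; lia.
by rewrite /cosz natrB // natrD !opprD opprK -!expzD; ring.
Qed.

Lemma cosz_rec d : cosz d.+2 = cosz 1 * cosz d.+1 + 2 * cosz d.+1 + 2 * cosz 1 - cosz d.
Proof. by rewrite mulrC coszM addn1 {1}/adist subSS subn0 /=; rewrite addn0; ring. Qed.

(** The operator on the left is z^2 d^2/dz^2, and cosh(d z) is an eigenfunction of d^2/dz^2. *)
Lemma euler2_cosz d : euler (euler (cosz d)) - euler (cosz d) =
  d%:R ^+ 2 * (z * z) * (cosz d + 2).
Proof.
have ez : euler z = z by rewrite eulerXn mul1r.
have h1 : euler (cosz d) = d%:R * (z * (expz d%:R - expz (- d%:R))).
  rewrite /cosz raddfB raddfD /= euler_natr !euler_expz raddfN /= (rmorph_nat (@fpsC C)); ring.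
rewrite h1 euler_natrM eulerM ez raddfB /= !euler_expz raddfN /= (rmorph_nat (@fpsC C)).
by rewrite /cosz; ring.
Qed.

(** By [cosz_rec] the second difference of [cosz] is [cosz 1 * (cosz _ + 2)], and the weights d - a
    are those of a double summation. *)
Lemma cosz_sum d : cosz 1 * (\sum_(0 <= a < d) (d%:R - a%:R) * cosz a) =
  cosz d - d%:R ^+ 2 * cosz 1.
Proof.
(* The second conjunct is the formula for first differences, carried through the same induction. *)
suff [] : cosz 1 * (\sum_(0 <= a < d) (d%:R - a%:R) * cosz a) = cosz d - d%:R ^+ 2 * cosz 1 /\
   cosz 1 * (\sum_(0 <= a < d.+1) cosz a) = cosz d.+1 - cosz d - (2 * d%:R + 1) * cosz 1 by [].
elim: d => [|d [IHK IHJ]].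
  by rewrite big_nat1 big_geq // cosz0; split; ring.
split; last first.
  by rewrite big_nat_recr //= mulrDr IHJ cosz_rec -natr1; ring.
have -> : \sum_(0 <= a < d.+1) (d.+1%:R - a%:R) * cosz a =
  \sum_(0 <= a < d) (d%:R - a%:R) * cosz a + \sum_(0 <= a < d.+1) cosz a.
  rewrite !big_nat_recr //= addrA -big_split /=; congr (_ + _).
    by apply: eq_bigr => a _; rewrite -natr1; ring.
  by rewrite -natr1; ring.
by rewrite mulrDr IHK IHJ -natr1; ring.
Qed.

(** The expansion of z / (e^z - 1). *)
Definition bernser : fps C := Fps (fun n => bernoulli C n / n`!%:R).

Lemma bernserM : bernser * (expz 1 - 1) = z.
Proof.
apply: fpsP => n; rewrite fps_mulE.
under eq_bigr => i _ do rewrite fps_subE fps_1E /= expr1n.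
case: n => [|[|m]].
- by rewrite big_ord1 /= fact0 divr1 subrr mulr0.
- by rewrite !big_ord_recl big_ord0 /= bernoulli0 fact0 factS fact0; field.
rewrite big_ord_recr /= subnn fact0 divr1 subrr mulr0 addr0.
transitivity ((m.+2`!%:R)^-1 * (\sum_(j < m.+2) 'C(m.+2, j)%:R * bernoulli C j)).
  rewrite mulr_sumr; apply: eq_bigr => i _.
  have -> : (m.+2 - i == 0)%N = false by have := ltn_ord i; lia.
  have lei : (i <= m.+2)%N by have := ltn_ord i; lia.
  have := bin_fact lei => /(congr1 (fun m => m%:R : C)); rewrite 2!natrM => e.
  have b0 : 'C(m.+2, i)%:R != 0 :> C by rewrite pnatr_eq0 -lt0n bin_gt0.
  rewrite mulr0n subr0 -e; have := fact_neq0 i; have := fact_neq0 (m.+2 - i) => h1 h2.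
  by field; rewrite h1 h2 b0.
by rewrite bernoulli_sum mulr0.
Qed.

(* [(z/2) coth (z/2)] *)
Definition tau : fps C := bernser + fpsC (1 / 2) * z.

Lemma expz1_sub1_neq0 : expz 1 - 1 <> 0.
Proof.
move=> /(congr1 (fun f : fps C => f 1%N)); rewrite fps_subE fps_1E /= expr1n subr0.
by move/eqP; rewrite mulf_eq0 oner_eq0 invr_eq0 (negbTE (fact_neq0 1)).
Qed.

Lemma tauE : 2 * tau * (expz 1 - 1) = z * (expz 1 + 1).
Proof.
have h : 2 * fpsC (1 / 2) = 1 :> fps C.
  by rewrite -(rmorph_nat (@fpsC C)) -rmorphM mulrA mulr1 mulfV ?pnatr_eq0 // rmorph1.
apply: (eq_lincomb (c := 2) bernserM).
by apply: (eq_lincomb (c := z * (expz 1 - 1)) h); rewrite /tau; ring.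
Qed.

Lemma tau_coef n : n != 1%N -> tau n = bernoulli C n / n`!%:R.
Proof.
move=> /negbTE n1; rewrite /tau fps_addE fpsC_mulE /= n1.
by rewrite mulr0 addr0.
Qed.

Lemma tau0 : tau 0%N = 1.
Proof. by rewrite tau_coef // bernoulli0 divr1. Qed.

(** The equation coth' = 1 - coth^2, written for (z/2) coth(z/2). *)
Lemma tau_riccati : 4 * euler tau = 4 * tau - 4 * (tau * tau) + z * z.
Proof.
set e := expz 1; have h := tauE; rewrite -/e in h.
have ee : euler e = z * e by rewrite euler_expz mul1r.
have ez : euler z = z by rewrite eulerXn mul1r.
have h' : 2 * euler tau * (e - 1) + 2 * tau * (z * e) = z * (e + 1) + z * (z * e).
  have e1 : euler (e - 1) = z * e by rewrite raddfB /= ee euler1 subr0.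
  have e2 : euler (e + 1) = z * e by rewrite raddfD /= ee euler1 addr0.
  have := congr1 (@euler C) h; rewrite !eulerM euler_natr e1 e2 ez.
  by move=> h'; apply: (eq_lincomb (c := 1) h'); ring.
apply/eqP; rewrite -subr_eq0; apply/eqP.
(* Both [tau * tau] and the derivative of [tau] have denominator (e - 1)^2, so the factor is
   cancelled twice. *)
apply: (@fps_mul_eq0 _ (e - 1)); last exact: expz1_sub1_neq0.
apply: (@fps_mul_eq0 _ (e - 1)); last exact: expz1_sub1_neq0.
apply: (eq_lincomb (c := 2 * (e - 1)) h').
by apply: (eq_lincomb (c := 2 * tau * (e - 1) + z * (e + 1) - 2 * (e - 1) - 2 * (z * e)) h); ring.
Qed.

(** Here [cosz 1] is 4 sinh(z/2)^2 and [cosz 1 + 4] is 4 cosh(z/2)^2. *)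
Lemma tau_sqr_cosz : 4 * (tau * tau) * cosz 1 = z * z * (cosz 1 + 4).
Proof.
set e := expz 1; have h := tauE; rewrite -/e in h.
have he : e * expz (- 1) = 1 by rewrite expzD subrr expz0.
rewrite /cosz -/e; set e' := expz (- 1) in he *.
have -> : e + e' - 2 = e' * (e - 1) ^+ 2.
  by apply: (eq_lincomb (c := 2 - e) he); ring.
have -> : e' * (e - 1) ^+ 2 + 4 = e' * (e + 1) ^+ 2.
  by apply: (eq_lincomb (c := -4) he); ring.
by apply: (eq_lincomb (c := e' * (2 * tau * (e - 1) + z * (e + 1))) h); ring.
Qed.

(** Amounts to the vanishing of the odd Bernoulli numbers from B_3 on. The Riccati equation
    expresses [n.+1%:R * tau n] by products [tau i * tau (n - i)], and for odd n one of the indices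
    is odd. *)
Lemma tau_odd n : odd n -> tau n = 0.
Proof.
elim/ltn_ind: n => n IH on; have n0 : (0 < n)%N by case: n on {IH}.
have := congr1 (fun f : fps C => f n) tau_riccati.
rewrite fps_addE fps_subE !fps_natr_mulE eulerE fps_mul_coef // -fpsXnD tau0.
rewrite big_nat big1 => [|i /andP[i0 ltin]]; last first.
  case: (boolP (odd i)) => oi; first by rewrite IH ?mul0r.
  by rewrite [tau (n - i)%N]IH ?mulr0 ?oddB ?(ltnW ltin) ?on //; lia.
have -> : fpsXn C (1 + 1) n = 0 by rewrite /=; case: eqP on => // ->.
move=> h; apply/eqP; rewrite -(mulrI_eq0 _ (mulfI (x := 4 * n.+1%:R : C) _)); last first.
  by rewrite mulf_neq0 ?pnatr_eq0.
by apply/eqP; apply: (eq_lincomb (c := 1) h); rewrite -natr1; ring.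
Qed.

Lemma tau_sqr_coef n : (tau * tau) n =
  (1 - n%:R) * tau n + (if n == 2%N then 1 / 4 else 0).
Proof.
have := congr1 (fun f : fps C => f n) tau_riccati.
rewrite fps_addE fps_subE !fps_natr_mulE eulerE -fpsXnD => h.
apply: (eq_lincomb (c := 1 / 4) h).
rewrite (_ : fpsXn C (1 + 1) n = (n == 2%N)%:R) //.
by move: (tau n) ((tau * tau) n) => x y; case: eqP => _ /=; field.
Qed.

(* [z^2 wp(z)] and [z^2 (wp(z) - 4 G_2)], as power series in [z] over [C[[q]]]. *)
Definition wp : fps (fps C) := Fps (fun j => if j == 0%N then 1
  else if (4 <= j)%N then fpsC (2 / ((j - 2)`!)%:R) * Gser C j else 0).

Definition Fser : fps (fps C) := wp - fpsC (4 * Gser C 2) * fpsXn _ 2.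

Notation wpq := (swap_fps wp).

(** At q = 0 the Weierstrass function is 1/(4 sinh(z/2)^2) + 1/12. [tau_sqr_coef] makes the
    expansion linear in the Bernoulli numbers, which matches the constant terms of the G_k. *)
Lemma wpq0 : 6 * wpq 0%N = 6 * (tau * tau) - z * z.
Proof.
apply: fpsP => j; rewrite fps_subE !fps_natr_mulE tau_sqr_coef -fpsXnD swap_fpsE.
have to : odd j -> tau j = 0 := @tau_odd j.
have tb : j != 1%N -> tau j = bernoulli C j / j`!%:R := @tau_coef j.
move: (tau j) to tb => t to tb.
case: j => [|[|[|[|j]]]] in to tb *; rewrite /=.
- by rewrite tb // bernoulli0 fact0; field.
- by rewrite to //; field.
- have [b2 _ _] := bernoulli_small C.
  by rewrite tb // b2 (_ : 2`! = 2)%N //; field.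
- by rewrite to //; field.
rewrite big_ord1 /= !subSS subn0 /Gcoef /= !negbK; case: ifP => oj.
  by rewrite to /= ?negbK ?oj //; ring.
rewrite tb // (factS j.+3) (factS j.+2) 2!natrM -mul2n natrM.
have h1 := fact_neq0 j.+2; move: (j.+2`!%:R) h1 => f h1.
have e : j.+4%:R = j.+3%:R + 1 :> C by rewrite natr1.
have n3 : j.+3%:R != 0 :> C by rewrite pnatr_eq0.
have n4 : j.+3%:R + 1 != 0 :> C by rewrite -e pnatr_eq0.
by rewrite e; move: (j.+3%:R) n3 n4 {e} => k n3 n4; field; rewrite h1 n3 n4.
Qed.

Lemma wpqS n : (0 < n)%N ->
  wpq n = z * z * (\sum_(d <- divisors n) d%:R * cosz d).
Proof.
move=> n0; apply: fpsP => j; rewrite swap_fpsE -fpsXnD fpsXn_mulE fps_sumE.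
under eq_bigr do rewrite fps_natr_mulE cosz_coef.
case: j => [|[|[|[|j]]]].
- by rewrite /= (negbTE (lt0n_neq0 n0)).
- by [].
- by rewrite big1 // => d _; rewrite mulr0.
- by rewrite big1 // => d _; rewrite mulr0.
rewrite -[LHS]/((fpsC (2 / (j.+2`!)%:R) * Gser C j.+4) n) fpsC_mulE !subSS subn0 /= !negbK orbF.
case: (boolP (odd j)) => oj.
  by rewrite big1 => [|d _]; rewrite ?mulr0 // /Gcoef /= negbK oj mulr0.
rewrite -[Gcoef _ _ _]/(Gser C j.+4 n) Gser_sigma //= ?negbK // /sigma mulr_sumr.
by apply: eq_bigr => d _; rewrite [_ ^+ j.+3]exprS; ring.
Qed.

(** With U = z^2 u, the operator euler^2 - 5 euler + 6 sends U to z^4 u'', so the conclusion is the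
    degenerate Weierstrass equation u'' = 6 u^2 - 1/24. *)
Lemma ode_of_riccati (T U : fps C) :
  4 * euler T = 4 * T - 4 * (T * T) + z * z -> 6 * U = 6 * (T * T) - z * z ->
  24 * (euler (euler U) - 5 * euler U + 6 * U) = 144 * (U * U) - z * z * (z * z).
Proof.
have ez : euler (z * z) = 2 * (z * z) by rewrite -fpsXnD eulerXn.
move=> ht hU; set t1 := euler T in ht.
have ht2 : 4 * euler t1 = 4 * t1 - 8 * (T * t1) + 2 * (z * z).
  have := congr1 (@euler C) ht; rewrite raddfD raddfB /= ez !euler_natrM eulerM -/t1 => ->.
  by ring.
have hU1 : 6 * euler U = 12 * (T * t1) - 2 * (z * z).
  by rewrite -euler_natrM hU raddfB /= ez euler_natrM eulerM -/t1; ring.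
have hU2 : 6 * euler (euler U) = 12 * (t1 * t1) + 12 * (T * euler t1) - 4 * (z * z).
  by rewrite -euler_natrM hU1 raddfB /= !euler_natrM ez eulerM -/t1; ring.
apply: (eq_lincomb (c := 4) hU2); apply: (eq_lincomb (c := -20) hU1).
apply: (eq_lincomb (c := 24 - 4 * (6 * U + 6 * (T * T) - z * z)) hU).
apply: (eq_lincomb (c := 12 * T) ht2).
set r := 4 * T - 4 * (T * T) + z * z in ht.
by apply: (eq_lincomb (c := 3 * (4 * t1 + r) - 60 * T + 12 * T - 24 * (T * T)) ht); rewrite /r; ring.
Qed.

Definition csum (k n : nat) : fps C := \sum_(d <- divisors n) d%:R ^+ k * cosz d.

Definition cconv (n : nat) : fps C :=
  \sum_(1 <= i < n) csum 1 i * csum 1 (n - i).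

Lemma euler_csum n : euler (euler (csum 1 n)) - euler (csum 1 n) =
  z * z * (csum 3 n + 2 * fpsC (sigma C 3 n)).
Proof.
rewrite /csum /sigma [fpsC _]rmorph_sum !(raddf_sum (@euler C)) /= -sumrB.
rewrite [2 * _]mulr_sumr -big_split mulr_sumr.
apply: eq_bigr => d _ /=; rewrite rmorphXn rmorph_nat expr1 !euler_natrM.
by apply: (eq_lincomb (c := d%:R) (euler2_cosz d)); ring.
Qed.

Lemma cconvE n : (0 < n)%N -> 6 * cconv n =
  csum 3 n - csum 1 n - 12 * \sum_(d <- divisors n) d%:R * \sum_(0 <= a < d) (d%:R - a%:R) * cosz a.
Proof.
move=> n0; have := second_convolution n0 cosz0.
have -> : \sum_(q <- quads n) q.1.1%:R * q.1.2%:R * (cosz (q.1.1 + q.1.2) +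
   cosz (adist q.1.1 q.1.2) - 2 * cosz q.1.1 - 2 * cosz q.1.2) = cconv n.
  transitivity (\sum_(q <- quads n) q.1.1%:R ^+ 1 * cosz q.1.1 * (q.1.2%:R ^+ 1 * cosz q.1.2)).
    by apply: eq_bigr => q _; rewrite -coszM; ring.
  by rewrite (sum_quads_mul (fun a => a%:R ^+ 1 * cosz a) (fun a => a%:R ^+ 1 * cosz a)).
move=> ->; rewrite /csum mulr_sumr -!sumrB; apply: eq_bigr => d _.
by move: (\sum_(0 <= a < d) _) => K; ring.
Qed.

(** [cosz_sum] gives the inner sums of [cconvE] only after multiplication by [cosz 1];
    [tau_sqr_cosz], read as (4 tau^2 - z^2) cosz 1 = 4 z^2, trades that factor for z^2. *)
Lemma cconv_tau n : (0 < n)%N -> 24 * (z * z * cconv n) =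
  4 * (z * z * csum 3 n) - 4 * (z * z * csum 1 n)
    - 12 * ((4 * (tau * tau) - z * z) * csum 1 n) + 48 * (z * z * fpsC (sigma C 3 n)).
Proof.
move=> n0.
pose K := \sum_(d <- divisors n) d%:R * \sum_(0 <= a < d) (d%:R - a%:R) * cosz a.
have hK : 4 * (z * z * K) = (4 * (tau * tau) - z * z) * csum 1 n - 4 * (z * z * fpsC (sigma C 3 n)).
  rewrite /K /csum /sigma [fpsC _]rmorph_sum.
  pose k d := \sum_(0 <= a < d) (d%:R - a%:R) * cosz a.
  rewrite -[\sum_(d <- _) d%:R * _]/(\sum_(d <- divisors n) d%:R * k d).
  rewrite !mulr_sumr -sumrB; apply: eq_bigr => d _ /=.
  rewrite rmorphXn rmorph_nat expr1 /k {k}.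
  have := cosz_sum d; have := tau_sqr_cosz; move: (\sum_(0 <= a < d) _) (cosz d) (cosz 1) (tau).
  move=> k1 c c1 t ht hk.
  apply: (eq_lincomb (c := d%:R * (4 * (t * t) - z * z)) hk).
  by apply: (eq_lincomb (c := - d%:R * (k1 + d%:R ^+ 2)) ht); ring.
have := cconvE n0; rewrite -/K; move: hK.
move: K (cconv n) (csum 3 n) (csum 1 n) (fpsC _) (tau) => K T s3 s1 sg t hK hT.
apply: (eq_lincomb (c := 4 * (z * z)) hT).
by apply: (eq_lincomb (c := -12) hK); ring.
Qed.

(** This is wp'' = 6 wp^2 - 10 G_4 read at q^n, with [g] the coefficient of 10 G_4. That term sits
    in degree 4 in z, out of sight of [wp_rec]. *)
Lemma wp_ode n : exists g : C, euler (euler (wpq n)) - 5 * euler (wpq n) + 6 * wpq n =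
  6 * (wpq * wpq) n - fpsC g * fpsXn _ 4.
Proof.
have z4 : fpsXn C 4 = (z * z) * (z * z) by rewrite -!fpsXnD.
have [->|n0] := posnP n.
  exists (1 / 24); rewrite coef0_mul z4; apply: (@fps_natI 23).
  have h24 : 24 * fpsC (1 / 24) = 1 :> fps C.
    by rewrite -(rmorph_nat (@fpsC C)) -rmorphM mulrA mulr1 mulfV ?pnatr_eq0 // rmorph1.
  rewrite (ode_of_riccati tau_riccati wpq0).
  by apply: (eq_lincomb (c := (z * z) * (z * z)) h24); ring.
exists (10 * sigma C 3 n); rewrite z4.
have -> : fpsC (10 * sigma C 3 n) = 10 * fpsC (sigma C 3 n) by rewrite rmorphM rmorph_nat.
have hW : (wpq * wpq) n = 2 * (wpq 0%N * wpq n) + z * z * (z * z) * cconv n.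
  rewrite fps_mul_coef //.
  have -> : \sum_(1 <= i < n) wpq i * wpq (n - i)%N = z * z * (z * z) * cconv n.
    rewrite mulr_sumr; apply: eq_big_nat => i /andP[i0 ltin].
    by rewrite !wpqS ?subn_gt0 // mulrACA.
  by move: (wpq 0%N) (wpq n) (cconv _) => a b c; ring.
have hn : wpq n = z * z * csum 1 n by rewrite wpqS.
have ez : euler (z * z) = 2 * (z * z) by rewrite -fpsXnD eulerXn.
rewrite hW hn; have := wpq0; have := cconv_tau n0; have := euler_csum n.
move: (wpq 0%N) (cconv n) (csum 3 n) (csum 1 n) (fpsC _) (tau) => W0 T s3 s1 sg t hs hT hW0.
have h1 f : euler (z * z * f) = 2 * (z * z * f) + z * z * euler f.
  by rewrite eulerM ez; ring.
rewrite h1 raddfD /= euler_natrM !h1.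
apply: (@fps_natI 3).
apply: (eq_lincomb (c := 4 * (z * z)) hs).
apply: (eq_lincomb (c := - (z * z)) hT).
by apply: (eq_lincomb (c := -8 * (z * z) * s1) hW0); ring.
Qed.

(** In degree j the operator gives j^2 - 5j + 6, and the two products with [wp 0 = 1] give 12; the
    difference is (j - 6)(j + 1). The range of i reflects that [wp] vanishes in degrees 1, 2, 3. *)
Lemma wp_rec j : (8 <= j)%N ->
  (j%:R - 6) * j.+1%:R * wp j = 6 * \sum_(4 <= i < j - 3) wp i * wp (j - i)%N.
Proof.
move=> j8; apply: fpsP => n.
have [g /(congr1 (fun f : fps C => f j))] := wp_ode n.
rewrite fps_addE !fps_subE !fps_natr_mulE !eulerE fpsC_mulE.
have -> : fpsXn C 4 j = 0 by rewrite /=; case: eqP j8 => // ->.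
rewrite -rmorphM !swap_fpsE.
have -> : (wp * wp) j = 2 * wp j + \sum_(4 <= i < j - 3) wp i * wp (j - i)%N.
  have j0 : (0 < j)%N by lia.
  rewrite fps_mul_coef // (_ : wp 0%N = 1) //.
  rewrite (@big_cat_nat _ _ _ 4) //; last by lia.
  rewrite [X in _ + (X + _)]big_nat big1 ?add0r; last first.
    move=> i /andP[i0 i4]; rewrite [X in X * _](_ : _ = 0) ?mul0r //.
    by rewrite /= (negbTE (lt0n_neq0 i0)) leqNgt i4.
  rewrite (@big_cat_nat _ _ _ (j - 3)%N) //; try by lia.
  rewrite [X in _ + (_ + X)]big_nat [X in _ + (_ + X)]big1 ?addr0; last first.
    move=> i /andP[i1 i2]; rewrite [X in _ * X](_ : _ = 0) ?mulr0 //.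
    by rewrite /= ifF ?ifF //; lia.
  by ring.
have -> : (j%:R - 6) * j.+1%:R = fpsC ((j%:R - 6) * j.+1%:R) :> fps C.
  by rewrite (rmorphM (@fpsC C)) (rmorphB (@fpsC C) j%:R 6) !(rmorph_nat (@fpsC C)).
rewrite fpsC_mulE fps_addE !fps_natr_mulE => h.
by apply: (eq_lincomb (c := 1) h); rewrite -natr1; ring.
Qed.

End WeierstrassP.

(** * The quasi-modular forms [A_k] *)

Section Truncation.
Variable C : numFieldType.

Lemma two_half : 2 * fpsC (1 / 2) = 1 :> fps C.
Proof.
by rewrite -(rmorph_nat (@fpsC C)) -rmorphM mulrA mulr1 mulfV ?pnatr_eq0 // rmorph1.
Qed.

Lemma Fser0 : Fser C 0%N = 1.
Proof. by rewrite fps_subE mulrC fpsXn_mulE subr0. Qed.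

Definition Sser : fps (fps C) := sval (cid (fps_sqrt_exists two_half Fser0)).

Lemma Sser0 : Sser 0%N = 1.
Proof. by rewrite /Sser; case: cid => S []. Qed.

Lemma SserE : Sser * Sser = Fser C.
Proof. by rewrite /Sser; case: cid => S []. Qed.

Definition fps_of_poly (p : {poly C}) : fps C := Fps (fun n => p`_n).

Fact fps_of_poly_additive : zmod_morphism fps_of_poly.
Proof. by move=> p q; apply: fpsP => n; rewrite /= coefB. Qed.

Fact fps_of_poly_multiplicative : monoid_morphism fps_of_poly.
Proof.
split=> [|p q]; apply: fpsP => n; first by rewrite fps_1E /= coef1.
by rewrite fps_mulE /= coefM.
Qed.

HB.instance Definition _ :=
  GRing.isZmodMorphism.Build _ _ fps_of_poly fps_of_poly_additive.
HB.instance Definition _ :=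
  GRing.isMonoidMorphism.Build _ _ fps_of_poly fps_of_poly_multiplicative.

Definition ord_gt (N : nat) (f : fps C) : Prop := forall i, (i <= N)%N -> f i = 0.

Lemma ord_gt0 N : ord_gt N 0. Proof. by []. Qed.

Lemma ord_gtD N f g : ord_gt N f -> ord_gt N g -> ord_gt N (f + g).
Proof. by move=> hf hg i leiN; rewrite fps_addE hf ?hg ?addr0. Qed.

Lemma ord_gtB N f g : ord_gt N f -> ord_gt N g -> ord_gt N (f - g).
Proof. by move=> hf hg i leiN; rewrite fps_subE hf ?hg ?subr0. Qed.

Lemma ord_gtM N f g : ord_gt N g -> ord_gt N (f * g).
Proof.
move=> hg i leiN; rewrite fps_mulE big1 // => j _.
by rewrite hg ?mulr0 // (leq_trans (leq_subr _ _)).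
Qed.

Lemma fps_of_Gtrunc k N : ord_gt N (fps_of_poly (Gtrunc C k N) - Gser C k).
Proof. by move=> i leiN; rewrite fps_subE /= coef_poly ltnS leiN subrr. Qed.

Lemma fps_of_Fz N j : ord_gt N (fps_of_poly (Fz C N j) - Fser C j).
Proof.
have scaleE c p : fps_of_poly (c *: p) = fpsC c * fps_of_poly p.
  by apply: fpsP => n; rewrite fpsC_mulE /= coefZ.
have polyB p q : fps_of_poly (p - q) = fps_of_poly p - fps_of_poly q by exact: rmorphB.
have poly1 : fps_of_poly 1 = 1 by exact: rmorph1.
have poly0 : fps_of_poly 0 = 0 by exact: rmorph0.
rewrite /Fz polyB [Fser C j]fps_subE.
have -> (a b c d : fps C) : a - b - (c - d) = (a - c) + -1 * (b - d) by ring.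
apply: ord_gtD; [|apply: ord_gtM].
  rewrite /wpz /wp [fcoef _ _]/=; case: eqP => _; first by rewrite poly1 subrr.
  case: ifP => _; last by rewrite poly0 subrr.
  by rewrite scaleE -mulrBr; apply/ord_gtM/fps_of_Gtrunc.
rewrite [fpsC _ * _]mulrC fpsXn_mulE; case: (ltngtP j 2) => [lt|gt|->].
- by rewrite poly0 subrr.
- by rewrite poly0 fpsCE subn_eq0 leqNgt gt subrr.
rewrite subnn fpsCE eqxx scaleE (rmorph_nat (@fpsC C)) -mulrBr.
by apply/ord_gtM/fps_of_Gtrunc.
Qed.

Lemma Fps_smul (a b : nat -> {poly C}) : Fps (smul a b) = Fps a * Fps b.
Proof. by []. Qed.

Lemma Fps_spow (a : nat -> {poly C}) k : Fps (spow a k) = Fps a ^+ k.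
Proof. by elim: k => [|k IH]; rewrite ?expr0 // exprS -IH. Qed.

Section SqrtSer.
Variable F : nat -> {poly C}.

Lemma size_sqrt_seq m : size (sqrt_seq F m) = m.+1.
Proof. by elim: m => //= m IH; rewrite size_rcons IH. Qed.

Lemma nth_sqrt_seq m j : (j <= m)%N -> (sqrt_seq F m)`_j = sqrt_ser F j.
Proof.
elim: m => [|m IH]; first by rewrite leqn0 => /eqP ->.
rewrite leq_eqVlt => /predU1P[-> //|ltjm].
by rewrite /= nth_rcons size_sqrt_seq ltjm IH.
Qed.

Lemma sqrt_serM : F 0%N = 1 -> Fps (sqrt_ser F) * Fps (sqrt_ser F) = Fps F.
Proof.
move=> F0; apply: fps_sqrt_intro => // -[|m] // _.
rewrite /= {1}/sqrt_ser /= nth_rcons size_sqrt_seq ltnn eqxx.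
rewrite -[2](rmorph_nat (@polyC C)) mul_polyC scalerA mulfV ?pnatr_eq0 // scale1r.
congr (_ - _); apply: eq_big_nat => i /andP[i0 ltim].
by rewrite !nth_sqrt_seq //; lia.
Qed.

End SqrtSer.

(** [A] truncates in q at order n before taking products and the square root. Both respect
    congruence modulo q^(n+1), so the coefficient of q^n is that of the exact series. *)
Lemma A_fps k n :
  A C k n = (-1) ^+ k / (odd_dfact k)%:R * (Fser C ^+ k * Sser) k.*2 n.
Proof.
rewrite /A; congr (_ * _).
pose phi := [the {rmorphism {poly C} -> fps C} of fps_of_poly].
pose Ft := map_fps phi (Fps (Fz C n)); pose St := map_fps phi (Fps (sqrt_ser (Fz C n))).
have -> : (res_trunc C k n)`_n = (Ft ^+ k * St) k.*2 n.
  rewrite /Ft /St -rmorphXn -rmorphM map_fpsE -Fps_spow -Fps_smul.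
  by [].
have hF j : ord_gt n (Ft j - Fser C j) by apply: fps_of_Fz.
have Ft0 : Ft 0%N = 1.
  by rewrite /Ft map_fpsE /= /Fz /wpz subr0; apply: rmorph1.
have hS j : ord_gt n (St j - Sser j).
  apply: (fps_sqrt_unique (@ord_gt0 n) (@ord_gtB n) (@ord_gtM n) two_half).
  - by rewrite /St map_fpsE; apply: rmorph1.
  - exact: Sser0.
  move=> i; rewrite SserE (_ : St * St = Ft) //.
  by rewrite /St -rmorphM sqrt_serM // /Fz /wpz subr0.
have hFk j : ord_gt n ((Ft ^+ k) j - (Fser C ^+ k) j).
  elim: k j => [|k IH] j; first by rewrite !expr0 subrr.
  by rewrite !exprS; apply: (fps_mul_congr (@ord_gt0 n) (@ord_gtD n) (@ord_gtM n)).
have := fps_mul_congr (@ord_gt0 n) (@ord_gtD n) (@ord_gtM n) hFk hS.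
move=> /(_ k.*2 n (leqnn n)); rewrite fps_subE => /eqP.
by rewrite subr_eq0 => /eqP.
Qed.

End Truncation.

(** * Lifting the residues to polynomials in G_2, G_4, G_6 *)

Section QuasiModular.
Variable C : numFieldType.
Notation M := {mpoly C[3]}.
Implicit Types (P Q : M) (w : nat).

Definition Gval (i : 'I_3) : fps C := Gser C (2 * i.+1).

(** Unlike [qexp], whose truncation order varies with the coefficient asked for, this is a ring
    morphism to power series. *)
Definition qser P : fps C := mmap (@fpsC C) Gval P.

HB.instance Definition _ := GRing.RMorphism.copy qser (mmap (@fpsC C) Gval).

Lemma qserZ c P : qser (c *: P) = fpsC c * qser P.
Proof. exact: mmapZ. Qed.

Lemma qserX i : qser 'X_i = Gval i.
Proof. by rewrite /qser mmapX mmap1U. Qed.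

Lemma qexpE P n : qexp P n = qser P n.
Proof.
pose phi := [the {rmorphism {poly C} -> fps C} of @fps_of_poly C].
have eq_trunc : ord_gt n (phi (mmap (@polyC C) (fun i : 'I_3 => Gtrunc C (2 * i.+1) n) P) - qser P).
  rewrite /qser /mmap rmorph_sum -sumrB; apply: big_ind => // [|m _].
    exact: ord_gtD.
  have congrM (f f' g g' : fps C) : ord_gt n (f - f') -> ord_gt n (g - g') ->
      ord_gt n (f * g - f' * g').
    move=> hf hg; have -> : f * g - f' * g' = f * (g - g') + g' * (f - f') by ring.
    by apply: ord_gtD; apply: ord_gtM.
  rewrite rmorphM; apply: (congrM).
    move=> i _; rewrite fps_subE fpsCE /= coefC.
    by case: eqP => _; rewrite subrr.
  rewrite /mmap1 rmorph_prod.
  apply: (big_ind2 (fun x y => ord_gt n (x - y))); first by rewrite subrr.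
    by move=> *; apply: (congrM).
  move=> i _; rewrite rmorphXn; elim: (m i) => [|e IH]; first by rewrite !expr0 subrr.
  by rewrite !exprS; apply: (congrM) => //; apply: fps_of_Gtrunc.
have := eq_trunc n (leqnn n); rewrite fps_subE => /eqP.
by rewrite subr_eq0 => /eqP.
Qed.

Definition mweight (m : 'X_{1..3}) : nat := (\sum_(i < 3) 2 * i.+1 * m i)%N.

Lemma mweightD m1 m2 : mweight (m1 + m2)%MM = (mweight m1 + mweight m2)%N.
Proof.
by rewrite /mweight -big_split /=; apply: eq_bigr => i _; rewrite mnmDE mulnDr.
Qed.

Lemma homog0 w : qmod_homog w (0 : M).
Proof. by move=> m; rewrite msupp0. Qed.

Lemma homog1 : qmod_homog 0 (1 : M).
Proof.
move=> m; rewrite msupp1 inE => /eqP ->.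
by rewrite big1 // => i _; rewrite mnm0E muln0.
Qed.

Lemma homogZ w c P : qmod_homog w P -> qmod_homog w (c *: P).
Proof. by move=> hP m /msuppZ_le /hP. Qed.

Lemma homogB w P Q : qmod_homog w P -> qmod_homog w Q -> qmod_homog w (P - Q).
Proof.
by move=> hP hQ m /msuppB_le; rewrite mem_cat => /orP[/hP|/hQ].
Qed.

Lemma homogM w1 w2 P Q :
  qmod_homog w1 P -> qmod_homog w2 Q -> qmod_homog (w1 + w2) (P * Q).
Proof.
move=> hP hQ m /msuppM_le /allpairsP [[m1 m2] [/= /hP + /hQ + ->]].
by rewrite -!/(mweight _) mweightD => -> ->.
Qed.

Lemma homogX (i : 'I_3) : qmod_homog (2 * i.+1) ('X_i : M).
Proof.
move=> m; rewrite msuppX inE => /eqP ->.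
rewrite (bigD1 i) //= mnm1E eqxx muln1 big1 ?addn0 // => j ji.
by rewrite mnm1E eq_sym (negbTE ji) muln0.
Qed.

Notation graded := (graded (@qmod_homog C)).

(** [P] lifts the coefficient of z^j in [wp] to a polynomial free of G_2. The last clause makes the
    lifted series start with 1, as the square root requires. *)
Definition modular_coef (j : nat) P :=
  [/\ qmod_homog j P, qser P = wp C j, P^`M(ord0) = 0 & j = 0%N -> P = 1].

Lemma modular_coef_exists j : exists P, modular_coef j P.
Proof.
elim/ltn_ind: j => j IH.
have [oj|ej] := boolP (odd j).
  exists 0; split; rewrite ?mderiv0 ?rmorph0 //; first exact: homog0.
    rewrite /wp /=; case: eqP oj => [->//|_ oj]; case: ifP => // _.
    by apply: fpsP => n; rewrite fpsC_mulE /= /Gcoef oj mulr0.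
  by move=> j0; rewrite j0 in oj.
have [j8|] := leqP 8 j; last first.
  case: j ej {IH} => [|[|[|[|[|[|[|[|j]]]]]]]] //= _ _.
  - exists 1; split; rewrite ?rmorph1 //; first exact: homog1.
    by rewrite -[1]/(1%:MP_[3]) mderivC.
  - by exists 0; split; rewrite ?mderiv0 ?rmorph0 //; apply: homog0.
  - exists 'X_(inord 1); split=> //.
    + by have := @homogX (inord 1); rewrite inordK.
    + rewrite qserX /Gval inordK // /wp /= subn2 /= (_ : 2`! = 2)%N //.
      by rewrite mulfV ?pnatr_eq0 // rmorph1 mul1r.
    + by rewrite mderivX mnm1E -val_eqE /= inordK // scale0r.
  (* 1/12 is 2/4!, the factor of G_6 in [wp]. *)
  exists ((1 / 12) *: 'X_(inord 2)); split=> //.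
  + by apply: homogZ; have := @homogX (inord 2); rewrite inordK.
  + rewrite qserZ qserX /Gval inordK // /wp /= (_ : (6 - 2)`! = 24)%N //.
    by congr (fpsC _ * _); field.
  + by rewrite mderivZ mderivX mnm1E -val_eqE /= inordK // scale0r scaler0.
have [H hH] : {H : nat -> M & forall i, (i < j)%N -> modular_coef i (H i)}.
  suff ex i : exists P, (i < j)%N -> modular_coef i P by exact: (choice ex).
  case: (ltnP i j) => [/IH [P hP]|]; last by exists 0.
  by exists P.
(* The factor of [wp j] in [wp_rec], nonzero from j = 8 on. *)
pose c : C := (j%:R - 6) * j.+1%:R.
have c0 : c != 0.
  rewrite mulf_neq0 ?pnatr_eq0 // subr_eq0.
  by rewrite eqr_nat; case: eqP j8 => // ->.
exists ((6 / c) *: \sum_(4 <= i < j - 3) H i * H (j - i)%N); split.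
- apply: homogZ; rewrite big_nat; apply: (graded_sum homog0 homogB) => i /andP[i4 ltij].
  have lt1 : (i < j)%N by lia.
  have lt2 : (j - i < j)%N by lia.
  rewrite -[X in qmod_homog X](subnKC (ltnW lt1)).
  by apply: homogM; [case: (hH _ lt1) | case: (hH _ lt2)].
- rewrite qserZ rmorph_sum /=.
  have -> : \sum_(4 <= i < j - 3) qser (H i * H (j - i)%N) =
      \sum_(4 <= i < j - 3) wp C i * wp C (j - i)%N.
    apply: eq_big_nat => i /andP[i4 ltij].
    have lt1 : (i < j)%N by lia.
    have lt2 : (j - i < j)%N by lia.
    have [_ <- _ _] := hH _ lt1; have [_ <- _ _] := hH _ lt2.
    exact: rmorphM.
  have := wp_rec C j8.
  have -> : (j%:R - 6) * j.+1%:R = fpsC c.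
    by rewrite /c (rmorphM (@fpsC C)) (rmorphB (@fpsC C) j%:R 6) !(rmorph_nat (@fpsC C)).
  move: (\sum_(4 <= i < j - 3) _) => S hS.
  have -> : fpsC (6 / c) = fpsC c^-1 * 6 by rewrite mulrC rmorphM (rmorph_nat (@fpsC C)).
  by rewrite -mulrA -hS mulrA -rmorphM mulVf // rmorph1 mul1r.
- rewrite mderivZ (raddf_sum (mderiv ord0)) big_nat big1 ?scaler0 // => i /andP[i4 ltij].
  have lt1 : (i < j)%N by lia.
  have lt2 : (j - i < j)%N by lia.
  have [_ _ d1 _] := hH _ lt1; have [_ _ d2 _] := hH _ lt2.
  transitivity ((H i)^`M(ord0) * H (j - i)%N + H i * (H (j - i)%N)^`M(ord0)).
    exact: mderivM.
  by rewrite d1 d2 mul0r mulr0 addr0.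
by move=> j0; rewrite j0 in j8.
Qed.

(** d/dG_2 acts on polynomials, not on q-expansions, so the construction of A_k is repeated with
    coefficients in [M]. *)
Definition Hser : fps M := Fps (fun j => sval (cid (modular_coef_exists j))).

Lemma HserP j : modular_coef j (Hser j).
Proof. by rewrite /=; case: cid. Qed.

Definition Fqm : fps M := Hser - fpsC (4 * 'X_ord0) * fpsXn _ 2.

Lemma Fqm_coef j : Fqm j = Hser j - (if j == 2%N then 4 * 'X_ord0 else 0).
Proof.
rewrite fps_subE fpsC_mulE [fpsXn _ _ _]/=.
by case: eqP => _; rewrite (mulr1, mulr0).
Qed.

Lemma mnat (k : nat) : k%:R = k%:R%:MP_[3] :> M.
Proof. by rewrite mpolyC_nat. Qed.

Lemma graded_Fqm : graded Fqm.
Proof.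
move=> j; rewrite Fqm_coef; apply: homogB; first by case: (HserP j).
case: eqP => [->|_]; last exact: homog0.
by rewrite mnat mul_mpolyC; apply: homogZ; apply: homogX.
Qed.

Lemma qser_Fqm j : qser (Fqm j) = Fser C j.
Proof.
have qserB P Q : qser (P - Q) = qser P - qser Q by exact: rmorphB.
rewrite Fqm_coef qserB; have [_ -> _ _] := HserP j.
rewrite [RHS]fps_subE fpsC_mulE [fpsXn _ _ _]/=; congr (_ - _).
case: eqP => _; rewrite ?mulr1 ?mulr0; last exact: rmorph0.
by rewrite mnat mul_mpolyC qserZ qserX (rmorph_nat (@fpsC C)).
Qed.

Lemma Fqm0 : Fqm 0%N = 1.
Proof. by rewrite Fqm_coef subr0; case: (HserP 0) => _ _ _ ->. Qed.

Lemma mhalf : 2 * (1 / 2)%:MP_[3] = 1 :> M.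
Proof. by rewrite mnat -mpolyCM mulrA mulr1 mulfV ?pnatr_eq0 // mpolyC1. Qed.

Definition Sqm : fps M := sval (cid (fps_sqrt_exists mhalf Fqm0)).

Lemma Sqm0 : Sqm 0%N = 1.
Proof. by rewrite /Sqm; case: cid => S []. Qed.

Lemma SqmE : Sqm * Sqm = Fqm.
Proof. by rewrite /Sqm; case: cid => S []. Qed.

Lemma graded_Sqm : graded Sqm.
Proof.
apply: (graded_sqrt homog0 homog1 homogB homogM mhalf); rewrite ?SqmE ?Sqm0 //.
  by move=> n a ha; rewrite mul_mpolyC; apply: homogZ.
exact: graded_Fqm.
Qed.

Notation qserf := (map_fps [the {rmorphism M -> fps C} of qser]).

Lemma qserf_Fqm : qserf Fqm = Fser C.
Proof. by apply: fpsP => j; rewrite map_fpsE; apply: qser_Fqm. Qed.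

Lemma qserf_Sqm : qserf Sqm = Sser C.
Proof.
apply: fpsP => j; apply/eqP; rewrite -subr_eq0; apply/eqP; move: j.
apply: (@fps_sqrt_unique _ (fun x => x = 0) (fpsC (1 / 2)) (qserf Sqm) (Sser C)) => //.
- by move=> a b -> ->; rewrite subr0.
- by move=> a b ->; rewrite mulr0.
- exact: two_half.
- by rewrite map_fpsE Sqm0; apply: rmorph1.
- exact: Sser0.
have e : qserf Sqm * qserf Sqm = Fser C.
  by rewrite -qserf_Fqm -SqmE; apply/esym/rmorphM.
by move=> n; rewrite e SserE subrr.
Qed.

Definition Aqm (k : nat) : M :=
  ((-1) ^+ k / (odd_dfact k)%:R) *: (Fqm ^+ k * Sqm) k.*2.

Lemma homog_Aqm k : qmod_homog k.*2 (Aqm k).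
Proof.
apply/homogZ/(graded_mul homog0 homogB homogM); last exact: graded_Sqm.
exact/(graded_exp homog0 homog1 homogB homogM)/graded_Fqm.
Qed.

Lemma qser_Aqm k n : qser (Aqm k) n = A C k n.
Proof.
rewrite qserZ fpsC_mulE A_fps; congr (_ * _).
by rewrite -qserf_Fqm -qserf_Sqm -rmorphXn -rmorphM.
Qed.

Definition dG2 (f : fps M) : fps M := Fps (fun n => (f n)^`M(ord0)).

Lemma dG2M f g : dG2 (f * g) = dG2 f * g + f * dG2 g.
Proof.
apply: fpsP => n; rewrite fps_addE !fps_mulE -big_split.
transitivity (\sum_(i < n.+1) (f i * g (n - i)%N)^`M(ord0)).
  by apply: (raddf_sum (mderiv ord0)).
by apply: eq_bigr => i _; rewrite mderivM.
Qed.

Lemma dG2X f k : dG2 (f ^+ k.+1) = k.+1%:R * f ^+ k * dG2 f.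
Proof.
elim: k => [|k IH]; first by rewrite expr1 expr0; ring.
by rewrite exprS dG2M IH -(natr1 k.+1) !exprS; ring.
Qed.

Lemma dG2_Fqm : dG2 Fqm = - (4 * fpsXn _ 2).
Proof.
apply: fpsP => j; rewrite fps_oppE fps_natr_mulE -[LHS]/((Fqm j)^`M(ord0)) Fqm_coef.
have [_ _ d _] := HserP j; rewrite mderivB d sub0r /=.
case: eqP => _; last by rewrite mderiv0 mulr0.
rewrite mulr1 mnat mderiv_mulC mderivX mnm1E eqxx scale1r.
by rewrite (_ : (U_(ord0) - U_(ord0))%MM = 0%MM) ?mpolyX0 ?mulr1 //; apply/mnmP => i; rewrite mnmBE subnn mnm0E.
Qed.

Lemma dG2_Sqm : Sqm * dG2 Sqm = - (2 * fpsXn _ 2).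
Proof.
have := congr1 dG2 SqmE; rewrite dG2M dG2_Fqm => h.
have hh : 2 * fpsC (1 / 2)%:MP_[3] = 1 :> fps M.
  by rewrite -(rmorph_nat (@fpsC M)) -rmorphM mhalf rmorph1.
apply: (eq_lincomb (c := fpsC (1 / 2)%:MP_[3]) h).
by apply: (eq_lincomb (c := - (Sqm * dG2 Sqm + 2 * fpsXn _ 2)) hh); ring.
Qed.

(** Differentiating the power k + 3/2 of wp - 4 G_2 gives the factor -4(k + 3/2) = -2(2k + 3); here
    2k + 3 turns (2k + 3)!! into (2k + 1)!!, and the sign adjusts the power of -1. *)
Lemma dG2_Aqm k : (Aqm k)^`M(ord0) = 2 *: (if k is k'.+1 then Aqm k' else 0).
Proof.
case: k => [|k].
  rewrite /Aqm mderivZ !expr0 !mul1r double0 Sqm0.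
  by rewrite (_ : (1 : M)^`M(ord0) = 0) ?scaler0 //; apply: mderivC.
have dFS : dG2 (Fqm ^+ k.+1 * Sqm) = - ((4 * k.+1 + 2)%:R * (fpsXn _ 2 * (Fqm ^+ k * Sqm))).
  rewrite dG2M dG2X dG2_Fqm exprS natrD natrM -{2}SqmE.
  by apply: (eq_lincomb (c := Sqm * Fqm ^+ k) dG2_Sqm); ring.
have e : ((Fqm ^+ k.+1 * Sqm) k.+1.*2)^`M(ord0) = dG2 (Fqm ^+ k.+1 * Sqm) k.+1.*2 by [].
rewrite /Aqm mderivZ e dFS fps_oppE fps_natr_mulE fpsXn_mulE doubleS /= !subSS subn0.
move: ((Fqm ^+ k * Sqm) k.*2) => y.
rewrite mulr_natl -scaler_nat scalerN scalerA -scaleNr scalerA; congr (_ *: _).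
rewrite natrM exprS -muln2 -addn3 !natrD !natrM -natr1.
have h0 : (odd_dfact k)%:R != 0 :> C.
  rewrite pnatr_eq0 -lt0n; elim: k {dFS e y} => //= k IH; by rewrite muln_gt0.
have h1 : (1 + k%:R) * 2 + 1 != 0 :> C.
  have -> : (1 + k%:R) * 2 + 1 = (k * 2 + 3)%:R :> C; first by rewrite natrD natrM; ring.
  by rewrite pnatr_eq0 addn3.
by field; rewrite h0 h1.
Qed.

Lemma A_cond_a : cond_a (A C).
Proof.
move=> k; exists (Aqm k); split; first exact: homog_Aqm.
  by move=> n; rewrite qexpE qser_Aqm.
move=> n; rewrite qexpE dG2_Aqm qserZ fpsC_mulE; congr (_ * _).
by case: k => [|k]; [rewrite rmorph0 | rewrite qser_Aqm].
Qed.

End QuasiModular.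

(** * Coefficients of [A_k] as functions of [k] *)

Section RationalCoefficients.
Variable C : numFieldType.

(** The expansion of (1 - X)^-(n+1), by Pascal's rule. *)
Lemma binser_exists n : (1 - fpsXn C 1) ^+ n.+1 * Fps (fun k => 'C(k + n, n)%:R) = 1.
Proof.
have step n' (f g : fps C) : f 0%N = g 0%N -> (forall k, f k.+1 - f k = g k.+1) ->
    (1 - fpsXn C 1) ^+ n'.+1 * f = (1 - fpsXn C 1) ^+ n' * g.
  move=> fg0 fg; rewrite exprSr -mulrA; congr (_ * _); apply: fpsP => -[|k].
    by rewrite mulrBl mul1r fps_subE fpsXn_mulE subr0.
  by rewrite mulrBl mul1r fps_subE fpsXn_mulE subn1 -fg.
elim: n => [|n IH].
  have c1 k : 'C(k + 0, 0)%:R = 1 :> C by rewrite bin0.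
  rewrite (step 0%N _ 1); first by rewrite expr0 mulr1.
    by rewrite fps_1E /= c1.
  by move=> k; rewrite fps_1E /= !c1 subrr.
rewrite (step n.+1 _ (Fps (fun k => 'C(k + n, n)%:R))); first exact: IH.
  by rewrite /= !add0n !binn.
by move=> k; rewrite /= addSn binS natrD addSnnS addrC addKr.
Qed.

(** The binomial coefficient of k - i + n over n as a polynomial in k, i.e. the coefficient of X^k
    in X^i / (1 - X)^(n+1) for k >= i. *)
Definition risepoly (n i : nat) : {poly C} :=
  (n`!%:R)^-1 *: \prod_(j < n) ('X - (i%:R - j.+1%:R)%:P).

Lemma size_risepoly n i : size (risepoly n i) = n.+1.
Proof.
rewrite size_scale ?invr_eq0 ?fact_neq0 // -(big_mkord xpredT (fun j => 'X - (i%:R - j.+1%:R)%:P)).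
rewrite -(big_map (fun j : nat => (i%:R - j.+1%:R) : C) xpredT (fun a => 'X - a%:P)).
by rewrite size_prod_XsubC size_map size_iota subn0.
Qed.

Lemma coef_risepoly n i : (risepoly n i)`_n = (n`!%:R)^-1.
Proof.
have := size_risepoly n i; rewrite /risepoly size_scale ?invr_eq0 ?fact_neq0 // => sz.
rewrite coefZ; have : \prod_(j < n) ('X - (i%:R - j.+1%:R)%:P) \is @monic C.
  by apply: monic_prod => j _; apply: monicXsubC.
by move/monicP; rewrite lead_coefE sz /= => ->; rewrite mulr1.
Qed.

Lemma horner_risepoly n i k : (i <= k)%N -> (risepoly n i).[k%:R] = 'C(k - i + n, n)%:R.
Proof.
move=> leik; rewrite hornerZ horner_prod.
have -> : \prod_(j < n) ('X - (i%:R - j.+1%:R)%:P).[k%:R] = ((k - i + n) ^_ n)%:R :> C.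
  rewrite ffact_prod natr_prod (reindex_inj rev_ord_inj) /=; apply: eq_bigr => j _.
  have -> : (k - i + n - j = k - i + (n - j.+1).+1)%N by have := ltn_ord j; lia.
  by rewrite hornerXsubC natrD natrB //; ring.
by rewrite -bin_ffact natrM mulrC mulfK ?fact_neq0.
Qed.

(** The roots i - n, ..., i - 1 extend the formula below degree i, where X^i / (1 - X)^(n+1) has
    coefficient 0. *)
Lemma horner_risepoly0 n i k : (k < i)%N -> (i <= k + n)%N -> (risepoly n i).[k%:R] = 0.
Proof.
move=> ltki lein; rewrite hornerZ horner_prod.
have ltn' : (i - k.+1 < n)%N by lia.
rewrite (bigD1 (Ordinal ltn')) //= hornerXsubC -natrB; last by lia.
by rewrite (_ : i - (i - k.+1).+1 = k)%N ?subrr ?mul0r ?mulr0 //; lia.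
Qed.

(** Each monomial X^i of the numerator obeys its polynomial formula once k >= i - n; since i <= 2n,
    all do so from k = n on. *)
Lemma rational_coef n (h : fps C) (P : {poly C}) : (size P <= n.*2.+1)%N ->
  (1 - fpsXn C 1) ^+ n.+1 * h = fps_of_poly P ->
  exists r : {poly C}, [/\ (size r <= n.+1)%N, r`_n = P.[1] / n`!%:R &
    forall k, (n <= k)%N -> h k = r.[k%:R]].
Proof.
move=> sP hE; pose b := Fps (fun k => 'C(k + n, n)%:R) : fps C.
have {hE} -> : h = fps_of_poly P * b.
  by rewrite -hE mulrAC binser_exists mul1r.
exists (\sum_(i < n.*2.+1) P`_i *: risepoly n i); split.
- apply: (leq_trans (size_sum _ _ _)); apply/bigmax_leqP => i _.
  by rewrite (leq_trans (size_scale_leq _ _)) // size_risepoly.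
- rewrite coef_sum (horner_coef_wide _ sP) mulr_suml; apply: eq_bigr => i _.
  by rewrite coefZ coef_risepoly expr1n mulr1.
move=> k lenk; rewrite horner_sum fps_mulE.
rewrite (big_ord_widen_cond (maxn k.+1 n.*2.+1) xpredT (fun i => P`_i * b (k - i)%N)) ?leq_maxl //.
rewrite (big_ord_widen_cond (maxn k.+1 n.*2.+1) xpredT (fun i => (P`_i *: risepoly n i).[k%:R])) ?leq_maxr //.
rewrite big_mkcond [RHS]big_mkcond /=; apply: eq_bigr => i _.
rewrite !ltnS hornerZ; case: (leqP i k) => [leik|ltki]; case: (leqP i n.*2) => [lei2n|lt2ni].
- by rewrite horner_risepoly.
- by rewrite nth_default ?mul0r // (leq_trans sP).
- by rewrite horner_risepoly0 ?mulr0 //; lia.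
- by [].
Qed.

Definition binpoly (m : nat) : {poly C} := (m`!%:R)^-1 *: \prod_(j < m) ('X - (j%:R)%:P).

Lemma size_binpoly m : size (binpoly m) = m.+1.
Proof.
rewrite size_scale ?invr_eq0 ?fact_neq0 // -(big_mkord xpredT (fun j => 'X - (j%:R)%:P)).
rewrite -(big_map (fun j : nat => (j%:R) : C) xpredT (fun a => 'X - a%:P)).
by rewrite size_prod_XsubC size_map size_iota subn0.
Qed.

Lemma coef_binpoly m : (binpoly m)`_m = (m`!%:R)^-1.
Proof.
have := size_binpoly m; rewrite /binpoly size_scale ?invr_eq0 ?fact_neq0 // => sz.
rewrite coefZ; have : \prod_(j < m) ('X - (j%:R)%:P) \is @monic C.
  by apply: monic_prod => j _; apply: monicXsubC.
by move/monicP; rewrite lead_coefE sz /= => ->; rewrite mulr1.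
Qed.

Lemma horner_binpoly m k : (binpoly m).[k%:R] = 'C(k, m)%:R.
Proof.
rewrite hornerZ horner_prod; case: (leqP m k) => [lemk|ltkm].
  have -> : \prod_(j < m) ('X - (j%:R)%:P).[k%:R] = (k ^_ m)%:R :> C.
    rewrite ffact_prod natr_prod; apply: eq_bigr => j _.
    by rewrite hornerXsubC natrB // (leq_trans (ltnW (ltn_ord j))).
  by rewrite -bin_ffact natrM mulrC mulfK ?fact_neq0.
by rewrite (bigD1 (Ordinal ltkm)) //= hornerXsubC subrr mul0r mulr0 bin_small.
Qed.

End RationalCoefficients.

(** * The substitution t = tanh(z/2) *)

Section Asymptotics.
Variable C : numFieldType.
Notation z := (fpsXn C 1).
Notation tau := (tau C).

Lemma cosz4_inv_exists : exists g, (cosz C 1 + 4) * g = 1.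
Proof.
apply: (@fps_inv_exists _ _ (1 / 4)).
by rewrite fps_addE cosz_coef fps_natrE /= add0r mulrA mulr1 mulfV ?pnatr_eq0.
Qed.

(* [sech(z/2)^2 / 4] *)
Definition sech2 : fps C := sval (cid cosz4_inv_exists).

Lemma sech2E : (cosz C 1 + 4) * sech2 = 1.
Proof. by rewrite /sech2; case: cid. Qed.

(* [tanh(z/2)^2] *)
Definition tanh2 : fps C := cosz C 1 * sech2.

Lemma one_sub_tanh2 : 1 - tanh2 = 4 * sech2.
Proof. by apply: (eq_lincomb (c := -1) sech2E); rewrite /tanh2; ring. Qed.

Lemma tanh2_cosz : (1 - tanh2) * cosz C 1 = 4 * tanh2.
Proof. by rewrite one_sub_tanh2 /tanh2; ring. Qed.

Lemma tau_tanh2 : 4 * (tau * tau * tanh2) = z * z.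
Proof.
have h1 := tau_sqr_cosz C; have h2 := sech2E; rewrite /tanh2.
move: tau sech2 (cosz C 1) h1 h2 => t g c h1 h2.
apply: (eq_lincomb (c := g) h1).
by apply: (eq_lincomb (c := z * z) h2); ring.
Qed.

Lemma tanh2_0 : tanh2 0%N = 0.
Proof. by rewrite coef0_mul cosz_coef mul0r. Qed.

(* [4^k Res_z ((coth(z/2) / 2)^(2k+1) g)], as a generating function in [k]; in terms of
   [t = tanh(z/2)] one has [dz = 2 dt / (1 - t^2)], whence [lam1] and [lam_tanh2]. *)
Definition lam (g : fps C) : fps C :=
  Fps (fun k => 4 ^+ k * (tau ^+ k.*2.+1 * g) k.*2).

Lemma lamE g k : lam g k = 4 ^+ k * (tau ^+ k.*2.+1 * g) k.*2. Proof. by []. Qed.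

Lemma lamD g h : lam (g + h) = lam g + lam h.
Proof. by apply: fpsP => k; rewrite fps_addE !lamE mulrDr fps_addE mulrDr. Qed.

Lemma lamC c g : lam (fpsC c * g) = fpsC c * lam g.
Proof. by apply: fpsP => k; rewrite fpsC_mulE !lamE mulrCA fpsC_mulE mulrCA. Qed.

Lemma lam_tanh2 g : lam (tanh2 * g) = fpsXn C 1 * lam g.
Proof.
apply: fpsP => -[|k]; rewrite fpsXn_mulE lamE.
  by rewrite mulrA coef0_mul coef0_mul tanh2_0 mulr0 mul0r mulr0.
rewrite subSS subn0 [lam _ _]lamE.
have -> : 4 ^+ k.+1 * (tau ^+ k.+1.*2.+1 * (tanh2 * g)) k.+1.*2 =
  4 ^+ k * (4 * (tau ^+ k.+1.*2.+1 * (tanh2 * g))) k.+1.*2.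
  by rewrite fps_natr_mulE; move: ((tau ^+ _ * _) _) => x; rewrite exprS; ring.
have -> : 4 * (tau ^+ k.+1.*2.+1 * (tanh2 * g)) = fpsXn C 2 * (tau ^+ k.*2.+1 * g).
  have -> : fpsXn C 2 = z * z by rewrite -fpsXnD.
  rewrite -tau_tanh2 doubleS 2!exprS.
  by move: tau tanh2 (tau ^+ _) => t s u; ring.
by rewrite fpsXn_mulE doubleS !subSS subn0.
Qed.

Lemma lam1 k : lam 1 k = 1.
Proof.
rewrite lamE mulr1; elim: k => [|k IH]; first by rewrite expr0 mul1r coef0_exp tau0 expr1n.
have key : 4 * (tau ^+ k.+1.*2.+1) k.+1.*2 = (tau ^+ k.*2.+1) k.*2.
  (* In degree 2k + 2 Euler's operator multiplies [tau ^+ k.+1.*2] by 2k + 2, which cancels the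
     first term on the right: a derivative has no residue. *)
  have e : 4 * euler (tau ^+ k.+1.*2) = k.+1.*2%:R *
     (4 * tau ^+ k.+1.*2 - 4 * tau ^+ k.+1.*2.+1 + fpsXn C 2 * tau ^+ k.*2.+1).
    have -> : fpsXn C 2 = z * z by rewrite -fpsXnD.
    rewrite doubleS eulerX; have := tau_riccati C; rewrite !exprS.
    move: tau (euler _) (_ ^+ _) => t t1 u h.
    by apply: (eq_lincomb (c := k.*2.+2%:R * (t * u)) h); ring.
  move: (tau ^+ k.+1.*2) (tau ^+ k.+1.*2.+1) (tau ^+ k.*2.+1) e => x y w e.
  have := congr1 (fun f : fps C => f k.+1.*2) e.
  rewrite !fps_natr_mulE eulerE fps_addE fps_subE !fps_natr_mulE fpsXn_mulE.
  have -> : (1 < k.+1.*2)%N = true by rewrite doubleS.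
  rewrite (_ : k.+1.*2 - 2 = k.*2)%N; last by rewrite doubleS !subSS subn0.
  have a0 : (k.+1.*2)%:R != 0 :> C by rewrite pnatr_eq0 double_eq0.
  rewrite mulrCA => /(mulfI a0) h; apply: (eq_lincomb (c := 1) h).
  by move: (x _) (y _) (w _) => x1 y1 w1; ring.
by rewrite exprSr -mulrA key IH.
Qed.

Definition tanh2_eval (P : {poly C}) : fps C := (map_poly (@fpsC C) P).[tanh2].

HB.instance Definition _ := GRing.RMorphism.copy tanh2_eval
  (horner_eval tanh2 \o map_poly (@fpsC C)).

Lemma tanh2_evalX : tanh2_eval 'X = tanh2.
Proof. by rewrite /tanh2_eval map_polyX hornerX. Qed.

Lemma tanh2_evalC c : tanh2_eval c%:P = fpsC c.
Proof. by rewrite /tanh2_eval map_polyC hornerC. Qed.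

Lemma tanh2_evalZ c P : tanh2_eval (c *: P) = fpsC c * tanh2_eval P.
Proof. by rewrite -mul_polyC rmorphM /= tanh2_evalC. Qed.

Lemma fps_of_polyX : fps_of_poly ('X : {poly C}) = fpsXn C 1.
Proof. by apply: fpsP => n; rewrite /= coefX. Qed.

Lemma fps_of_polyC (c : C) : fps_of_poly c%:P = fpsC c.
Proof. by apply: fpsP => n; rewrite /= coefC. Qed.

Lemma lam_eval P g : lam (tanh2_eval P * g) = fps_of_poly P * lam g.
Proof.
elim/poly_ind: P g => [|P c IH] g.
  rewrite (rmorph0 tanh2_eval) (rmorph0 (@fps_of_poly C)) !mul0r.
  by apply: fpsP => k; rewrite lamE mulr0 mulr0.
have -> : tanh2_eval (P * 'X + c%:P) = tanh2_eval P * tanh2 + fpsC c.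
  by rewrite rmorphD rmorphM /= tanh2_evalX tanh2_evalC.
have -> : fps_of_poly (P * 'X + c%:P) = fps_of_poly P * fpsXn C 1 + fpsC c.
  by rewrite rmorphD rmorphM /= fps_of_polyX fps_of_polyC.
by rewrite !mulrDl lamD lamC -mulrA IH lam_tanh2 mulrA.
Qed.

Lemma size_mul_leq (P Q : {poly C}) a b :
  (size P <= a)%N -> (size Q <= b)%N -> (size (P * Q)%R <= (a + b).-1)%N.
Proof.
by move=> sP sQ; rewrite (leq_trans (size_polyMleq _ _)) // -!subn1 leq_sub2r // leq_add.
Qed.

Lemma size_add_leq (P Q : {poly C}) a :
  (size P <= a)%N -> (size Q <= a)%N -> (size (P + Q)%R <= a)%N.
Proof. by move=> sP sQ; rewrite (leq_trans (size_polyD _ _)) // geq_max sP. Qed.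

Lemma size_scale_le (c : C) (P : {poly C}) a : (size P <= a)%N -> (size (c *: P) <= a)%N.
Proof. exact/leq_trans/size_scale_leq. Qed.

(** The degree bound 2n is additive under products, is what [rational_coef] allows, and for n > 0
    leaves room for the numerator of [Nq n], of degree at most n + 1. *)
Definition tanh2_rat (n : nat) (g : fps C) : Prop :=
  exists2 P : {poly C}, (size P <= n.*2.+1)%N & (1 - tanh2) ^+ n * g = tanh2_eval P.

Lemma tanh2_rat0 n : tanh2_rat n 0.
Proof. by exists 0; rewrite ?size_poly0 // mulr0 rmorph0. Qed.

Lemma tanh2_rat1 : tanh2_rat 0 1.
Proof. by exists 1; rewrite ?size_poly1 // mulr1 rmorph1. Qed.

Lemma tanh2_ratB n f g : tanh2_rat n f -> tanh2_rat n g -> tanh2_rat n (f - g).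
Proof.
move=> [P sP hP] [Q sQ hQ]; exists (P - Q); last by rewrite mulrBr hP hQ rmorphB.
by rewrite (leq_trans (size_polyD _ _)) // geq_max sP size_polyN.
Qed.

Lemma tanh2_ratZ n c g : tanh2_rat n g -> tanh2_rat n (fpsC c * g).
Proof.
move=> [P sP hP]; exists (c *: P); first by rewrite (leq_trans (size_scale_leq _ _)).
by rewrite tanh2_evalZ -hP mulrCA.
Qed.

Lemma tanh2_ratM m n f g : tanh2_rat m f -> tanh2_rat n g -> tanh2_rat (m + n) (f * g).
Proof.
move=> [P sP hP] [Q sQ hQ]; exists (P * Q); last by rewrite exprD mulrACA hP hQ rmorphM.
rewrite (leq_trans (size_polyMleq _ _)) // doubleD.
by move: sP sQ; lia.
Qed.

Lemma cosz_rat d : exists2 P : {poly C}, (size P <= d.+1)%N &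
  (1 - tanh2) ^+ d * cosz C d = tanh2_eval P.
Proof.
(* [cosz_rec] reaches back two steps, so consecutive values of d are treated together. *)
suff [] : (exists2 P : {poly C}, (size P <= d.+1)%N & (1 - tanh2) ^+ d * cosz C d = tanh2_eval P)
  /\ (exists2 P : {poly C}, (size P <= d.+2)%N & (1 - tanh2) ^+ d.+1 * cosz C d.+1 = tanh2_eval P) by [].
elim: d => [|d [[P sP hP] [Q sQ hQ]]].
  split; first by exists 0; rewrite ?size_poly0 // cosz0 mulr0 rmorph0.
  exists (4 *: 'X); first by rewrite (leq_trans (size_scale_leq _ _)) // size_polyX.
  by rewrite expr1 tanh2_cosz tanh2_evalZ tanh2_evalX (rmorph_nat (@fpsC C)).
split; first by exists Q.
have s1 k : (size ((1 - 'X) ^+ k : {poly C}) <= k.+1)%N.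
  rewrite (leq_trans (size_poly_exp_leq _ _)) //.
  have -> : size (1 - 'X : {poly C}) = 2.
    by rewrite -size_polyN opprB size_XsubC.
  by rewrite mul1n.
(* [cosz_rec] times (1 - t^2)^(d+2), with (1 - t^2) [cosz 1] replaced by 4 t^2. *)
exists (4 *: 'X * Q + 2 *: ((1 - 'X) * Q) + 8 *: ('X * (1 - 'X) ^+ d.+1) - (1 - 'X) ^+ 2 * P).
  have s11 := s1 1; rewrite expr1 in s11.
  have sX : (size ('X : {poly C}) <= 2)%N by rewrite size_polyX.
  apply: size_add_leq; last first.
    by rewrite size_polyN (leq_trans (size_mul_leq (s1 2) sP)).
  apply: size_add_leq; last first.
    by apply: size_scale_le; rewrite (leq_trans (size_mul_leq sX (s1 d.+1))).
  apply: size_add_leq.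
    by rewrite (leq_trans (size_mul_leq (size_scale_le 4 sX) sQ)).
  by apply: size_scale_le; rewrite (leq_trans (size_mul_leq s11 sQ)).
have e1 : tanh2_eval (1 - 'X) = 1 - tanh2 by rewrite rmorphB rmorph1 /= tanh2_evalX.
have -> : tanh2_eval (4 *: 'X * Q + 2 *: ((1 - 'X) * Q) + 8 *: ('X * (1 - 'X) ^+ d.+1)
    - (1 - 'X) ^+ 2 * P) = 4 * tanh2 * tanh2_eval Q + 2 * ((1 - tanh2) * tanh2_eval Q)
    + 8 * (tanh2 * (1 - tanh2) ^+ d.+1) - (1 - tanh2) ^+ 2 * tanh2_eval P.
  have eD P1 P2 : tanh2_eval (P1 + P2) = tanh2_eval P1 + tanh2_eval P2 by exact: rmorphD.
  have eM P1 P2 : tanh2_eval (P1 * P2) = tanh2_eval P1 * tanh2_eval P2 by exact: rmorphM.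
  have eX P1 k : tanh2_eval (P1 ^+ k) = tanh2_eval P1 ^+ k by exact: rmorphXn.
  have eB P1 P2 : tanh2_eval (P1 - P2) = tanh2_eval P1 - tanh2_eval P2 by exact: rmorphB.
  by rewrite eB !(eD, eM, tanh2_evalZ, eX, e1, tanh2_evalX) !(rmorph_nat (@fpsC C)).
rewrite -hP -hQ cosz_rec !exprS.
have h := tanh2_cosz; move: tanh2 (cosz C d.+1) (cosz C d) (cosz C 1) h => s c1 c0 c h.
move: ((1 - s) ^+ d) => u.
by apply: (eq_lincomb (c := (1 - s) * u * (c1 + 2)) h); ring.
Qed.


(** [lam 1] is 1/(1 - X), so [lam g] is P(X) / (1 - X)^(n+1). *)
Lemma lam_rational n g (P : {poly C}) : (size P <= n.*2.+1)%N ->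
  (1 - tanh2) ^+ n * g = tanh2_eval P -> exists r : {poly C},
  [/\ (size r <= n.+1)%N, r`_n = P.[1] / n`!%:R &
    forall k, (n <= k)%N -> lam g k = r.[k%:R]].
Proof.
move=> sP hP; apply: (rational_coef sP).
have : lam (tanh2_eval ((1 - 'X) ^+ n) * g) = lam (tanh2_eval P * 1).
  rewrite mulr1 -hP; congr (lam (_ * _)).
  by rewrite rmorphXn rmorphB rmorph1 /= tanh2_evalX.
rewrite !lam_eval.
have -> : fps_of_poly ((1 - 'X) ^+ n : {poly C}) = (1 - fpsXn C 1) ^+ n.
  by rewrite rmorphXn rmorphB rmorph1 /= fps_of_polyX.
move=> h; rewrite exprS -mulrA h mulrCA.
have -> : (1 - fpsXn C 1) * lam 1 = 1.
  apply: fpsP => k; rewrite mulrBl mul1r fps_subE fpsXn_mulE fps_1E lam1.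
  by case: k => [|k]; rewrite ?subr0 ?lam1 ?subrr.
by rewrite mulr1.
Qed.

Notation Fq := (swap_fps (Fser C)).
Notation Sq := (swap_fps (Sser C)).

Lemma Fq_coef n : Fq n = swap_fps (wp C) n - fpsC (4 * Gcoef C 2 n) * fpsXn C 2.
Proof.
apply: fpsP => j; rewrite fps_subE fpsC_mulE !swap_fpsE !fps_subE fpsC_mulE.
rewrite ![fpsXn _ _ _]/=; congr (_ - _).
by case: (j == 2%N); rewrite ?(mulr1, mulr0) // fps_natr_mulE.
Qed.

Lemma Fq0 : Fq 0%N = tau * tau.
Proof.
have zz : fpsXn C 2 = z * z by rewrite -fpsXnD.
have [g2 _ _] := Gser_coef0 C.
have h6 : 6 * fpsC (4 * Gcoef C 2 0) = -1 :> fps C.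
  rewrite -(rmorph_nat (@fpsC C)) -rmorphM -(rmorphN1 (@fpsC C)); congr fpsC.
  by rewrite -[Gcoef _ _ _]/(Gser C 2 0%N) g2; field.
apply: (@fps_natI _ 5); rewrite Fq_coef zz.
by apply: (eq_lincomb (c := 1) (wpq0 C)); apply: (eq_lincomb (c := - (z * z)) h6); ring.
Qed.

Definition Nq : fps (fps C) := Fps (fun n => if n == 0%N then 0 else
  4 * (tanh2 * \sum_(d <- divisors n) d%:R * (cosz C d - 4))).

Lemma NqE n : (0 < n)%N -> Nq n = 4 * (tanh2 * \sum_(d <- divisors n) d%:R * (cosz C d - 4)).
Proof. by case: n. Qed.

(** Factoring out tau^2 turns the z^2 of [wpqS] into 4 t^2, by [tau_tanh2]; the -4 in each summand
    of [Nq] is the contribution of -4 G_2. *)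
Lemma FqE : Fq = fpsC (tau * tau) * (1 + Nq).
Proof.
apply: fpsP => n; rewrite fpsC_mulE fps_addE fps_1E.
have [->|n0] := posnP n; first by rewrite Fq0 addr0 mulr1.
rewrite NqE // Fq_coef wpqS // mulr0n add0r.
rewrite -[Gcoef _ _ _]/(Gser C 2 n) Gser_sigma //.
have -> : \sum_(d <- divisors n) d%:R * (cosz C d - 4) =
    \sum_(d <- divisors n) d%:R * cosz C d - fpsC (4 * sigma C 1 n).
  rewrite /sigma mulr_sumr [fpsC _]rmorph_sum -sumrB; apply: eq_bigr => d _.
  by rewrite expr1 rmorphM !rmorph_nat; ring.
have -> : fpsXn C 2 = z * z by rewrite -fpsXnD.
move: (\sum_(d <- _) _) (fpsC _) => a b.
by apply: (eq_lincomb (c := - (a - b)) tau_tanh2); ring.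
Qed.

Lemma SqE : Sq * Sq = Fq.
Proof. by rewrite -SserE; apply/esym/rmorphM. Qed.

Lemma Sq0 : Sq 0%N = tau.
Proof.
apply: fpsP => j; apply/eqP; rewrite -subr_eq0; apply/eqP; move: j.
apply: (@fps_sqrt_unique _ (fun x => x = 0) (1 / 2)) => //.
- by move=> a b -> ->; rewrite subr0.
- by move=> a b ->; rewrite mulr0.
- by rewrite mulrA mulr1 mulfV ?pnatr_eq0.
- by rewrite swap_fpsE Sser0.
- exact: tau0.
by move=> n; rewrite -coef0_mul SqE Fq0 subrr.
Qed.

Lemma Sq_factor : exists y : fps (fps C), [/\ y 0%N = 1, y * y = 1 + Nq & Sq = fpsC tau * y].
Proof.
have [|ti hti] := @fps_inv_exists _ tau 1; first by rewrite tau0 mulr1.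
have htiC : fpsC tau * fpsC ti = 1 :> fps (fps C) by rewrite -rmorphM hti rmorph1.
exists (fpsC ti * Sq); split.
- by rewrite fpsC_mulE Sq0 mulrC.
- have -> : fpsC ti * Sq * (fpsC ti * Sq) = fpsC ti * fpsC ti * (Sq * Sq) by ring.
  have e : fpsC (tau * tau) = fpsC tau * fpsC tau :> fps (fps C) by exact: rmorphM.
  rewrite SqE FqE e.
  move: (fpsC ti) (fpsC tau) htiC => t t' h.
  by apply: (eq_lincomb (c := (t' * t + 1) * (1 + Nq)) h); ring.
by rewrite mulrA htiC mul1r.
Qed.

Lemma graded_Nq : graded tanh2_rat Nq.
Proof.
move=> n; have [->|n0] := posnP n; first exact: tanh2_rat0.
rewrite NqE // mulr_sumr mulr_sumr big_seq.
apply: (graded_sum tanh2_rat0 tanh2_ratB) => d; rewrite -dvdn_divisors // => dn.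
have ledn := dvdn_leq n0 dn; have [P sP hP] := cosz_rat d.
have sX : (size ('X : {poly C}) <= 2)%N by rewrite size_polyX.
have s1 k : (size ((1 - 'X) ^+ k : {poly C}) <= k.+1)%N.
  rewrite (leq_trans (size_poly_exp_leq _ _)) //.
  by rewrite -size_polyN opprB size_XsubC mul1n.
exists ((4 * d%:R) *: ('X * ((1 - 'X) ^+ (n - d) * P - 4 *: (1 - 'X) ^+ n))).
  apply: size_scale_le.
  have sQ : (size ((1 - 'X) ^+ (n - d) * P - 4 *: (1 - 'X) ^+ n)%R <= n.+1)%N.
    apply: size_add_leq.
      by rewrite (leq_trans (size_mul_leq (s1 _) sP)) //; lia.
    by rewrite size_polyN; apply: size_scale_le.
  by rewrite (leq_trans (size_mul_leq sX sQ)) //; lia.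
have eM P1 P2 : tanh2_eval (P1 * P2) = tanh2_eval P1 * tanh2_eval P2 by exact: rmorphM.
have eX P1 k : tanh2_eval (P1 ^+ k) = tanh2_eval P1 ^+ k by exact: rmorphXn.
have eB P1 P2 : tanh2_eval (P1 - P2) = tanh2_eval P1 - tanh2_eval P2 by exact: rmorphB.
have e1 : tanh2_eval (1 - 'X) = 1 - tanh2 by rewrite eB rmorph1 tanh2_evalX.
rewrite tanh2_evalZ eM eB eM tanh2_evalZ !eX e1 tanh2_evalX -hP.
have -> : (1 - tanh2) ^+ n = (1 - tanh2) ^+ (n - d) * (1 - tanh2) ^+ d.
  by rewrite -exprD subnK.
rewrite (rmorphM (@fpsC C)) !(rmorph_nat (@fpsC C)).
by move: ((1 - tanh2) ^+ _) ((1 - tanh2) ^+ _) => u v; ring.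
Qed.

(** In the sum, k occurs only in the binomial coefficient and as the index into [lam] of a series
    independent of k: this is the source of polynomiality. *)
Lemma A_lam : exists y : fps (fps C), [/\ y 0%N = 1, graded tanh2_rat y &
  forall k n, A C k n = (-1) ^+ k / (4 ^+ k * (odd_dfact k)%:R) *
    \sum_(m < n.+1) 'C(k, m)%:R * lam ((Nq ^+ m * y) n) k].
Proof.
have [y [y0 yy Sy]] := Sq_factor; exists y; split=> //.
  apply: (graded_sqrt tanh2_rat0 tanh2_rat1 tanh2_ratB tanh2_ratM (two_half C)) => //.
    by move=> n a; apply: tanh2_ratZ.
  rewrite yy => n; rewrite fps_addE -[X in _ + X]opprK -[- Nq n]sub0r.
  apply: tanh2_ratB; last by apply: tanh2_ratB; [apply: tanh2_rat0 | apply: graded_Nq].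
  by case: n => [|n]; rewrite fps_1E; [apply: tanh2_rat1 | apply: tanh2_rat0].
move=> k n; rewrite A_fps invfM [(4 ^+ k)^-1 * _]mulrC mulrA -!mulrA; do 2!congr (_ * _).
have e4 : 4 ^+ k != 0 :> C by rewrite expf_neq0 // pnatr_eq0.
apply: (mulfI e4); rewrite mulrA mulfV // mul1r.
have -> : (Fser C ^+ k * Sser C) k.*2 n =
    (tau ^+ k.*2.+1 * ((1 + Nq) ^+ k * y) n) k.*2.
  rewrite -[LHS]/(swap_fps (Fser C ^+ k * Sser C) n k.*2); congr (fcoef _ _).
  have -> : swap_fps (Fser C ^+ k * Sser C) = Fq ^+ k * Sq by rewrite rmorphM rmorphXn.
  rewrite FqE Sy exprMn mulrACA.
  have -> : fpsC (tau * tau) ^+ k * fpsC tau = fpsC (tau ^+ k.*2.+1) :> fps (fps C).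
    by rewrite -fpsC_exp -(rmorphM (@fpsC (fps C))) -expr2 -exprM mul2n -exprSr.
  by rewrite fpsC_mulE.
have -> : ((1 + Nq) ^+ k * y) n = \sum_(m < n.+1) 'C(k, m)%:R * (Nq ^+ m * y) n.
  rewrite exprDn mulr_suml fps_sumE.
  under eq_bigr do rewrite expr1n mul1r -mulr_natl -mulrA fps_natr_mulE.
  (* One sum stops at k, the other at n. Between the two bounds the terms vanish: either q^m divides
     [Nq ^+ m] with m > n, or the binomial coefficient is 0. *)
  rewrite (big_ord_widen (maxn k.+1 n.+1)
    (fun m => 'C(k, m)%:R * (Nq ^+ m * y) n)) ?leq_maxl //.
  rewrite [RHS](big_ord_widen (maxn k.+1 n.+1)
    (fun m => 'C(k, m)%:R * (Nq ^+ m * y) n)) ?leq_maxr //.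
  rewrite big_mkcond [RHS]big_mkcond; apply: eq_bigr => m _.
  rewrite !ltnS; case: leqP => lemk; case: leqP => lemn //.
    by rewrite fps_ord_pow ?(ltnW lemn) // (ltn_eqF lemn) mulr0.
  by rewrite bin_small ?mul0r.
rewrite -lamE; apply: (big_ind2 (fun x y => lam x k = y)).
- by rewrite lamE mulr0 mulr0.
- by move=> f x g x' <- <-; rewrite lamD.
by move=> m _; rewrite -(rmorph_nat (@fpsC C)) lamC fpsC_mulE.
Qed.

(** Governs the leading coefficient of p_n: (1 - t^2) N_1 = 4 t^2 (8 t^2 - 4), which equals 16 at
    t^2 = 1. *)
Lemma Nq1_pow n : exists P : {poly C}, [/\ (size P <= n.*2.+1)%N,
  (1 - tanh2) ^+ n * Nq 1%N ^+ n = tanh2_eval P & P.[1] = 16 ^+ n].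
Proof.
have N1 : Nq 1%N = 4 * (tanh2 * (cosz C 1 - 4)).
  by rewrite NqE // (_ : divisors 1 = [:: 1%N]) // big_seq1 mul1r.
exists (((4 *: 'X) * (8 *: 'X - 4%:P)) ^+ n); split.
- have sX : (size ('X : {poly C}) <= 2)%N by rewrite size_polyX.
  have s8 : (size (8 *: 'X - 4%:P : {poly C})%R <= 2)%N.
    apply: size_add_leq; first exact: size_scale_le.
    by rewrite size_polyN (leq_trans (size_polyC_leq1 _)).
  rewrite (leq_trans (size_poly_exp_leq _ _)) // ltnS -muln2 mulnC leq_mul2l.
  have := size_mul_leq (size_scale_le 4 sX) s8.
  by case: (size _) => [|m] /=; lia.
- have eM P1 P2 : tanh2_eval (P1 * P2) = tanh2_eval P1 * tanh2_eval P2 by exact: rmorphM.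
  have eX P1 k : tanh2_eval (P1 ^+ k) = tanh2_eval P1 ^+ k by exact: rmorphXn.
  have eB P1 P2 : tanh2_eval (P1 - P2) = tanh2_eval P1 - tanh2_eval P2 by exact: rmorphB.
  rewrite eX eM eB !tanh2_evalZ tanh2_evalX tanh2_evalC -exprMn N1 !(rmorph_nat (@fpsC C)).
  congr (_ ^+ _).
  by apply: (eq_lincomb (c := 4 * tanh2) tanh2_cosz); ring.
rewrite horner_exp hornerM hornerD hornerN !hornerZ hornerX hornerC; congr (_ ^+ _).
by ring.
Qed.

Lemma A_cond_b : cond_b (A C).
Proof.
have [y [y0 gy AE]] := A_lam => n.
(* For m = n the coefficient of q^n in [Nq ^+ m * y] is N_1^n, so the top coefficient of [r] is
   known. *)
have ex (m : nat) : exists r : {poly C}, [/\ (size r <= n.+1)%N,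
    (m = n -> r`_n = 16 ^+ n / n`!%:R) &
    forall k, (n <= k)%N -> lam ((Nq ^+ m * y) n) k = r.[k%:R]].
  have [->|neq] := eqVneq m n.
    have [P [sP hP P1]] := Nq1_pow n.
    have e : (Nq ^+ n * y) n = Nq 1%N ^+ n by rewrite fps_ord_pow // eqxx y0 mulr1.
    have [r [sr rn hr]] := lam_rational sP hP.
    by exists r; split; rewrite ?rn ?P1 ?e.
  have gN : graded tanh2_rat (Nq ^+ m * y).
    apply: (graded_mul tanh2_rat0 tanh2_ratB tanh2_ratM) => //.
    exact/(graded_exp tanh2_rat0 tanh2_rat1 tanh2_ratB tanh2_ratM)/graded_Nq.
  have [P sP hP] := gN n; have [r [sr _ hr]] := lam_rational sP hP.
  by exists r; split=> // e; rewrite e eqxx in neq.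
have [r hr] := choice ex.
exists (\sum_(m < n.+1) binpoly C m * r m); split; last first.
  move=> k lenk; rewrite AE horner_sum mulrC.
  have -> : (-4) ^+ k * (odd_dfact k)%:R = (-1) ^+ k * (4 ^+ k * (odd_dfact k)%:R) :> C.
    by rewrite mulrA -exprMn mulN1r.
  rewrite [in RHS]invfM invr_sign; congr (_ * _); apply: eq_bigr => m _.
  by have [_ _ h] := hr m; rewrite h // hornerM horner_binpoly.
have sm m : (size (binpoly C m * r m)%R <= m + n.+1)%N.
  have [sr _ _] := hr m.
  have := size_mul_leq (eq_leq (size_binpoly C m)) sr.
  by rewrite addSn.
apply/eqP; rewrite eqn_leq; apply/andP; split.
  apply: (leq_trans (size_sum _ _ _)); apply/bigmax_leqP => m _.
  by rewrite (leq_trans (sm m)) //; have := ltn_ord m; lia.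
(* Summand m has degree at most m + n, so the coefficient in degree 2n comes from m = n alone; it is
   16^n / n!^2. *)
rewrite ltnNge; apply/negP => /leq_sizeP /(_ n.*2 (leqnn _)) /eqP.
rewrite big_ord_recr coefD coef_sum big1 ?add0r => [|m _]; last first.
  by rewrite nth_default // (leq_trans (sm _)) //=; have := ltn_ord m; lia.
have [srn rn _] := hr n.
have lt : (n < n.*2.+1)%N by lia.
rewrite coefM (bigD1 (Ordinal lt)) //= big1 ?addr0 => [|i].
  rewrite coef_binpoly (_ : n.*2 - n = n)%N ?rn //; last by lia.
  by apply/negP; rewrite !mulf_neq0 ?invr_eq0 ?fact_neq0 ?expf_neq0 ?pnatr_eq0.
rewrite -val_eqE /= => ne; have := ltn_ord i => lti.
case: (ltngtP i n) ne => // [ltin|gtin] _.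
  by rewrite [(r n)`_ _]nth_default ?mulr0 // (leq_trans srn) //; lia.
by rewrite nth_default ?mul0r // size_binpoly.
Qed.

End Asymptotics.

(** * Algebraic independence of [E2], [E4], [E6] *)

Section Independence.
Variable C : numFieldType.
Notation E2 := (E2 C).
Notation E4 := (E4 C).
Notation E6 := (E6 C).

Lemma E4_isqrt_exists : exists ee : fps C * fps C,
  [/\ ee.1 0%N = 1, ee.1 * ee.1 = E4 & ee.1 * ee.2 = 1].
Proof.
have [_ e40 _] := Eseries_coef0 C.
have h : 2 * (1 / 2) = 1 :> C by rewrite mulrA mulr1 mulfV ?pnatr_eq0.
have [e [e0 ee]] := fps_sqrt_exists h e40.
have [|ei hei] := @fps_inv_exists _ e 1; first by rewrite e0 mulr1.
by exists (e, ei).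
Qed.

(* [E4^(1/2)] and its inverse *)
Definition rE4 : fps C := (sval (cid E4_isqrt_exists)).1.
Definition iE4 : fps C := (sval (cid E4_isqrt_exists)).2.

Lemma rE4P : [/\ rE4 0%N = 1, rE4 * rE4 = E4 & rE4 * iE4 = 1].
Proof. by rewrite /rE4 /iE4; case: cid. Qed.

Lemma iE4E : iE4 * iE4 * E4 = 1.
Proof.
have [_ <- h] := rE4P; rewrite (_ : _ * _ = (rE4 * iE4) * (rE4 * iE4)); last by ring.
by rewrite h mulr1.
Qed.

(** Quotients of weight 0, in which Ramanujan's three equations close up on two unknowns. *)
Definition Xq : fps C := E2 * iE4.
Definition Yq : fps C := E6 * (iE4 * iE4 * iE4).

Lemma euler_iE4 : 6 * euler iE4 = Yq - Xq.
Proof.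
have h := iE4E; have h' := congr1 (@euler C) h.
have h1 := ramanujan_E4 C.
rewrite (eulerM (iE4 * iE4) E4) (eulerM iE4 iE4) euler1 in h'; rewrite /Xq /Yq.
move: iE4 E2 E4 E6 (euler iE4) (euler E4) h h' h1 => t a b c t' b' h h' h1.
apply: (eq_lincomb (c := 3 * t) h').
apply: (eq_lincomb (c := - (t * t * t)) h1).
by apply: (eq_lincomb (c := - (6 * t') - a * t) h); ring.
Qed.

Lemma euler_Xq : 12 * (iE4 * euler Xq) = - (Xq * Xq - 2 * (Yq * Xq) + 1).
Proof.
have h := iE4E; have h1 := ramanujan_E2 C; have h2 := euler_iE4.
have -> : euler Xq = euler E2 * iE4 + E2 * euler iE4 by exact: eulerM.
rewrite /Xq /Yq in h2 *.
move: iE4 E2 E4 E6 (euler iE4) (euler E2) h h1 h2 => t a b c t' a' h h1 h2.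
apply: (eq_lincomb (c := t * t) h1).
apply: (eq_lincomb (c := 2 * (a * t)) h2).
by apply: (eq_lincomb (c := -1) h); ring.
Qed.

Lemma euler_Yq : 12 * (iE4 * euler Yq) = 6 * (Yq * Yq - 1).
Proof.
have h := iE4E; have h1 := ramanujan_E6 C; have h2 := euler_iE4.
have -> : euler Yq = euler E6 * (iE4 * iE4 * iE4) + 3 * (E6 * (iE4 * iE4 * euler iE4)).
  by rewrite /Yq (eulerM E6) (eulerM (iE4 * iE4)) (eulerM iE4 iE4); ring.
rewrite /Xq /Yq in h2 *.
move: iE4 E2 E4 E6 (euler iE4) (euler E6) h h1 h2 => t a b c t' c' h h1 h2.
apply: (eq_lincomb (c := 6 * (t * t * t * t)) h1).
apply: (eq_lincomb (c := 6 * (c * (t * t * t))) h2).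
by apply: (eq_lincomb (c := - 6 * (1 + t * t * b)) h); ring.
Qed.

Lemma Yq0 : Yq 0%N = 1.
Proof.
have [_ _ e6] := Eseries_coef0 C; have [r0 _ h] := rE4P.
have i0 : iE4 0%N = 1.
  by have := congr1 (fun f : fps C => f 0%N) h; rewrite coef0_mul r0 mul1r fps_1E.
by rewrite (coef0_mul E6) e6 !(coef0_mul, i0) !mulr1.
Qed.

Lemma Yq1 : Yq 1%N = -864.
Proof.
have [_ e40 e60] := Eseries_coef0 C; have [r0 _ h] := rE4P.
have i0 : iE4 0%N = 1.
  by have := congr1 (fun f : fps C => f 0%N) h; rewrite coef0_mul r0 mul1r fps_1E.
have s1 k : sigma C k 1 = 1 by rewrite /sigma (_ : divisors 1 = [:: 1%N]) // big_seq1 expr1n.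
have [_ e41 e61] := Eseries_coef C (ltnSn 0); rewrite !s1 in e41 e61.
have mul1 (f g : fps C) : (f * g) 1%N = f 0%N * g 1%N + f 1%N * g 0%N.
  by rewrite fps_mul_coef // big_geq // addr0.
have i1 : iE4 1%N = -120.
  have f0 : (1 : fps C) 1%N = 0 by [].
  have := congr1 (fun f : fps C => f 1%N) iE4E; rewrite f0 (mul1 _ E4) e40 e41 (mul1 iE4) (coef0_mul iE4) i0 => h1.
  by apply: (@natr_inj0 _ 1); apply: (eq_lincomb (c := 1) h1); ring.
by rewrite (mul1 E6) e60 e61 !mul1 !coef0_mul i0 i1; ring.
Qed.

Definition evalY (p : {poly C}) : fps C := (map_poly (@fpsC C) p).[Yq].

HB.instance Definition _ := GRing.RMorphism.copy evalY
  (horner_eval Yq \o map_poly (@fpsC C)).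

Lemma evalYX : evalY 'X = Yq.
Proof. by rewrite /evalY map_polyX hornerX. Qed.

Lemma evalYC c : evalY c%:P = fpsC c.
Proof. by rewrite /evalY map_polyC hornerC. Qed.

Lemma evalYD p1 p2 : evalY (p1 + p2) = evalY p1 + evalY p2. Proof. exact: rmorphD. Qed.
Lemma evalYM p1 p2 : evalY (p1 * p2) = evalY p1 * evalY p2. Proof. exact: rmorphM. Qed.
Lemma evalYB p1 p2 : evalY (p1 - p2) = evalY p1 - evalY p2. Proof. exact: rmorphB. Qed.
Lemma evalYXn p k : evalY (p ^+ k) = evalY p ^+ k. Proof. exact: rmorphXn. Qed.
Lemma evalY0 : evalY 0 = 0. Proof. exact: rmorph0. Qed.

Lemma evalY_coef0 p : evalY p 0%N = p.[1].
Proof.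
elim/poly_ind: p => [|p c IH]; first by rewrite evalY0 horner0.
by rewrite evalYD evalYM evalYX evalYC fps_addE coef0_mul IH Yq0 hornerMXaddC.
Qed.

Lemma euler_evalY p : euler (evalY p) = evalY p^`() * euler Yq.
Proof.
elim/poly_ind: p => [|p c IH]; first by rewrite deriv0 evalY0 mul0r raddf0.
rewrite evalYD evalYM evalYX evalYC raddfD /= eulerC addr0 eulerM IH.
by rewrite derivMXaddC evalYD evalYM evalYX; ring.
Qed.

(* [Y = 1 - 864 q + ...], so the order in [q] of [p(Y)] is the multiplicity of [1] as a
   root of [p]. *)
Lemma evalY_ord p : p != 0 -> exists m (p' : {poly C}),
  [/\ p = p' * ('X - 1%:P) ^+ m, evalY p m != 0 & forall n, (n < m)%N -> evalY p n = 0].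
Proof.
move=> p0; have [m [p' p'1 pE]] := multiplicity_XsubC p 1.
rewrite p0 /= in p'1.
have eE : evalY p = (Yq - 1) ^+ m * evalY p'.
  rewrite pE mulrC evalYM evalYXn evalYB evalYX evalYC.
  by rewrite (rmorph1 (@fpsC C)).
have y0 : (Yq - 1) 0%N = 0 by rewrite fps_subE Yq0 fps_1E subrr.
exists m, p'; split=> //.
  rewrite eE fps_ord_pow // eqxx fps_subE Yq1 fps_1E evalY_coef0 subr0 mulf_neq0 //.
  by rewrite expf_neq0 // oppr_eq0 pnatr_eq0.
by move=> n ltnm; rewrite eE fps_ord_pow // ?(ltnW ltnm) // (ltn_eqF ltnm).
Qed.

Lemma evalY_eq0 p : evalY p = 0 -> p = 0.
Proof.
move=> h; apply/eqP; case: eqVneq => // /evalY_ord [m [p' [_ /eqP]]].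
by rewrite h.
Qed.

Definition evalXY (F : {poly {poly C}}) : fps C := (map_poly evalY F).[Xq].

HB.instance Definition _ := GRing.RMorphism.copy evalXY
  (horner_eval Xq \o map_poly evalY).

Lemma evalXYX : evalXY 'X = Xq.
Proof. by rewrite /evalXY map_polyX hornerX. Qed.

Lemma evalXYC c : evalXY c%:P = evalY c.
Proof. by rewrite /evalXY map_polyC hornerC. Qed.

Lemma evalXYD F1 F2 : evalXY (F1 + F2) = evalXY F1 + evalXY F2. Proof. exact: rmorphD. Qed.
Lemma evalXYM F1 F2 : evalXY (F1 * F2) = evalXY F1 * evalXY F2. Proof. exact: rmorphM. Qed.
Lemma evalXYB F1 F2 : evalXY (F1 - F2) = evalXY F1 - evalXY F2. Proof. exact: rmorphB. Qed.
Lemma evalXY0 : evalXY 0 = 0. Proof. exact: rmorph0. Qed.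

Definition dY (F : {poly {poly C}}) := map_poly (@deriv C) F.

Lemma coef_dY F j : (dY F)`_j = (F`_j)^`().
Proof. by rewrite /dY coef_map_id0 ?deriv0. Qed.

Lemma euler_evalXY F : euler (evalXY F) = evalXY F^`() * euler Xq + evalXY (dY F) * euler Yq.
Proof.
elim/poly_ind: F => [|F c IH].
  by rewrite deriv0 /dY map_poly0 evalXY0 !mul0r addr0 raddf0.
have -> : dY (F * 'X + c%:P) = dY F * 'X + (c^`())%:P.
  by apply/polyP => j; rewrite coef_dY !coefD !coefMX !coefC coef_dY; case: j => [|j] /=;
    rewrite ?derivD ?deriv0 ?add0r ?addr0.
rewrite evalXYD evalXYM evalXYX evalXYC raddfD /= eulerM IH euler_evalY.
by rewrite derivMXaddC !evalXYD !evalXYM evalXYX !evalXYC; ring.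
Qed.

(* [12 iE4 * euler], read on polynomials in [X] and [Y], plus [r X]: it maps relations of
   degree [r] in [X] to relations of degree at most [r]. *)
Definition ramanujan_op (r : nat) (F : {poly {poly C}}) : {poly {poly C}} :=
  - F^`() * ('X ^+ 2 - (2 * 'X)%:P * 'X + 1) + dY F * (6 * ('X ^+ 2 - 1))%:P
  + r%:R * 'X * F.

Lemma ramanujan_op_relation r F : evalXY F = 0 -> evalXY (ramanujan_op r F) = 0.
Proof.
move=> hF; have := euler_evalXY F; rewrite hF raddf0 => hd.
rewrite /ramanujan_op !evalXYD !evalXYM hF mulr0 addr0.
have evalY1 : evalY 1 = 1 by exact: rmorph1.
have evalY2 : evalY 2 = 2 by exact: rmorph_nat.
have evalY6 : evalY 6 = 6 by exact: rmorph_nat.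
have -> : evalXY (- F^`()) = - evalXY F^`() by exact: rmorphN.
have -> : evalXY ('X ^+ 2 - (2 * 'X)%:P * 'X + 1) = Xq * Xq - 2 * (Yq * Xq) + 1.
  rewrite evalXYD evalXYB (evalXYM _%:P) evalXYX evalXYC evalYM evalY2 evalYX.
  have -> : evalXY ('X ^+ 2) = Xq * Xq by rewrite expr2 evalXYM evalXYX.
  have -> : evalXY 1 = 1 by exact: rmorph1.
  by ring.
have -> : evalXY (6 * ('X ^+ 2 - 1))%:P = 6 * (Yq * Yq - 1).
  by rewrite evalXYC evalYM evalY6 evalYB evalYXn evalYX expr2 evalY1.
have hX := euler_Xq; have hY := euler_Yq.
move: (evalXY _) (evalXY _) (euler Xq) (euler Yq) hd hX hY => b a x y hd hX hY.
apply: (eq_lincomb (c := 12 * iE4) (esym hd)).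
apply: (eq_lincomb (c := - a) hX).
by apply: (eq_lincomb (c := - b) hY); ring.
Qed.

(** The factor [r - j + 1] vanishes for j = r + 1; this is why adding r X keeps the degree in X at
    most r. *)
Lemma coef_ramanujan_op r F j : (ramanujan_op r F)`_j =
  (r%:R - j%:R + 1) * (if j is j'.+1 then F`_j' else 0) + 2 * j%:R * ('X * F`_j)
  - j.+1%:R * F`_j.+1 + 6 * (('X ^+ 2 - 1) * (F`_j)^`()).
Proof.
have -> : ramanujan_op r F = - (F^`() * 'X * 'X) + F^`() * 'X * (2 * 'X)%:P - F^`()
   + dY F * (6 * ('X ^+ 2 - 1))%:P + (F * 'X) * (r%:R)%:P.
  by rewrite /ramanujan_op (rmorph_nat (@polyC _)) expr2; ring.
rewrite !coefD !coefN !coefMC coef_dY.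
have c0 (p : {poly {poly C}}) : (p * 'X)`_0 = 0 by rewrite coefMX.
have cS (p : {poly {poly C}}) i : (p * 'X)`_i.+1 = p`_i by rewrite coefMX.
have cd i : F^`()`_i = i.+1%:R * F`_i.+1 by rewrite coef_deriv mulr_natl.
case: j => [|[|j]]; rewrite !(c0, cS, cd); first by ring.
  by ring.
by rewrite -(natr1 j.+2) -(natr1 j.+1); ring.
Qed.

Lemma coef_natM k (p : {poly C}) i : (k%:R * p)`_i = k%:R * p`_i.
Proof. by rewrite !mulr_natl coefMn. Qed.

(** With X of weight 1 and Y of weight 3, only 2XY d/dX and 6Y^2 d/dY raise the weight by 3.
    Together they are 2Y times the operator that multiplies a monomial by its weight. *)
Lemma ramanujan_op_top (r : nat) (F : {poly {poly C}}) (j m e : nat) :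
  (forall i k, F`_i`_k != 0 -> (i + 3 * k <= j + 3 * m)%N) -> (0 < e)%N ->
  (ramanujan_op r F)`_j`_(m + e) = if e == 1%N then (2 * (j + 3 * m))%:R * F`_j`_m else 0.
Proof.
move=> top e0.
have hz i k : (j + 3 * m < i + 3 * k)%N -> F`_i`_k = 0.
  by move=> lt; apply/eqP; apply: contraTT lt => /top; rewrite -leqNgt.
pose prev : {poly C} := if j is j'.+1 then F`_j' else 0.
have hprev : prev`_(m + e) = 0.
  by rewrite /prev; case: (j) hz => [|i] hz; rewrite ?coef0 // hz //; lia.
rewrite coef_ramanujan_op -/prev.
rewrite !coefD coefN mulrDl mulrBl mul1r !coefD coefN !coef_natM hprev {prev hprev}.
rewrite [F`_j.+1`_ _]hz; last by lia.
rewrite -mulrA !coef_natM mulrBl mul1r coefB coef_deriv.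
rewrite [F`_j`_(m + e).+1]hz; last by lia.
rewrite mul0rn subr0 coefXM expr2 -mulrA !coefXM coef_deriv.
have -> : (m + e == 0)%N = false by lia.
case: e e0 => [|[|e]] // _; rewrite addnS /=.
  rewrite addn0; case: m top hz => [|m] top hz.
    rewrite /= muln0 addn0 natrM; ring.
  rewrite /= -mulr_natl natrM natrD natrM; ring.
rewrite addnS /= [F`_j`_(m + e).+1]hz; last by lia.
by rewrite mul0rn; ring.
Qed.

(** If p = (X - a)^m q with q(a) nonzero, the left side vanishes at a to order at least m + 1, so
    the linear factor on the right has the root a. *)
Lemma riccati_root (r : nat) (a k : C) (p : {poly C}) : p != 0 ->
  ('X - a%:P) ^+ 2 * p^`() = (r%:R * 'X - k%:P) * p -> k = r%:R * a.
Proof.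
move=> p0; have [m [q qa ->]] := multiplicity_XsubC p a; rewrite p0 /= in qa.
have Xa0 : ('X - a%:P) ^+ m != 0 by rewrite expf_neq0 // polyXsubC_eq0.
have -> : ('X - a%:P) ^+ 2 * (q * ('X - a%:P) ^+ m)^`() =
    ('X - a%:P) ^+ m * (('X - a%:P) * (('X - a%:P) * q^`() + m%:R * q)).
  case: m {Xa0} => [|m]; first by rewrite expr0 !mulr1; ring.
  by rewrite derivM deriv_exp derivXsubC /= -mulr_natl !exprS; ring.
have -> : (r%:R * 'X - k%:P) * (q * ('X - a%:P) ^+ m) =
    ('X - a%:P) ^+ m * ((r%:R * 'X - k%:P) * q) by ring.
move=> /(mulfI Xa0) /(congr1 (fun p => p.[a])).
rewrite !hornerM hornerXsubC subrr !mul0r => /esym /eqP.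
rewrite mulf_eq0 -/(root q a) (negbTE qa) orbF hornerD hornerN hornerM hornerX hornerC.
by rewrite -(rmorph_nat (@polyC C)) hornerC subr_eq0 => /eqP.
Qed.

(** At Y = a the term with [dY] disappears, and X^2 - 2aX + 1 becomes (X - a)^2. *)
Lemma ramanujan_op_eval r F (c : {poly C}) (a : C) : a * a = 1 ->
  map_poly (horner_eval a) F != 0 -> ramanujan_op r F = c%:P * F -> c.[a] = r%:R * a.
Proof.
move=> aa; set p := map_poly _ F => p0 hF; apply: (riccati_root p0).
have := congr1 (map_poly (horner_eval a)) hF; rewrite /ramanujan_op.
rewrite !(rmorphD, rmorphN, rmorphM) /= !map_polyC /= !map_polyX -deriv_map rmorph_nat -/p.
have h1 : (1 : {poly C}).[a] = 1 by rewrite hornerC.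
have ha : a%:P * a%:P = 1 :> {poly C} by rewrite -polyCM aa.
rewrite /horner_eval !h1 !hornerX polyC1; move: (map_poly _ (dY F)) => d h.
apply: (eq_lincomb (c := -1) h).
by apply: (eq_lincomb (c := p^`() + 6 * d) ha); ring.
Qed.

Lemma top_monomial (F : {poly {poly C}}) : F != 0 -> exists j m : nat,
  F`_j`_m != 0 /\ forall i k : nat, F`_i`_k != 0 -> (i + 3 * k <= j + 3 * m)%N.
Proof.
move=> F0; pose P w := `[< exists j m : nat, F`_j`_m != 0 /\ (j + 3 * m)%N = w >].
pose K := (\max_(i < size F) size (F`_i)%R)%N.
have exP : exists w, P w.
  have l0 : lead_coef F != 0 by rewrite lead_coef_eq0.
  exists ((size F).-1 + 3 * (size (lead_coef F)).-1)%N; apply/asboolP.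
  exists (size F).-1, (size (lead_coef F)).-1; split=> //.
  by rewrite -lead_coefE -lead_coefE lead_coef_eq0.
have ubP w : P w -> (w <= size F + 3 * K)%N.
  move=> /asboolP [j [m [jm <-]]].
  have ltj : (j < size F)%N.
    by rewrite ltnNge; apply: contra jm => lej; rewrite (nth_default _ lej) coef0.
  have ltm : (m < size (F`_j)%R)%N.
    by rewrite ltnNge; apply: contra jm => lej; rewrite nth_default.
  have leK : (size (F`_j)%R <= K)%N by apply: (leq_bigmax (Ordinal ltj)).
  by rewrite leq_add ?(ltnW ltj) // leq_mul2l (leq_trans (ltnW ltm) leK).
case: (ex_maxnP exP ubP) => w /asboolP [j [m [jm <-]]] maxw.
by exists j, m; split=> // i k ik; apply: maxw; apply/asboolP; exists i, k.
Qed.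

(** Multiplying a monomial of top weight by c(Y) may gain only one power of Y, by
    [ramanujan_op_top]; so c is at most linear, with the slope found there. *)
Lemma ramanujan_op_eigen r (F : {poly {poly C}}) (c : {poly C}) (j m : nat) :
  F`_j`_m != 0 -> (forall i k, F`_i`_k != 0 -> (i + 3 * k <= j + 3 * m)%N) ->
  ramanujan_op r F = c%:P * F -> c = (c`_0)%:P + (2 * (j + 3 * m))%:R *: 'X.
Proof.
move=> jm top hF.
have hz k : (m < k)%N -> F`_j`_k = 0.
  by move=> lt; apply/eqP; apply: contraTT lt => /top; rewrite -leqNgt; lia.
have hc e : (forall i, (e < i)%N -> c`_i = 0) -> (0 < e)%N ->
    c`_e = if e == 1%N then (2 * (j + 3 * m))%:R else 0.
  move=> ce e0; apply: (mulIf jm).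
  have := ramanujan_op_top r top e0; rewrite hF coefCM coefM addnC.
  have lt : (e < (e + m).+1)%N by lia.
  rewrite (bigD1 (Ordinal lt)) //= addKn big1 ?addr0 => [->|i].
    by case: ifP; rewrite ?mul0r.
  rewrite -val_eqE /= => ne; case: (ltngtP i e) ne => // [ltie|gtie] _.
    by rewrite hz ?mulr0 //; lia.
  by rewrite ce ?mul0r.
have big e : (1 < e)%N -> c`_e = 0.
  case: (leqP (size c) e) => [|lt e1]; first by move=> le _; rewrite nth_default.
  have [s1|s1] := leqP (size c) 2; first by move: lt e1 s1; lia.
  have [k sk] : exists k, size c = k.+3 by exists (size c - 3)%N; lia.
  have above i : (k.+2 < i)%N -> c`_i = 0 by move=> lti; rewrite nth_default // sk.
  have := hc k.+2 above isT => /= /eqP.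
  have -> : c`_k.+2 = lead_coef c by rewrite lead_coefE sk.
  by rewrite lead_coef_eq0 => /eqP c0; move: sk; rewrite c0 size_poly0.
apply/polyP => i; rewrite coefD coefC coefZ coefX.
case: i => [|[|i]] /=; first by rewrite mulr0 addr0.
  by rewrite (hc 1%N) // mulr1 add0r.
by rewrite big // mulr0 addr0.
Qed.

(** Induction on the degree in X, then on the degree in Y of the leading coefficient. The inner
    induction makes F primitive, so that its image under the operator is a polynomial multiple c(Y)
    F. *)
Lemma evalXY_eq0 F : evalXY F = 0 -> F = 0.
Proof.
move: F; suff main n (F : {poly {poly C}}) : (size F <= n)%N -> evalXY F = 0 -> F = 0 by move=> F; apply: (main (size F)).
elim: n F => [|r IHr] F; first by rewrite leqn0 size_poly_eq0 => /eqP ->.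
rewrite leq_eqVlt => /predU1P[sF|]; last by rewrite ltnS; apply: IHr.
move=> hF; exfalso; have [l] := ubnP (size (lead_coef F)).
elim: l F sF hF => // l IHl F sF hF; rewrite ltnS => sl.
have F0 : F != 0 by rewrite -size_poly_eq0 sF.
have f0 : lead_coef F != 0 by rewrite lead_coef_eq0.
(* A common factor d(Y) can be divided out because its q-series is nonzero; this lowers the degree
   of the leading coefficient. *)
have descend (d : {poly C}) : (1 < size d)%N -> (forall j, d %| F`_j) -> False.
  move=> sd dF; have d0 : d != 0 by rewrite -size_poly_gt0 ltnW.
  pose F' := map_poly (fun p => p %/ d) F.
  have FE : F = d%:P * F'.
    apply/polyP => j; rewrite coefCM coef_map_id0 ?div0p // mulrC divpK //.
  have sF' : size F' = r.+1 by rewrite -sF FE mul_polyC size_scale.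
  apply: (IHl F' sF').
    have := hF; rewrite FE evalXYM evalXYC => /fps_mul_eq0; apply.
    by move/evalY_eq0/eqP; rewrite (negbTE d0).
  apply: leq_trans sl; rewrite FE lead_coefM lead_coefC.
  have l0 : lead_coef F' != 0 by rewrite lead_coef_eq0 -size_poly_eq0 sF'.
  by rewrite size_mul //; move: sd; case: (size d) => [|[|s]] // _; rewrite !addSn /= ltnS leq_addl.
set f := lead_coef F in sl f0; pose G := ramanujan_op r F; pose g := G`_r.
have fE : f = F`_r by rewrite /f lead_coefE sF.
have Fbig j : (r < j)%N -> F`_j = 0 by move=> lt; rewrite nth_default // sF.
have dz (p : {poly C}) : p = 0 -> p^`() = 0 by move=> ->; apply: deriv0.
have Gbig j : (r < j)%N -> G`_j = 0.
  case: j => // j; rewrite ltnS leq_eqVlt => /predU1P[<-|lt].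
    rewrite /G coef_ramanujan_op (dz _ (Fbig _ (ltnSn r))).
    rewrite (Fbig _ (ltnSn r)) (Fbig _ (leqW (ltnSn r))).
    by rewrite -natr1; ring.
  rewrite /G coef_ramanujan_op (dz _ (Fbig _ (leqW lt))).
  rewrite (Fbig _ lt) (Fbig _ (leqW lt)) (Fbig _ (leqW (leqW lt))).
  by ring.
(* The terms in X^r cancel in the difference, which is thus a relation of smaller degree. *)
have fG : f%:P * G = g%:P * F.
  apply/eqP; rewrite -subr_eq0; apply/eqP/IHr.
    apply/leq_sizeP => j; rewrite leq_eqVlt coefB !coefCM => /predU1P[<-|lt].
      by rewrite -fE -/g mulrC subrr.
    by rewrite Gbig // Fbig // !mulr0 subrr.
  by rewrite evalXYB !evalXYM hF (ramanujan_op_relation r hF) !mulr0 subrr.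
(* By Gauss's lemma, f / gcd(f, g) divides every coefficient of F, so by [descend] it is
   constant. *)
pose h := gcdp f g; pose f1 := f %/ h.
have h0 : h != 0 by rewrite gcdp_eq0 (negbTE f0).
have cop : coprimep f1 (g %/ h) by rewrite coprimep_div_gcd // f0.
have ef : f1 * h = f by rewrite divpK ?dvdp_gcdl.
have eg : g %/ h * h = g by rewrite divpK ?dvdp_gcdr.
have ej j : f1 * G`_j = g %/ h * F`_j.
  have := congr1 (fun P : {poly {poly C}} => P`_j) fG; rewrite !coefCM => e.
  apply: (mulfI h0); apply: (eq_lincomb (c := 1) e).
  by rewrite -[in X in _ = X]ef -[in X in _ = X]eg; ring.
have dvd j : f1 %| F`_j by rewrite -(Gauss_dvdpr _ cop) -ej dvdp_mulr.
have f10 : f1 != 0 by apply: contra f0 => /eqP e; rewrite -ef e mul0r.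
have sf1 : size f1 == 1%N.
  rewrite eqn_leq size_poly_gt0 f10 andbT leqNgt.
  by apply/negP => /descend; apply.
have [a a0 f1E] := size_poly1P _ sf1.
pose c := a^-1 *: (g %/ h).
have GE : G = c%:P * F.
  apply/polyP => j; rewrite coefCM -scalerAl -ej f1E mul_polyC scalerA mulVf // scale1r.
  by [].
have [r0|r0] := posnP r.
  have FC : F = f%:P by rewrite fE r0; apply: size1_polyC; rewrite sF r0.
  by move: hF; rewrite FC evalXYC => /evalY_eq0 e; rewrite e eqxx in f0.
have ev b : b * b = 1 -> c.[b] = r%:R * b.
  move=> bb; apply: (ramanujan_op_eval bb) GE; apply/negP => /eqP e0.
  apply: (descend ('X - b%:P)); first by rewrite size_XsubC.
  move=> j; rewrite dvdp_XsubCl; apply/eqP.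
  have := congr1 (fun p : {poly C} => p`_j) e0.
  by rewrite coef_map_id0 ?coef0 // /horner_eval horner0.
have [j [m [jm top]]] := top_monomial F0.
have cE := ramanujan_op_eigen jm top GE.
have leW : (r <= j + 3 * m)%N.
  apply: leq_trans (top r (size f).-1 _); first exact: leq_addr.
  by rewrite -fE -lead_coefE lead_coef_eq0.
have h1 := ev 1 (mulr1 1).
have h2 : c.[-1] = r%:R * -1 by apply: ev; rewrite mulrNN mulr1.
rewrite cE hornerD hornerC hornerZ hornerX in h1.
rewrite cE hornerD hornerC hornerZ hornerX in h2.
(* Half the difference of c(1) = r and c(-1) = -r is the slope; so twice the top weight is r,
   against [leW] and r > 0. *)
have /eqP : (2 * (j + 3 * m))%:R = r%:R :> C.
  apply: (@natr_inj0 _ 1); apply: (eq_lincomb (c := 1) h1).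
  by apply: (eq_lincomb (c := -1) h2); ring.
by rewrite eqr_nat => /eqP; move: r0 leW; lia.
Qed.

End Independence.

(** * Uniqueness *)

Section Dehomogenization.
Variable C : numFieldType.
Notation M := {mpoly C[3]}.
Implicit Types (P Q : M).

(* Sets [E4 = 1]; the two remaining variables stand for [E2 / E4^(1/2)] (outer) and
   [E6 / E4^(3/2)] (inner). *)
Definition dehom_var (i : 'I_3) : {poly {poly C}} :=
  match val i with
  | 0 => (- (1 / 24))%:P%:P * 'X
  | 1 => (1 / 240)%:P%:P
  | _ => (- (1 / 504) *: 'X)%:P
  end.

Definition polyCC : C -> {poly {poly C}} := @polyC {poly C} \o @polyC C.

HB.instance Definition _ := GRing.RMorphism.copy polyCC (@polyC {poly C} \o @polyC C).

Definition dehom P : {poly {poly C}} := mmap polyCC dehom_var P.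

Lemma evalXY_dehom_var i : evalXY (dehom_var i) = Gval C i * iE4 C ^+ i.+1.
Proof.
have cancelC (a b : C) : a * b = 1 -> fpsC a * fpsC b = 1 :> fps C.
  by move=> ab; rewrite -(rmorphM (@fpsC C)) ab rmorph1.
case: i => [[|[|[|i]]] //= lti]; rewrite /dehom_var /Gval /=.
- rewrite evalXYM evalXYX evalXYC evalYC expr1 /Xq /E2.
  rewrite (_ : - (1 / 24) = (-24)^-1); last by field.
  have h : fpsC (-24)^-1 * fpsC (-24) = 1 :> fps C.
    by apply: cancelC; rewrite mulVf // oppr_eq0 pnatr_eq0.
  by apply: (eq_lincomb (c := Gser C 2 * iE4 C) h); ring.
- rewrite evalXYC evalYC expr2; have := iE4E C; rewrite /E4.
  rewrite (_ : 1 / 240 = 240^-1); last by field.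
  have h : fpsC 240^-1 * fpsC 240 = 1 :> fps C.
    by apply: cancelC; rewrite mulVf // pnatr_eq0.
  move=> h2; apply: (eq_lincomb (c := - fpsC 240^-1) h2).
  by apply: (eq_lincomb (c := iE4 C * iE4 C * Gser C 4) h); ring.
rewrite evalXYC -mul_polyC evalYM evalYC evalYX /Yq /E6 !exprS expr0.
rewrite (_ : - (1 / 504) = (-504)^-1); last by field.
have h : fpsC (-504)^-1 * fpsC (-504) = 1 :> fps C.
  by apply: cancelC; rewrite mulVf // oppr_eq0 pnatr_eq0.
by apply: (eq_lincomb (c := Gser C 6 * (iE4 C * iE4 C * iE4 C)) h); ring.
Qed.

Lemma homog_half k P m : qmod_homog k.*2 P -> m \in msupp P ->
  (m ord0 + 2 * m (inord 1) + 3 * m (inord 2) = k)%N.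
Proof.
move=> hP /hP; rewrite !big_ord_recl big_ord0 /=.
rewrite (_ : lift ord0 ord0 = inord 1); last by apply: val_inj; rewrite /= inordK.
rewrite (_ : lift ord0 (lift ord0 ord0) = inord 2); last by apply: val_inj; rewrite /= inordK.
by rewrite /bump /=; lia.
Qed.

(** In weight 2k, setting E_4 = 1 amounts to division by E_4^(k/2). *)
Lemma evalXY_dehom k P : qmod_homog k.*2 P -> evalXY (dehom P) = qser P * iE4 C ^+ k.
Proof.
move=> hP; rewrite /dehom /qser /mmap mulr_suml.
have sumE : evalXY (\sum_(m <- msupp P) polyCC P@_m * mmap1 dehom_var m) =
  \sum_(m <- msupp P) evalXY (polyCC P@_m * mmap1 dehom_var m) by exact: rmorph_sum.
rewrite sumE big_seq [RHS]big_seq; apply: eq_bigr => m mP.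
rewrite evalXYM evalXYC evalYC -mulrA; congr (_ * _).
have prodE : evalXY (mmap1 dehom_var m) = \prod_(i < 3) evalXY (dehom_var i) ^+ m i.
  transitivity (\prod_(i < 3) evalXY (dehom_var i ^+ m i)); first exact: rmorph_prod.
  by apply: eq_bigr => i _; apply: rmorphXn.
have -> : k = (\sum_(i < 3) i.+1 * m i)%N.
  apply: double_inj; rewrite -(hP _ mP) -mul2n big_distrr /=.
  by apply: eq_bigr => i _; rewrite mulnA.
rewrite prodE /mmap1 expr_sum -big_split /=; apply: eq_bigr => i _.
by rewrite evalXY_dehom_var exprMn -exprM.
Qed.

Definition dehom_cst (m : 'X_{1..3}) : C :=
  (- (1 / 24)) ^+ m ord0 * (1 / 240) ^+ m (inord 1) * (- (1 / 504)) ^+ m (inord 2).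

Lemma dehom_cst_neq0 m : dehom_cst m != 0.
Proof.
by rewrite !mulf_neq0 ?expf_neq0 ?oppr_eq0 ?mulf_neq0 ?invr_eq0 ?oner_eq0 ?pnatr_eq0.
Qed.

Lemma coef_dehom P i j : (dehom P)`_i`_j =
  \sum_(m <- msupp P | (m ord0 == i) && (m (inord 2) == j)) P@_m * dehom_cst m.
Proof.
rewrite /dehom /mmap !coef_sum [RHS]big_mkcond; apply: eq_bigr => m _.
have -> : polyCC P@_m * mmap1 dehom_var m =
    ((P@_m * dehom_cst m) *: 'X^(m (inord 2)))%:P * 'X^(m ord0).
  rewrite /mmap1 !big_ord_recl big_ord0.
  rewrite (_ : lift ord0 ord0 = inord 1); last by apply: val_inj; rewrite /= inordK.
  rewrite (_ : lift ord0 (lift ord0 ord0) = inord 2); last by apply: val_inj; rewrite /= inordK.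
  have -> : dehom_var (inord 1) = (1 / 240)%:P%:P by rewrite /dehom_var /= inordK.
  have -> : dehom_var (inord 2) = (- (1 / 504) *: 'X)%:P by rewrite /dehom_var /= inordK.
  rewrite /dehom_var /dehom_cst /polyCC /=.
  move: (- (1 / 24)) (1 / 240) (- (1 / 504)) => a b c.
  by rewrite -!mul_polyC !polyCM !polyC_exp !exprMn; ring.
rewrite coefMXn coefC; case: (ltngtP i (m ord0)) => [lt|gt|->] /=.
- by rewrite coef0.
- by rewrite subn_eq0 leqNgt gt coef0.
rewrite subnn eqxx coefZ coefXn [j == _]eq_sym.
by case: eqP; rewrite ?mulr1 ?mulr0.
Qed.

(** The weight determines the exponent of G_4 from the other two, so no two monomials of P merge. *)
Lemma dehom_eq0 k P : qmod_homog k.*2 P -> dehom P = 0 -> P = 0.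
Proof.
move=> hP d0; apply/eqP; rewrite -msupp_eq0.
case e : (msupp P) => [//|m s]; exfalso.
have mP : m \in msupp P by rewrite e inE eqxx.
have := coef_dehom P (m ord0) (m (inord 2)); rewrite d0 !coef0 -big_filter.
have -> : [seq m' : 'X_{1..3} <- msupp P | (m' ord0 == m ord0) && (m' (inord 2) == m (inord 2))] =
    [seq m' : 'X_{1..3} <- msupp P | m' == m].
  apply: eq_in_filter => m' m'P; apply/andP/eqP => [[/eqP e0 /eqP e2]|->]; last by [].
  have h1 := homog_half hP mP; have h2 := homog_half hP m'P.
  apply/mnmP => -[[|[|[|i]]] // lti].
  - by move: e0; congr (_ = _); congr (_ _); apply: val_inj.
  - have -> : Ordinal lti = inord 1 by apply: val_inj; rewrite /= inordK.
    by lia.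
  - by have -> : Ordinal lti = inord 2 by apply: val_inj; rewrite /= inordK.
rewrite filter_pred1_uniq ?msupp_uniq // big_seq1 => /esym/eqP.
by rewrite mulf_eq0 (negbTE (dehom_cst_neq0 m)) orbF mcoeff_eq0 mP.
Qed.

Lemma homog_qser_eq0 k P : qmod_homog k.*2 P -> qser P = 0 -> P = 0.
Proof.
move=> hP q0; apply: (dehom_eq0 hP); apply: evalXY_eq0.
by rewrite (evalXY_dehom hP) q0 mul0r.
Qed.

Lemma mderiv0_msupp P m : P^`M(ord0) = 0 -> m \in msupp P -> m ord0 = 0%N.
Proof.
move=> dP mP; apply/eqP; apply: contraTT mP; rewrite -lt0n => m0.
have em : m = (m - U_(ord0) + U_(ord0))%MM.
  apply/mnmP => i; rewrite mnmDE mnmBE mnm1E; case: eqP => [<-|_]; last by rewrite subn0 addn0.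
  by rewrite subnK.
have := mcoeff_mderiv ord0 P (m - U_(ord0))%MM; rewrite dP mcoeff0 -em.
by move=> /esym/eqP; rewrite mulrn_eq0 /= -mcoeff_eq0.
Qed.

(** Exponents b of G_4 and c of G_6 satisfy 2b + 3c = k, which bounds the degree of p by k/3 and
    fixes its parity. The clause [n == 0] adds something for k = 0 only, where it excludes nonzero
    constants. *)
Lemma modular_valence k P : qmod_homog k.*2 P -> P^`M(ord0) = 0 ->
  (forall n, (n == 0%N) || (3 * n < k)%N -> qser P n = 0) -> P = 0.
Proof.
move=> hP dP q0; apply: (dehom_eq0 hP).
pose p := (dehom P)`_0.
have dE : dehom P = p%:P.
  apply/polyP => -[|i]; rewrite coefC //=; apply/polyP => j; rewrite coef0 coef_dehom.
  rewrite big_seq_cond big1 // => m /andP[mP /andP[/eqP]].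
  by rewrite (mderiv0_msupp dP mP).
have supp j : p`_j != 0 -> (3 * j <= k)%N /\ odd j = odd k.
  move=> pj.
  suff [m mP mj] : exists2 m, m \in msupp P & m (inord 2) = j.
    have := homog_half hP mP; rewrite (mderiv0_msupp dP mP) mj add0n => <-.
    by split; [lia | rewrite oddD !oddM /=].
  apply: contrapT => nex; move/eqP: pj; apply; rewrite /p coef_dehom.
  rewrite big_seq_cond big1 // => m /andP[mP /andP[_ /eqP mj]].
  by case: nex; exists m.
rewrite dE; apply/eqP; rewrite polyC_eq0; apply: contraT => p0; exfalso.
have ep n : (n == 0%N) || (3 * n < k)%N -> evalY p n = 0.
  move=> hn; rewrite -evalXYC -dE (evalXY_dehom hP) fps_mulE big1 // => i _.
  by rewrite q0 ?mul0r //; have := ltn_ord i; move: hn; case: eqP; lia.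
have [m [p' [pE em _]]] := evalY_ord p0.
have {em ep} hm : (0 < m)%N && (k <= 3 * m)%N.
  apply: contraR em; rewrite negb_and -leqNgt leqn0 -ltnNge => hm.
  by rewrite ep.
have p'0 : p' != 0 by apply: contra p0 => /eqP e; rewrite pE e mul0r.
have sp : size p = (size p' + m)%N.
  rewrite pE size_mul ?expf_neq0 ?polyXsubC_eq0 // size_exp_XsubC addnS /=.
  by [].
have [le3 _] : (3 * (size p).-1 <= k)%N /\ odd (size p).-1 = odd k.
  by apply: supp; rewrite -lead_coefE lead_coef_eq0.
(* The degree of p is at most k/3, hence at most m: p is a constant times (Y - 1)^m, and parity
   carries its root 1 to -1. *)
have sp' : size p' == 1%N.
  by move: p'0; rewrite -size_poly_gt0; move: le3 hm; rewrite sp; lia.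
have [a a0 p'E] := size_poly1P _ sp'.
have par : p.[-1] = (-1) ^+ k * p.[1].
  rewrite !horner_coef mulr_sumr; apply: eq_bigr => i _.
  have [->|/supp [_ e]] := eqVneq p`_i 0; first by rewrite !mul0r mulr0.
  by rewrite expr1n mulr1 mulrC -[in LHS]signr_odd e signr_odd.
have p1 : p.[1] = 0.
  rewrite pE hornerM horner_exp hornerXsubC subrr expr0n.
  by case/andP: hm; case: m {pE sp} => // m _ _; rewrite mulr0.
move: par; rewrite p1 mulr0 pE p'E hornerM hornerC horner_exp hornerXsubC => /eqP.
rewrite mulf_eq0 (negbTE a0) expf_eq0 -opprD oppr_eq0 -[1 + 1]/(2%:R) pnatr_eq0.
by rewrite andbF.
Qed.

End Dehomogenization.

(** * Comparison of two solutions *)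

Section Uniqueness.
Variable C : numFieldType.

Lemma A_cond_c : cond_c (A C).
Proof.
by rewrite /cond_c A_fps !expr0 (_ : (odd_dfact 0)%:R = 1) // divr1 !mul1r double0 Sser0.
Qed.

Lemma homog_mderiv k (P : {mpoly C[3]}) :
  qmod_homog k.*2 P -> qmod_homog k.-1.*2 P^`M(ord0).
Proof.
move=> hP m; rewrite mcoeff_msupp mcoeff_mderiv => h.
have mP : (m + U_(ord0))%MM \in msupp P.
  by rewrite mcoeff_msupp; apply: contra h => /eqP ->; rewrite mul0rn.
have := hP _ mP; rewrite -/(mweight _) mweightD -/(mweight m).
have -> : mweight U_(ord0) = 2.
  rewrite /mweight (bigD1 ord0) //= big1 => [|i i0]; first by rewrite mnm1E eqxx.
  by rewrite mnm1E eq_sym (negbTE i0) muln0.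
by case: k {hP} => [|k]; rewrite ?doubleS /=; lia.
Qed.

(** Two polynomials of degree 2n that agree at the 2n + 1 points n, ..., 3n, all below k, are
    equal. *)
Lemma cond_b_next (B1 B2 : nat -> nat -> C) n k : cond_b B1 -> cond_b B2 ->
  (3 * n < k)%N -> (forall j, (j < k)%N -> B1 j n = B2 j n) -> B1 k n = B2 k n.
Proof.
move=> /(_ n) [p1 [s1 h1]] /(_ n) [p2 [s2 h2]] lt eqB.
have h0 j : (-4) ^+ j * (odd_dfact j)%:R != 0 :> C.
  rewrite mulf_neq0 ?expf_neq0 ?oppr_eq0 ?pnatr_eq0 // -lt0n.
  by elim: j => //= j IH; rewrite muln_gt0.
suff e : p1 - p2 = 0.
  by rewrite h1 ?h2 //; try lia; move/eqP: e; rewrite subr_eq0 => /eqP ->.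
apply: (@roots_geq_poly_eq0 _ _ [seq j%:R | j <- iota n n.*2.+1]).
- apply/allP => _ /mapP [j + ->]; rewrite mem_iota => /andP[lenj ltj].
  have ltjk : (j < k)%N by lia.
  have := eqB j ltjk; rewrite h1 // h2 // => /(divIf (h0 j)) e.
  by rewrite /root hornerD hornerN e subrr.
- by rewrite map_inj_uniq ?iota_uniq // => i j /eqP; rewrite eqr_nat => /eqP.
rewrite size_map size_iota (leq_trans (size_polyD _ _)) //.
by rewrite size_polyN s1 s2 maxnn.
Qed.

Lemma unique_A (B : nat -> nat -> C) :
  cond_a B -> cond_b B -> cond_c B -> forall k n : nat, B k n = A C k n.
Proof.
move=> Ba Bb Bc; elim/ltn_ind => k IH n.
have [P [hP PB dP]] := Ba k; pose D := P - Aqm C k.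
have qserB Q1 Q2 : qser (Q1 - Q2) = qser Q1 - qser Q2 :> fps C by exact: rmorphB.
have hD : qmod_homog k.*2 D by apply: homogB => //; apply: homog_Aqm.
have DE i : qser D i = B k i - A C k i.
  by rewrite qserB fps_subE -qexpE PB qser_Aqm.
(* Condition (a) and the induction hypothesis equate q-expansions only; algebraic independence lifts
   this to polynomials, so D is free of G_2. *)
have dD : D^`M(ord0) = 0.
  apply: (homog_qser_eq0 (homog_mderiv hD)); apply: fpsP => i.
  rewrite mderivB qserB fps_subE -!qexpE dP.
  have -> : qexp (Aqm C k)^`M(ord0) i = 2 * (if k is k'.+1 then A C k' i else 0).
    rewrite qexpE dG2_Aqm qserZ fpsC_mulE; congr (_ * _).
    by case: (k) => [|k']; [rewrite (rmorph0 (@qser C)) | rewrite qser_Aqm].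
  by case: (k) IH => [|k'] IH; rewrite ?IH // subrr.
have D0 : D = 0.
  apply: (modular_valence hD dD) => i hi; rewrite DE; apply/eqP; rewrite subr_eq0; apply/eqP.
  have [lt|ge] := ltnP (3 * i) k.
    by apply: cond_b_next => //; [apply: A_cond_b | move=> j ltj; apply: IH].
  (* What is left is the constant term of A_0, fixed by (c). *)
  have i0 : i = 0%N by move: hi ge; case: eqP => //=; lia.
  have k0 : k = 0%N by move: ge; rewrite i0; lia.
  by rewrite i0 k0 Bc A_cond_c.
by apply/eqP; rewrite -subr_eq0 -DE D0 (rmorph0 (@qser C)).
Qed.

End Uniqueness.

Theorem theorem3p1 (C : numClosedFieldType) :
  [/\ cond_a (A C), cond_b (A C), cond_c (A C) &
      forall B : nat -> nat -> C,
        cond_a B -> cond_b B -> cond_c B -> forall k n : nat, B k n = A C k n].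
Proof.
split; [exact: A_cond_a | exact: A_cond_b | exact: A_cond_c | exact: unique_A].
Qed.
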